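(* Let $\sigma_0$ be a minimally degenerate Poisson structure on $Z_1$, i.e. a holomorphic Poisson structure whose degeneracy locus contains a fibre of $Z_1\to\mathbb P^1$ but does not contain the zero section $\ell$. Then all instantons on $Z_1$ are $\sigma_0$-tame; that is, for every charge $j$ and every $P\in\mathbb{MI}_j(Z_1)$ the stalk at $P$ of the quantizing sheaf $\mathcal Q^{\sigma_0}$ is trivial, i.e. the fibre over $P$ of the classical limit map $\mathbb{QI}^{(1)}_j(\mathcal Z_1(\sigma_0))\to\mathbb{MI}_j(Z_1)$ is a single point.
   Context: **Surface.** $Z_1=\mathrm{Tot}(\mathcal O_{\mathbb P^1}(-1))$ is covered by $U=\mathbb C^2_{(z,u)}$, $V=\mathbb C^2_{(\xi,v)}$, glued on $U\cap V=\mathbb C^*\times\mathbb C$ by $(\xi,v)=(z^{-1},zu)$. The zero section is $\ell=\{u=0\}\cup\{v=0\}$. A Poisson structure is a section $\sigma\in H^0(Z_1,\Lambda^2\mathcal T_{Z_1})$, written $\sigma_U\partial_z\wedge\partial_u$ on $U$ and $\sigma_V\partial_\xi\wedge\partial_v$ on $V$, with $\{f,g\}=\sigma_U(\partial_zf\,\partial_ug-\partial_uf\,\partial_zg)$ on $U$. Its degeneracy locus is the zero set of $\sigma_U,\sigma_V$. Coordinates are chosen so that the fibre contained in the degeneracy locus of $\sigma_0$ is $Z_1\setminus U=\{\xi=0\}$. **Quantization.** $\mathcal Z_1(\sigma_0)=(Z_1,\mathcal A)$ with $\mathcal A=(\mathcal O_{Z_1}[[\hbar]],\star)$ and $f\star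 g=fg+\{f,g\}\hbar+O(\hbar^2)$ associative, given by bidifferential operators. The superscript $(1)$ means working modulo $\hbar^2$, so only $fg+\{f,g\}\hbar$ matters. **Classical instantons.** $\mathrm{SU}(2)$ instantons on $Z_1$ correspond to rank $2$ holomorphic bundles with $c_1=0$. The splitting type is the $j\ge0$ with $E|_\ell\simeq\mathcal O(j)\oplus\mathcal O(-j)$. The charge of $E$ is $h^0(\mathbb C^2,(\tau_*E)^{\vee\vee}/\tau_*E)+h^0(\mathbb C^2,R^1\tau_*E)$, with $\tau\colon Z_1\to\mathbb C^2$ the contraction of $\ell$. Bundles are considered on the first formal neighbourhood $\ell^{(1)}$ of $\ell$ (terms $u^2$ are discarded), with transition matrix $T_p=\begin{pmatrix}z^j&p\\0&z^{-j}\end{pmatrix}$, $p=\sum_{l=2-j}^{j-1}p_{1,l}z^lu\ne0$, $j\ge2$. Two of them are isomorphic on $\ell^{(1)}$ iff the $p$ are proportional. $\mathbb{MI}_j(Z_1)$ is the set of points $P=[p_{1,2-j}:\cdots:p_{1,j-1}]\in\mathbb P^{2j-3}$ whose bundle has charge $j$. **Quantum instantons.** $\mathbb{QI}^{(1)}_j(\mathcal Z_1(\sigma_0))$ is the set of equivalence classes of pairs $(p,p')$, representing transition matrices $T_{p+p'\hbar}=\begin{pmatrix}z^j&p+p'\hbar\\0&z^{-j}\end{pmatrix}$, with $p,p'$ both of the form $\sum_{l=2-j}^{j-1}(\cdot)z^lu$ and $p$ defining a point of $\mathbb{MI}_j(Z_1)$. Equivalence (generated by): $(p,p')\sim(q,q')$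 if there are $\star$-invertible $2\times 2$ matrices $A_U,A_V$ over $\mathcal A(U)/\hbar^2$, $\mathcal A(V)/\hbar^2$ with $A_V=T_{p+p'\hbar}\star A_U\star T_{q+q'\hbar}^{-1}$ on $U\cap V$ modulo $\hbar^2$, where after computing the product all terms $u^i$ with $i\ge2$ are discarded. The classical limit map sends the class of $(p,p')$ to the point $P$ defined by $p$. **Rebel/tame.** The quantum moduli space is viewed as the étale space of a sheaf $\mathcal Q^{\sigma_0}$ (the quantizing sheaf) over the classical one, whose stalk at $P$ is the fibre of the classical limit map over $P$. An instanton $P$ is rebel for $\sigma_0$ if the stalk is nontrivial (positive-dimensional), and $\sigma_0$-tame otherwise. *)

(* Defs.v *)
From mathcomp Require Import all_boot all_order all_algebra.
From mathcomp Require Import all_classical all_reals all_analysis.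
From mathcomp Require Import complex.
From Stdlib Require Import Relation_Operators.

Set Implicit Arguments.
Unset Strict Implicit.
Unset Printing Implicit Defensive.

Import Order.TTheory GRing.Theory Num.Theory.
Import numFieldNormedType.Exports.

Local Open Scope classical_set_scope.
Local Open Scope ring_scope.

(* Typed as an abstract field so that the topology and the normed module
   structure that every [numFieldType] carries over itself are found. *)
Definition Cplx (R : realType) : numClosedFieldType := R[i].

Section Defs.
Variable R : realType.
Local Notation C := (Cplx R).
Local Notation C2 := (C * C)%type.

Definition holo (W : set C2) (f : C2 -> C) : Prop :=
  forall x, W x -> differentiable f x.

Definition mx2 (T : Type) (a b c d : T) : 'M[T]_2 :=
  \matrix_(i, k) if i == 0 then if k == 0 then a else b
                 else if k == 0 then c else d.

(* Functions on U and V are functions of the coordinates (z, u), (xi, v). A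
   function on U /\ V is a function of (z, u), relevant where z <> 0 only. *)
Definition UV : set C2 := [set x | x.1 != 0].

Definition glue (x : C2) : C2 := (x.1^-1, x.1 * x.2).

(* The contraction Z_1 -> C^2 of the zero section, on U and on V. *)
Definition tauU (x : C2) : C2 := (x.2, x.1 * x.2).
Definition tauV (y : C2) : C2 := (y.1 * y.2, y.2).

(* The Jacobian determinant of [glue] is - z^-1, whence
   d_z /\ d_u = - z^-1 d_xi /\ d_v. *)
Record poisson (sU sV : C2 -> C) : Prop := Poisson {
  poisson_holoU : holo setT sU;
  poisson_holoV : holo setT sV;
  poisson_glue : forall x, UV x -> sV (glue x) = - x.1^-1 * sU x }.

Definition degenerate_along_ell (sU sV : C2 -> C) : Prop :=
  (forall z, sU (z, 0) = 0) /\ (forall xi, sV (xi, 0) = 0).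

Definition degenerate_along_fibre (sV : C2 -> C) : Prop :=
  forall v, sV (0, v) = 0.

(* The coordinates are chosen so that the fibre is xi = 0. *)
Definition minimally_degenerate (sU sV : C2 -> C) : Prop :=
  [/\ poisson sU sV, degenerate_along_fibre sV & ~ degenerate_along_ell sU sV].

Definition bracket (s f g : C2 -> C) (x : C2) : C :=
  s x * ('D_((1, 0) : C2) f x * 'D_((0, 1) : C2) g x
         - 'D_((0, 1) : C2) f x * 'D_((1, 0) : C2) g x).

(* (f, f') stands for f + f' hbar. *)
Local Notation qfun := ((C2 -> C) * (C2 -> C))%type.

Definition star (s : C2 -> C) (f g : qfun) : qfun :=
  (fun x => f.1 x * g.1 x,
   fun x => f.1 x * g.2 x + f.2 x * g.1 x + bracket s f.1 g.1 x).

Definition starmx (s : C2 -> C) (A B : 'M[qfun]_2) : 'M[qfun]_2 :=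
  \matrix_(i, l) \sum_k star s (A i k) (B k l).

Definition onemx : 'M[qfun]_2 :=
  mx2 (cst 1, cst 0) (cst 0, cst 0) (cst 0, cst 0) (cst 1, cst 0).

Definition qholo (W : set C2) (A : 'M[qfun]_2) : Prop :=
  forall i k, holo W (A i k).1 /\ holo W (A i k).2.

Definition eq_on (W : set C2) (A B : 'M[qfun]_2) : Prop :=
  forall i k x, W x -> (A i k).1 x = (B i k).1 x /\ (A i k).2 x = (B i k).2 x.

Definition star_inverse (s : C2 -> C) (W : set C2) (A B : 'M[qfun]_2) : Prop :=
  [/\ qholo W B, eq_on W (starmx s A B) onemx & eq_on W (starmx s B A) onemx].

(* Equality on U /\ V of the coefficients of u^0 and u^1. *)
Definition eq_mod_u2 (f g : C2 -> C) : Prop :=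
  forall z : C, z != 0 ->
    f (z, 0) = g (z, 0) /\
    'D_((0, 1) : C2) f (z, 0) = 'D_((0, 1) : C2) g (z, 0).

(* A presheaf of modules over the sheaf of holomorphic functions on C^2, given
   by sections W / (sections W `&` zeros W) over every open W, all restrictions
   being induced by the identity of the ambient space. This covers sections
   represented by total functions, of which only the values over W matter.
   The expected closure properties are not part of the record. *)
Record presheaf := Presheaf {
  ambient : lmodType C;
  scal : (C2 -> C) -> ambient -> ambient;
  sections : set C2 -> set ambient;
  zeros : set C2 -> set ambient }.
Arguments sections : clear implicits.
Arguments zeros : clear implicits.

(* The sheaf of O-linear morphisms from F to O: a section over W is a family of
   maps F(W') -> O(W'), W' contained in W. *)
Definition dual_sections (F : presheaf) (W : set C2)
    (phi : set C2 -> ambient F -> C2 -> C) : Prop :=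
  forall W', open W' -> W' `<=` W ->
  [/\ forall s, sections F W' s -> holo W' (phi W' s),
      forall s, sections F W' s -> zeros F W' s ->
        forall x, W' x -> phi W' s x = 0,
      forall a s t, holo W' a -> sections F W' s -> sections F W' t ->
        forall x, W' x -> phi W' (scal a s + t) x = a x * phi W' s x + phi W' t x
    & forall W'' s, open W'' -> W'' `<=` W' -> sections F W' s ->
        forall x, W'' x -> phi W'' s x = phi W' s x].

Definition dual_zeros (F : presheaf) (W : set C2)
    (phi : set C2 -> ambient F -> C2 -> C) : Prop :=
  forall W' s, open W' -> W' `<=` W -> sections F W' s ->
    forall x, W' x -> phi W' s x = 0.

Definition dual (F : presheaf) : presheaf :=
  @Presheaf (set C2 -> ambient F -> C2 -> C^o)
    (fun a phi W s x => a x * phi W s x) (@dual_sections F) (@dual_zeros F).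

Definition bidual_map (F : presheaf) (s : ambient F) : ambient (dual (dual F)) :=
  fun W phi => phi W s.

Definition bidual_quotient (F : presheaf) : presheaf :=
  @Presheaf (ambient (dual (dual F))) (@scal (dual (dual F)))
    (sections (dual (dual F)))
    (fun W psi => exists2 s, sections F W s &
       zeros (dual (dual F)) W (psi - @bidual_map F s)).

(* Global sections of the associated sheaf, as sections of the etale space:
   [s x] represents the germ at [x]. *)
Definition zero_germ (F : presheaf) (x : C2) (s : ambient F) : Prop :=
  exists W, [/\ open W, W x & zeros F W s].

Arguments zero_germ : clear implicits.

Definition global_section (F : presheaf) (s : C2 -> ambient F) : Prop :=
  forall x, exists W, [/\ open W, W x, sections F W (s x)
    & forall y, W y -> zero_germ F y (s y - s x)].

Definition global_zero (F : presheaf) (s : C2 -> ambient F) : Prop :=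
  forall x, zero_germ F x (s x).

(* The quotient of the subspace S of V by its intersection with N has finite
   dimension n. *)
Definition quotient_dim (V : lmodType C) (S N : set V) (n : nat) : Prop :=
  exists e : 'I_n -> V,
  [/\ forall i, S (e i),
      forall v, S v -> exists c : 'I_n -> C, N (v - \sum_i c i *: e i)
    & forall c : 'I_n -> C, N (\sum_i c i *: e i) -> forall i, c i = 0].

Definition h0 (F : presheaf) (n : nat) : Prop :=
  @quotient_dim (C2 -> ambient F) (@global_section F) (@global_zero F) n.

(* The coefficient of index i is that of z^l u with l = i + 2 - j, so that l
   ranges over 2 - j, ..., j - 1. *)
Definition coeffs (j : nat) : Type := 'rV[C]_(2 * j - 2).

Definition pfun (j : nat) (p : coeffs j) (x : C2) : C :=
  \sum_(i < 2 * j - 2) p 0 i * x.1 ^ (i%:Z + 2 - j%:Z) * x.2.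

Definition transition (j : nat) (p : coeffs j) (x : C2) : 'M[C]_2 :=
  mx2 (x.1 ^+ j) (pfun p x) 0 (x.1 ^- j).

Definition vholo (W : set C2) (s : C2 -> 'cV[C]_2) : Prop :=
  forall i, holo W (fun x => s x i 0).

(* The direct image under tau of the bundle E on Z_1 with transition matrix
   T_p: a section over W is a pair (s_U, s_V) with s_V = T_p s_U over the
   inverse image of W. *)
Definition direct_image (j : nat) (p : coeffs j) : presheaf :=
  @Presheaf ((C2 -> 'cV[C]_2) * (C2 -> 'cV[C]_2))%type
    (fun a s => (fun x => a (tauU x) *: s.1 x, fun y => a (tauV y) *: s.2 y))
    (fun W s => [/\ vholo (tauU @^-1` W) s.1, vholo (tauV @^-1` W) s.2
       & forall x, UV x -> W (tauU x) -> s.2 (glue x) = transition p x *m s.1 x])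
    (fun W s => (forall x, W (tauU x) -> s.1 x = 0) /\
                (forall y, W (tauV y) -> s.2 y = 0)).

(* The first direct image is the sheaf associated with
   W |-> H^1(tau^-1 W, E), computed on the Cech cochains of the cover of
   tau^-1 W by its intersections with U and V, which are Stein if W is. *)
Definition first_direct_image (j : nat) (p : coeffs j) : presheaf :=
  @Presheaf (C2 -> 'cV[C]_2)
    (fun a s x => a (tauU x) *: s x)
    (fun W s => vholo (UV `&` tauU @^-1` W) s)
    (fun W s => exists sU sV,
       [/\ vholo (tauU @^-1` W) sU, vholo (tauV @^-1` W) sV
         & forall x, UV x -> W (tauU x) ->
             s x = sV (glue x) - transition p x *m sU x]).

Definition charge (j : nat) (p : coeffs j) (n : nat) : Prop :=
  exists w h, [/\ h0 (bidual_quotient (direct_image p)) w,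
                  h0 (first_direct_image p) h & n = (w + h)%N].

(* The point of projective space defined by p, as a set of coordinate vectors. *)
Definition proj_point (j : nat) (p : coeffs j) : set (coeffs j) :=
  [set q | exists2 c : C, c != 0 & q = c *: p].

Definition MI (j : nat) : set (set (coeffs j)) :=
  [set P | exists p : coeffs j, [/\ p != 0, P = proj_point p & charge p j]].

Definition qtransition (j : nat) (p p' : coeffs j) : 'M[qfun]_2 :=
  mx2 (fun x => x.1 ^+ j, cst 0) (pfun p, pfun p')
      (cst 0, cst 0) (fun x => x.1 ^- j, cst 0).

Definition qpair (j : nat) : set (coeffs j * coeffs j) :=
  [set P | MI (proj_point P.1)].

Definition qstep (sU sV : C2 -> C) (j : nat) (P Q : coeffs j * coeffs j) : Prop :=
  [/\ qpair P, qpair Q &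
  exists AU AV S : 'M[qfun]_2,
  [/\ qholo setT AU /\ (exists BU, star_inverse sU setT AU BU),
      qholo setT AV /\ (exists BV, star_inverse sV setT AV BV),
      star_inverse sU UV (qtransition Q.1 Q.2) S
    & forall i k,
        let M := starmx sU (starmx sU (qtransition P.1 P.2) AU) S in
        eq_mod_u2 ((AV i k).1 \o glue) (M i k).1 /\
        eq_mod_u2 ((AV i k).2 \o glue) (M i k).2]].

Definition qclass (sU sV : C2 -> C) (j : nat) (P : coeffs j * coeffs j) :
    set (coeffs j * coeffs j) :=
  [set Q | clos_refl_sym_trans _ (@qstep sU sV j) P Q].

Definition QI (sU sV : C2 -> C) (j : nat) : set (set (coeffs j * coeffs j)) :=
  [set c | exists2 P, qpair P & c = qclass sU sV P].

(* The graph of the classical limit map from QI to MI. *)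
Definition classical_limit (j : nat) (c : set (coeffs j * coeffs j))
    (P : set (coeffs j)) : Prop :=
  exists2 x, c x & P = proj_point x.1.

(* The etale space of the quantizing sheaf is QI over MI, so that its stalks
   are the fibres of the classical limit map. *)
Definition quantizing_stalk (sU sV : C2 -> C) (j : nat) (P : set (coeffs j)) :
    set (set (coeffs j * coeffs j)) :=
  [set c | QI sU sV c /\ classical_limit c P].

Definition tame (sU sV : C2 -> C) (j : nat) (P : set (coeffs j)) : Prop :=
  exists c, quantizing_stalk sU sV P = [set c].

End Defs.

(* Main.v *)
(* Write p = pi(z) u and P = z^(j-2) pi, a polynomial of degree < 2j - 2. The
   images of the monomials z^m, 0 < m < j, are always independent in the first
   direct image, and every f of degree < j such that P f has no coefficient of
   index j - 1, ..., 2j - 3 gives an element of the bidual of the direct image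
   outside the direct image. Hence charge j means that the Toeplitz matrix sending
   f to these coefficients has the maximal rank j - 1.
     Since sV vanishes on the fibre xi = 0, the function sU(z, 0) = - z sV(1/z, 0)
   is entire with a limit at infinity, hence a constant s0, and s0 <> 0. A gauge
   transformation whose classical part is [[1, 0], [f, 1]] on ell, corrected in
   order u so as to be regular on both charts, changes p' through the brackets by
   2 j s0 pi (G_- - G_+), where G_- and G_+ are the parts of z^(-j-1) pi f with
   negative and nonnegative exponents; all other terms are absorbed by the hbar
   parts of the gauge transformation because sU z^-1 is regular on V, and a
   constant diagonal hbar part adds multiples of p. When the Toeplitz matrix has
   maximal rank, every p' is of this form: a Bezout relation between the
   generators of the polynomials apolar to P shows that the dual map is
   injective. So (p, p') ~ (p, 0), and (c p, 0) ~ (p, 0) by diag(c, 1). *)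
Require Import Defs.
From mathcomp Require Import all_boot all_order all_algebra.
From mathcomp Require Import all_classical all_reals all_analysis.
From mathcomp Require Import complex ring lra zify.
From Stdlib Require Import Relation_Operators.

Set Implicit Arguments.
Unset Strict Implicit.
Unset Printing Implicit Defensive.

Import Order.TTheory GRing.Theory Num.Theory.
Import numFieldNormedType.Exports.

Local Open Scope classical_set_scope.
Local Open Scope ring_scope.
Local Open Scope complex_scope.

Local Notation Re := complex.Re.
Local Notation Im := complex.Im.

(** * Toeplitz matrices and signed products of polynomials *)

Section LinearAlgebra.
Variable K : fieldType.
Implicit Types P f : {poly K}.

(** The charge enters through lower bounds only: [j.-1] classes in the first direct image and one
    class of the bidual quotient per kernel vector of the Toeplitz matrix, so charge [j] leaves room
    for a kernel of dimension at most 1. An element of the bidual is built by dividing a holomorphic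
    function of two variables by a coordinate; its differentiability at the origin is a Hartogs-type
    statement. This and Liouville arguments along ell are what the Cauchy theory on squares is for.
    Diagonal hbar terms always split between the charts. Only the upper right entry at order u has a
    gap, the exponents 2, ..., 2j - 1, exactly those of z^j p' / u. The minus sign between G_- and
    G_+ has two sources: the order u correction of the classical gauge removes the nonnegative part
    from the bracket term of that entry and leaves G_-, while the diagonal hbar corrections on U,
    conjugated by the transition matrix, contribute - G_+. Because of this sign the linear system is
    not plain multiplication by P^2, and its surjectivity is read off from the dual map. *)

Lemma kernel_vector m n (A : 'M[K]_(m, n)) : (n < m)%N ->
  exists2 a : 'rV[K]_m, a != 0 & a *m A = 0.
Proof.
move=> nm; have k0 : kermx A != 0.
  rewrite -mxrank_eq0 mxrank_ker subn_eq0 -ltnNge.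
  by apply: leq_ltn_trans (rank_leq_col A) nm.
have [i ri] : exists i, row i (kermx A) != 0.
  apply/existsP; rewrite -negb_forall; apply: contra k0 => /forallP k.
  by apply/eqP/row_matrixP => i; rewrite row0; apply/eqP.
by exists (row i (kermx A)) => //; rewrite -row_mul mulmx_ker row0.
Qed.

Section Toeplitz.
Variables (j : nat) (P : {poly K}).
Hypothesis j2 : (2 <= j)%N.

(* The linear map sending a polynomial f with j coefficients to the coefficients
   of P * f of the indices j - 1, ..., 2 j - 3. *)
Definition toeplitz : 'M[K]_(j, j.-1) := \matrix_(k, a) P`_(a + j.-1 - k).

Lemma toeplitzE (v : 'rV[K]_j) (a : 'I_j.-1) :
  (v *m toeplitz) 0 a = (P * rVpoly v)`_(a + j.-1).
Proof.
rewrite mulrC coefM !mxE.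
have ja : (j <= (a + j.-1).+1)%N by lia.
rewrite -(big_mkord xpredT (fun i => (rVpoly v)`_i * P`_(a + j.-1 - i))).
rewrite (big_cat_nat (leq0n j) ja) /= [X in _ = _ + X](_ : _ = 0).
  by rewrite addr0 big_mkord; apply: eq_bigr => i _; rewrite mxE coef_rVpoly_ord.
rewrite big_nat_cond; apply: big1 => i /andP[/andP[ji _] _].
by rewrite nth_default ?mul0r// (leq_trans (size_poly _ _)).
Qed.

Lemma kernel_gap (v : 'rV[K]_j) : v *m toeplitz = 0 ->
  P * rVpoly v = take_poly j.-1 (P * rVpoly v)
               + 'X^(2 * j - 2) * drop_poly (2 * j - 2) (P * rVpoly v).
Proof.
move=> v0; apply/polyP => i; rewrite coefD coefXnM coef_take_poly coef_drop_poly.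
have [i1|i1] := ltnP i j.-1.
  by rewrite ifT ?addr0//; lia.
have [i2|i2] := ltnP i (2 * j - 2); last by rewrite add0r subnK.
have ia : (i - j.-1 < j.-1)%N by lia.
have := toeplitzE v (Ordinal ia); rewrite v0 mxE /= subnK// => <-.
by rewrite addr0.
Qed.

Hypothesis rank_toeplitz : \rank toeplitz = j.-1.

(** The full rank read on columns instead of rows: [toeplitz] applied to the reversed coefficients
    of [f] gives coefficients of [P * f], whence the smaller bound [j.-1] and a window starting one
    index lower, at [j.-2]. *)
Lemma toeplitz_inj f : (size f <= j.-1)%N ->
  (forall i, (j.-2 <= i < 2 * j - 2)%N -> (P * f)`_i = 0) -> f = 0.
Proof.
move=> sf fw; pose c : 'cV[K]_j.-1 := \col_a f`_(j.-2 - a).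
have c0 : toeplitz *m c = 0.
  apply/colP => k; rewrite !mxE.
  have := fw (2 * j - 3 - k)%N; have kj := ltn_ord k; rewrite (_ : _ && _); last by lia.
  move=> /(_ isT); rewrite mulrC coefM => w0.
  rewrite -[RHS]w0 (reindex_inj rev_ord_inj) /=.
  have le : (j.-1 <= (2 * j - 3 - k).+1)%N by lia.
  rewrite -(big_mkord xpredT (fun i => f`_i * P`_(2 * j - 3 - k - i))).
  rewrite (big_cat_nat (leq0n j.-1) le) /= [X in _ = _ + X](_ : _ = 0).
    rewrite addr0 big_mkord; apply: eq_bigr => i _; rewrite !mxE mulrC /=.
    have ij := ltn_ord i.
    by congr (f`_ _ * P`_ _); lia.
  rewrite big_nat_cond; apply: big1 => i /andP[/andP[ji _] _].
  by rewrite nth_default ?mul0r// (leq_trans sf).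
have /row_fullP[B BT] : row_full toeplitz by rewrite /row_full rank_toeplitz.
have {}c0 : c = 0 by rewrite -[c]mul1mx -BT -mulmxA c0 mulmx0.
apply/polyP => i; rewrite coef0; have [ij|ij] := ltnP i j.-1; last first.
  by rewrite nth_default// (leq_trans sf).
have ilt : (j.-2 - i < j.-1)%N by lia.
have := congr1 (fun c : 'cV[K]_j.-1 => c (Ordinal ilt) 0) c0; rewrite !mxE /=.
by rewrite subKn//; lia.
Qed.

Lemma toeplitz_surj (w : nat -> K) : exists2 f : {poly K}, (size f <= j)%N &
  forall a, (a < j.-1)%N -> (P * f)`_(a + j.-1) = w a.
Proof.
have /row_fullP[B BT] : row_full toeplitz by rewrite /row_full rank_toeplitz.
exists (rVpoly ((\row_a w a) *m B)); first exact: size_poly.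
move=> a aj; rewrite -(toeplitzE _ (Ordinal aj)) -mulmxA BT mulmx1.
by rewrite mxE.
Qed.

(** [toeplitz] has one more row than columns. Such an [f] serves as the first generator in the
    apolarity argument. *)
Lemma toeplitz_kernel : exists2 f : {poly K}, f != 0 & (size f <= j)%N /\
  forall i, (j.-1 <= i < 2 * j - 2)%N -> (P * f)`_i = 0.
Proof.
have [|v v0 vT] := kernel_vector toeplitz; first by lia.
exists (rVpoly v); first by rewrite -(inj_eq (can_inj (@rVpolyK _ _))) linear0 in v0 *.
split; first exact: size_poly.
move=> i iI; have ia : (i - j.-1 < j.-1)%N by lia.
have := toeplitzE v (Ordinal ia); rewrite vT mxE /= subnK => [<-//|]; lia.
Qed.

Lemma split_gap (g : {poly K}) m n : (m <= n)%N ->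
  (forall i, (m <= i < n)%N -> g`_i = 0) ->
  g = take_poly m g + 'X^n * drop_poly n g.
Proof.
move=> mn g0; apply/polyP => i; rewrite coefD coefXnM coef_take_poly coef_drop_poly.
have [i1|i1] := ltnP i m; first by rewrite ifT ?addr0//; lia.
have [i2|i2] := ltnP i n; last by rewrite add0r subnK.
by rewrite addr0; apply: g0; rewrite i1.
Qed.

Lemma size_monomial_factor (g h : {poly K}) n m : g = 'X^n * h ->
  (size g <= n + m)%N -> (size h <= m)%N.
Proof.
move=> ->; have [->|h0] := eqVneq h 0; first by rewrite size_poly0.
by rewrite mulrC size_mulXn//; lia.
Qed.

Lemma size_mul_le (g h : {poly K}) m n : (size g <= m)%N -> (size h <= n)%N ->
  (size (g * h)%R <= (m + n).-1)%N.
Proof. by move=> sg sh; rewrite (leq_trans (size_polyMleq _ _))//; lia. Qed.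

Lemma coefM_top (g h : {poly K}) m n : (size g <= m.+1)%N -> (size h <= n.+1)%N ->
  (g * h)`_(m + n) = g`_m * h`_n.
Proof.
move=> sg sh; rewrite coefM; have ml : (m < (m + n).+1)%N by rewrite ltnS leq_addr.
rewrite (bigD1 (Ordinal ml)) //= addKn big1 ?addr0// => k /negbTE km.
have {}km : (k == m :> nat) = false by rewrite -km.
have [mk|mk] := ltnP m k; first by rewrite nth_default ?mul0r// (leq_trans sg).
by rewrite [h`__]nth_default ?mulr0// (leq_trans sh)//; have := ltn_ord k; lia.
Qed.

Lemma coef_mul_window (g h : {poly K}) m lo hi : (size h <= m.+1)%N ->
  (forall i, (lo <= i <= hi)%N -> g`_i = 0) ->
  forall i, (lo + m <= i <= hi)%N -> (g * h)`_i = 0.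
Proof.
move=> sh g0 i iI; rewrite coefM big1// => k _.
have [mk|mk] := leqP (i - k) m; first by rewrite g0 ?mul0r//; have := ltn_ord k; lia.
by rewrite [h`__]nth_default ?mulr0// (leq_trans sh).
Qed.

(* Writing A, B for generators of the polynomials apolar to P, the two products
   of y with the tails of P * A and P * B measure y because of the Bezout-like
   relation B lo - A Qm = X^(2j - 2). *)
Lemma signed_window_inj (y : {poly K}) : (size y <= 2 * j - 2)%N ->
  (y * P)`_(2 * j - 3) = 0 ->
  (forall i, (2 * j - 4 <= i <= 4 * j - 5)%N ->
    (P * ('X^(2 * j - 2) * drop_poly (2 * j - 2) (y * P) - take_poly (2 * j - 3) (y * P)))`_i = 0) ->
  y = 0.
Proof.
move=> sy yc; set Z := y * P; set Zp := drop_poly _ Z; set Zm := take_poly _ Z => UP0.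
have ZE : Z = Zm + 'X^(2 * j - 2) * Zp.
  apply: split_gap => [|i iI]; first lia.
  by rewrite (_ : i = (2 * j - 3)%N) //; lia.
have sZm : (size Zm <= 2 * j - 3)%N by exact: size_take_poly.
have [A A0 [sA wA]] := toeplitz_kernel.
set lo := take_poly j.-1 (P * A); set Ph := drop_poly (2 * j - 2) (P * A).
have PA : P * A = lo + 'X^(2 * j - 2) * Ph by apply: split_gap => //; lia.
have slo : (size lo <= j.-1)%N by exact: size_take_poly.
(* If both vanished, [A] would be one size smaller and the gap of [P * A] one index longer, so
   [toeplitz_inj] would give [A = 0]. *)
have nz : (A`_j.-1 != 0) || (lo`_j.-2 != 0).
  rewrite -negb_and; apply: contra A0 => /andP[/eqP a0 /eqP l0].
  apply/eqP; apply: toeplitz_inj => [|i iI].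
    apply/leq_sizeP => k kj; have [->//|kj'] := eqVneq k j.-1.
    by rewrite nth_default// (leq_trans sA)//; lia.
  have [ii|ii] := eqVneq i j.-2; last by apply: wA; lia.
  by move: l0; rewrite /lo coef_take_poly -ii ifT => [->//|]; lia.
have [b [q bq]] : exists b q : K, b * lo`_j.-2 - A`_j.-1 * q = 1.
  case/orP: nz => n0; first by exists 0, (- (A`_j.-1)^-1); rewrite mul0r sub0r mulrN opprK mulfV.
  by exists ((lo`_j.-2)^-1), 0; rewrite mulr0 subr0 mulVf.
(* The second generator [B] has degree at most [j] and coefficient [b] at [j]; [B0] adjusts the
   coefficients of [P * B] of indices j - 1, ..., 2j - 3 to q, 0, ..., 0. *)
have [B0 sB0 wB0] := toeplitz_surj (fun a => (if a == 0%N then q else 0) - b * (P * 'X^j)`_(a + j.-1)).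
pose B := B0 + b%:P * 'X^j.
have sB : (size B <= j.+1)%N.
  rewrite (leq_trans (size_polyD _ _))// geq_max (leq_trans sB0)//=.
  by rewrite mul_polyC (leq_trans (size_scale_leq _ _))// size_polyXn.
have wB a : (a < j.-1)%N -> (P * B)`_(a + j.-1) = if a == 0%N then q else 0.
  move=> aj; rewrite mulrDr coefD wB0// mulrCA coefCM subrK//.
set Qm := take_poly j (P * B); set Qh := drop_poly (2 * j - 2) (P * B).
have sQm : (size Qm <= j)%N by exact: size_take_poly.
have PB : P * B = Qm + 'X^(2 * j - 2) * Qh.
  apply: split_gap => [|i iI]; first lia.
  have := wB (i - j.-1)%N; rewrite subnK; last lia.
  by rewrite ifF => [->//|]; lia.
have Bj : B`_j = b.
  by rewrite coefD coefCM coefXn eqxx mulr1 nth_default ?add0r.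
have Qj : Qm`_j.-1 = q.
  have := wB 0%N; rewrite add0n /= => <-; last lia.
  by rewrite coef_take_poly ifT//; lia.
(* Both products agree with [P * A * B] modulo X^(2j - 2), and their degrees are at most 2j - 2. So
   only the top coefficient is left, which is 1 by the choice of [b] and [q]. *)
have Bez : B * lo - A * Qm = 'X^(2 * j - 2).
  have E : B * lo - A * Qm = 'X^(2 * j - 2) * (A * Qh - B * Ph).
    have -> : lo = P * A - 'X^(2 * j - 2) * Ph by rewrite PA addrK.
    have -> : Qm = P * B - 'X^(2 * j - 2) * Qh by rewrite PB addrK.
    by ring.
  have sE : (size (B * lo - A * Qm)%R <= (2 * j - 2) + 1)%N.
    rewrite (leq_trans (size_polyD _ _))// geq_max size_polyN.
    by rewrite (leq_trans (size_mul_le sB slo)) ?(leq_trans (size_mul_le sA sQm))//; lia.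
  have /size1_polyC H := size_monomial_factor E sE.
  have := congr1 (fun g : {poly K} => g`_(2 * j - 2)) E; rewrite /= [X in _ = X]coefXnM ltnn subnn.
  rewrite E; move: H; set c := (A * Qh - B * Ph) => H cE; rewrite [c in LHS]H -cE -E.
  suff -> : (B * lo - A * Qm)`_(2 * j - 2) = 1 by rewrite polyC1 mulr1.
  rewrite coefB; have e1 : (2 * j - 2 = j + j.-2)%N by lia.
  have e2 : (2 * j - 2 = j.-1 + j.-1)%N by lia.
  rewrite {1}e1 coefM_top//; last by rewrite (leq_trans slo)//; lia.
  rewrite e2 coefM_top//; last by rewrite (leq_trans sQm)//; lia.
    by rewrite Bj Qj.
  by rewrite (leq_trans sA)//; lia.
set n := (2 * j - 2)%N in ZE PA PB Bez *.
(* The Bezout relation gives [X^n * y = B * (lo * y - A * Zm) + A * (B * Zm - Qm * y)]; both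
   brackets are divisible by [X^n], with quotients [D] and [E], and each quotient is killed by
   [toeplitz_inj]. *)
pose D := A * Zp - Ph * y; pose E := Qh * y - B * Zp.
have DE : lo * y - A * Zm = 'X^n * D.
  have -> : lo = P * A - 'X^n * Ph by rewrite PA addrK.
  have -> : Zm = y * P - 'X^n * Zp by rewrite -/Z ZE addrK.
  by rewrite /D; ring.
have EE : B * Zm - Qm * y = 'X^n * E.
  have -> : Qm = P * B - 'X^n * Qh by rewrite PB addrK.
  have -> : Zm = y * P - 'X^n * Zp by rewrite -/Z ZE addrK.
  by rewrite /E; ring.
have yE : y = B * D + A * E.
  apply: (@mulfI _ 'X^n); first by rewrite monic_neq0 ?monicXn.
  by rewrite mulrDr !(mulrCA 'X^n) -DE -EE -[in LHS]Bez; ring.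
have Xn0 : 'X^n != 0 :> {poly K} by rewrite monic_neq0 ?monicXn.
have sD : (size D <= j.-2)%N.
  apply: (size_monomial_factor DE); rewrite (leq_trans (size_polyD _ _))// geq_max size_polyN.
  by rewrite (leq_trans (size_mul_le slo sy)) ?(leq_trans (size_mul_le sA sZm))//; rewrite /n; lia.
have sE : (size E <= j.-1)%N.
  apply: (size_monomial_factor EE); rewrite (leq_trans (size_polyD _ _))// geq_max size_polyN.
  by rewrite (leq_trans (size_mul_le sB sZm)) ?(leq_trans (size_mul_le sQm sy))//; rewrite /n; lia.
set U := 'X^n * Zp - Zm in UP0.
have PD : 'X^n * (P * D) = (P * U) * A + (Zm * lo - 'X^(n + n) * (Zp * Ph)).
  rewrite mulrCA -DE exprD /U.
  have -> : P * ('X^n * Zp - Zm) * A = (P * A) * ('X^n * Zp - Zm) by ring.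
  have -> : P * (lo * y - A * Zm) = lo * Z - (P * A) * Zm by rewrite /Z; ring.
  by rewrite PA ZE; ring.
have PE : 'X^n * (P * E) = - ((P * U) * B) + ('X^(n + n) * (Zp * Qh) - Zm * Qm).
  rewrite mulrCA -EE exprD /U.
  have -> : P * ('X^n * Zp - Zm) * B = (P * B) * ('X^n * Zp - Zm) by ring.
  have -> : P * (B * Zm - Qm * y) = (P * B) * Zm - Qm * Z by rewrite /Z; ring.
  by rewrite PB ZE; ring.
have shift (g : {poly K}) i : g`_i = ('X^n * g)`_(n + i).
  by rewrite coefXnM ltnNge leq_addr /= addKn.
(* The coefficients of [P * D] are read off at indices shifted by [n]. Multiplication by [A]
   shortens the window of [P * U] from below, and the other two products lie strictly below and
   above what remains. *)
have D0 : D = 0.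
  apply: toeplitz_inj => [|i iI]; first by rewrite (leq_trans sD)//; lia.
  rewrite shift PD coefD coefB (coef_mul_window (m := j.-1) _ UP0); last 2 first.
  - by rewrite (leq_trans sA)//; lia.
  - by rewrite /n; lia.
  rewrite coefXnM ifT; last by rewrite /n; lia.
  rewrite nth_default ?subr0 ?addr0// (leq_trans (size_mul_le sZm slo))//.
  by move: iI; rewrite /n; lia.
have E0 : E = 0.
  apply: toeplitz_inj => [|i iI]; first by rewrite (leq_trans sE).
  rewrite shift PE coefD coefB coefN (coef_mul_window (m := j) sB UP0); last by rewrite /n; lia.
  rewrite coefXnM ifT; last by rewrite /n; lia.
  rewrite nth_default ?subr0 ?oppr0 ?addr0// (leq_trans (size_mul_le sZm sQm))//.
  by move: iI; rewrite /n; lia.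
by rewrite yE D0 E0 !mulr0 addr0.
Qed.

(** For [g = P * f] and G = z^(-j-1) pi f = z^-(2j-1) P f this is z^(2j-1) (G_- - G_+): the cut at
    2j - 1 separates the negative from the nonnegative exponents of G. *)
Definition signed_split (g : {poly K}) : {poly K} :=
  take_poly (2 * j - 1) g - 'X^(2 * j - 1) * drop_poly (2 * j - 1) g.

Lemma signed_split_sum n (u : 'I_n -> K) (g : 'I_n -> {poly K}) :
  signed_split (\sum_t u t *: g t) = \sum_t u t *: signed_split (g t).
Proof.
apply/polyP => i; rewrite /signed_split coefB coefXnM coef_take_poly coef_drop_poly.
rewrite !coef_sum.
have E t : (u t *: signed_split (g t))`_i = (if (i < 2 * j - 1)%N then u t * (g t)`_i else - (u t * (g t)`_i)).
  rewrite coefZ /signed_split coefB coefXnM coef_take_poly coef_drop_poly.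
  by case: ltnP => ij; rewrite ?subr0// sub0r subnK// mulrN.
under [RHS]eq_bigr do rewrite E.
case: ltnP => ij; first by rewrite subr0; apply: eq_bigr => t _; rewrite coefZ.
by rewrite sub0r subnK// -sumrN; apply: eq_bigr => t _; rewrite coefZ.
Qed.

(* The rows of the linear map in f and mu span everything, because a functional y
   vanishing on them is zero by [signed_window_inj]. *)
Lemma signed_window_surj (v : nat -> K) (s : K) : s != 0 ->
  exists f : {poly K}, exists2 mu : K, (size f <= (2 * j).+1)%N &
  forall k, (k < 2 * j - 2)%N ->
    v k + s * (P * signed_split (P * f))`_(k + (2 * j - 1)) + mu * P`_k = 0.
Proof.
move=> s0.
pose A : 'M[K]_((2 * j).+1, 2 * j - 2) :=
  \matrix_(t, k) (s * (P * signed_split (P * 'X^t))`_(k + (2 * j - 1))).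
pose r : 'rV[K]_(2 * j - 2) := \row_k P`_k.
pose M := col_mx A r.
have Mfull : row_full M.
  rewrite /row_full -mxrank_tr -[_ == _]/(row_free M^T) -kermx_eq0.
  apply/eqP/row_matrixP => i; rewrite row0; set y := row i _.
  have yM : y *m M^T = 0 by apply/sub_kermxP; exact: row_sub.
  (* The reversed vector, so that pairing [y] with a window of coefficients becomes a single
     coefficient of a product. *)
  pose yh : {poly K} := \poly_(i < 2 * j - 2) (if insub (2 * j - 3 - i)%N is Some k then y 0 k else 0).
  have yhE g m : (yh * g)`_(2 * j - 3 + m) = \sum_k y 0 k * g`_(k + m).
    rewrite coefM.
    have le : (2 * j - 2 <= (2 * j - 3 + m).+1)%N by lia.
    rewrite -(big_mkord xpredT (fun i => yh`_i * g`_(2 * j - 3 + m - i))).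
    rewrite (big_cat_nat (leq0n _) le) /= [X in _ + X](_ : _ = 0).
      rewrite addr0 big_mkord (reindex_inj rev_ord_inj) /=; apply: eq_bigr => k _.
      rewrite coef_poly; have kj := ltn_ord k; rewrite ifT; last by lia.
      rewrite (_ : (2 * j - 3 - (2 * j - 2 - k.+1) = k)%N); last by lia.
      by rewrite valK; congr (_ * g`_ _); lia.
    rewrite big_nat_cond; apply: big1 => k /andP[/andP[jk _] _].
    by rewrite nth_default ?mul0r// (leq_trans (size_poly _ _)).
  have yM1 (t : 'I_(2 * j).+1) : (yh * (P * signed_split (P * 'X^t)))`_(4 * j - 4) = 0.
    have e : (4 * j - 4 = 2 * j - 3 + (2 * j - 1))%N by lia.
    rewrite e yhE; apply: (mulfI s0); rewrite mulr0 mulr_sumr.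
    have := congr1 (fun w : 'rV[K]_((2 * j).+1 + 1) => w 0 (lshift 1 t)) yM.
    rewrite [LHS]mxE [RHS]mxE => e0; apply: etrans e0; apply: eq_bigr => k _.
    by rewrite [M^T _ _]mxE /M col_mxEu [A _ _]mxE mulrCA.
  have yM2 : (yh * P)`_(2 * j - 3) = 0.
    rewrite -[(2 * j - 3)%N]addn0 yhE.
    have := congr1 (fun w : 'rV[K]_((2 * j).+1 + 1) => w 0 (rshift _ 0)) yM.
    rewrite [LHS]mxE [RHS]mxE => e0; apply: etrans e0; apply: eq_bigr => k _.
    by rewrite [M^T _ _]mxE /M col_mxEd [r _ _]mxE addn0.
  suff yh0 : yh = 0.
    apply/rowP => k; rewrite [RHS]mxE; have kj := ltn_ord k.
    have := congr1 (fun g : {poly K} => g`_(2 * j - 3 - k)) yh0.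
    rewrite coef0 coef_poly ifT; last by lia.
    rewrite (_ : (2 * j - 3 - (2 * j - 3 - k) = k)%N); last by lia.
    by rewrite valK.
  apply: signed_window_inj => //; first exact: size_poly.
  set Z := yh * P; set Zp := drop_poly _ Z; set Zm := take_poly _ Z => m mI.
  have ZE : Z = Zm + 'X^(2 * j - 2) * Zp.
    apply: split_gap => [|k kI]; first lia.
    by rewrite (_ : k = (2 * j - 3)%N) //; lia.
  (* Multiplying by [X^t] moves the index [m] to 4j - 4; the degrees t <= 2j reach every index of
     the window in [signed_window_inj]. *)
  have tlt : (4 * j - 4 - m < (2 * j).+1)%N by lia.
  have := yM1 (Ordinal tlt) => /=; set t := (4 * j - 4 - m)%N.
  set U := _ - Zm; set Qt := take_poly (2 * j - 1) (P * 'X^t).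
  set Qd := drop_poly (2 * j - 1) (P * 'X^t) => Z0.
  have QE : P * 'X^t = Qt + 'X^(2 * j - 1) * Qd.
    by apply: split_gap => [|k]; lia.
  (* The sign can be moved from the splitting of [P * X^t] to that of [Z], up to products that miss
     the index 4j - 4: [Zm * Qt] stays below it, the multiple of X^(4j - 3) above. *)
  have E : yh * (P * signed_split (P * 'X^t)) =
      'X^t * (P * U) + ((Zm * Qt) *+ 2 - 'X^(2 * j - 2 + (2 * j - 1)) * ((Zp * Qd) *+ 2)).
    have -> : signed_split (P * 'X^t) = Qt - 'X^(2 * j - 1) * Qd by [].
    have -> : 'X^t * (P * U) = (P * 'X^t) * U by ring.
    by rewrite QE mulrA -/Z ZE /U exprD; ring.
  move: Z0; rewrite E coefD coefB [X in _ + (_ - X)]coefXnM ifT; last by lia.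
  rewrite [X in _ + (X - _)]nth_default ?subr0 ?addr0.
    rewrite coefXnM ifF; last by rewrite /t; lia.
    by rewrite (_ : (4 * j - 4 - t = m)%N) // /t; lia.
  rewrite -scaler_nat (leq_trans (size_scale_leq _ _))//.
  rewrite (leq_trans (size_mul_le (size_take_poly _ _) (size_take_poly _ _)))//; lia.
have /row_fullP[B BM] := Mfull.
pose u := - (\row_k v k) *m B.
pose w := lsubmx u.
have fE : rVpoly w = \sum_t w 0 t *: 'X^t.
  by rewrite /rVpoly poly_def; apply: eq_bigr => t _; rewrite valK.
exists (rVpoly w), (rsubmx u 0 0); first exact: size_poly.
move=> k kj; have uM : u *m M = - (\row_k v k) by rewrite -mulmxA BM mulmx1.
have : (w *m A + rsubmx u *m r) 0 (Ordinal kj) = - v k.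
  by rewrite -mul_row_col hsubmxK uM !mxE.
rewrite [LHS]mxE [(rsubmx u *m r) 0 _]mxE big_ord1 [r _ _]mxE [(w *m A) 0 _]mxE /= => /eqP.
rewrite -eqr_oppLR => /eqP <-.
rewrite [X in - (X + _)](_ : _ = s * (P * signed_split (P * rVpoly w))`_(k + (2 * j - 1))); last first.
  rewrite fE mulr_sumr.
  under [in RHS]eq_bigr do rewrite -scalerAr.
  rewrite signed_split_sum !mulr_sumr coef_sum mulr_sumr; apply: eq_bigr => t _.
  by rewrite [A _ _]mxE -scalerAr coefZ mulrCA.
ring.
Qed.

End Toeplitz.
End LinearAlgebra.

(** * Contour integrals and Cauchy's formula *)

Section RealIntegral.
Variable R : realType.
Implicit Types (f g : R -> R) (a b c M : R).

Definition ri f a b : R := \int[lebesgue_measure]_(x in `[a, b]) f x.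

Definition continuous_on (T : topologicalType) (f : R -> T) a b :=
  forall t, a <= t <= b -> {for t, continuous f}.

Lemma continuous_onS (T : topologicalType) (f : R -> T) a b a' b' :
  a <= a' -> b' <= b -> continuous_on f a b -> continuous_on f a' b'.
Proof.
move=> aa bb cf t /andP[at' tb]; apply: cf.
by rewrite (le_trans aa)//= (le_trans tb).
Qed.

Lemma continuous_on_integrable f a b : continuous_on f a b ->
  lebesgue_measure.-integrable `[a, b] (EFin \o f).
Proof.
move=> cf; apply: continuous_compact_integrable; first exact: segment_compact.
apply: continuous_in_subspaceT => t; rewrite inE /= in_itv /=; exact: cf.
Qed.
Hint Resolve continuous_on_integrable : core.

Let msegment a b : measurable (`[a, b] : set R). Proof. exact: measurable_itv. Qed.
Hint Resolve msegment : core.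

Lemma fine_segment a b : a <= b ->
  fine (lebesgue_measure (`[a, b] : set R)) = b - a.
Proof.
move=> ab; rewrite lebesgue_measure_itv /= lte_fin; case: ltgtP ab => //= -> _.
by rewrite subrr.
Qed.

Lemma ri_cat f a b c : a <= c <= b -> continuous_on f a b ->
  ri f a b = ri f a c + ri f c b.
Proof.
move=> /andP[ac cb] cf; apply/eqP; rewrite addrC -subr_eq; apply/eqP.
rewrite /ri Rintegral_itvB ?bnd_simp//; last exact: continuous_on_integrable.
rewrite Rintegral_itv_obnd_cbnd//.
apply: integrableS (continuous_on_integrable cf) => //.
by apply: subset_itv; rewrite ?bnd_simp.
Qed.

Lemma riD f g a b : continuous_on f a b -> continuous_on g a b ->
  ri (fun t => f t + g t) a b = ri f a b + ri g a b.
Proof. by move=> cf cg; rewrite /ri RintegralD//; apply: continuous_on_integrable. Qed.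

Lemma riZ r f a b : continuous_on f a b ->
  ri (fun t => r * f t) a b = r * ri f a b.
Proof. by move=> cf; rewrite /ri RintegralZl//; apply: continuous_on_integrable. Qed.

Lemma eq_ri f g a b : (forall t, a <= t <= b -> f t = g t) ->
  ri f a b = ri g a b.
Proof.
move=> fg; apply: eq_Rintegral => t; rewrite inE /= in_itv /=; exact: fg.
Qed.

Lemma ri_cst r a b : a <= b -> ri (cst r) a b = r * (b - a).
Proof. by move=> ab; rewrite /ri Rintegral_cst// fine_segment. Qed.

Lemma le_ri f g a b : continuous_on f a b -> continuous_on g a b ->
  (forall t, a <= t <= b -> f t <= g t) -> ri f a b <= ri g a b.
Proof.
by move=> cf cg fg; apply: le_Rintegral => //; exact: continuous_on_integrable.
Qed.

Lemma ri_norm f a b M : a <= b -> continuous_on f a b ->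
  (forall t, a <= t <= b -> `|f t| <= M) -> `|ri f a b| <= M * (b - a).
Proof.
move=> ab cf fM; rewrite ler_norml -mulNr -!ri_cst//.
have cc r : continuous_on (cst r : R -> R) a b by move=> t _; apply: cvg_cst.
by apply/andP; split; apply: le_ri => // t /fM; rewrite ler_norml => /andP[].
Qed.

Lemma ri_id a b : a <= b -> ri id a b = (b ^+ 2 - a ^+ 2) / 2.
Proof.
rewrite le_eqVlt => /predU1P[<-|ab].
  by rewrite /ri set_itv1 Rintegral_set1 subrr mul0r.
have dF (t : R) : is_derive t (1 : R) (fun x : R => x ^+ 2 / 2) t.
  have -> : (fun x : R => x ^+ 2 / 2) = (2^-1 \*: (@id R ^+ 2)).
    by apply/funext => x; rewrite /= -[RHS]/(_ * _) mulrC.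
  apply: is_derive_eq; rewrite /= expr1 /GRing.scale /=; lra.
have cF (t : R) : {for t, continuous (fun x : R => x ^+ 2 / 2)}.
  by apply: differentiable_continuous; apply/derivable1_diffP; case: (dF t).
rewrite /ri /Rintegral (@continuous_FTC2 _ _ (fun x => x ^+ 2 / 2))//=; first lra.
- by apply: continuous_subspaceT => x; apply: cvg_id.
- split; first by move=> x _; case: (dF x).
  + by apply: cvg_at_right_filter; exact: cF.
  + by apply: cvg_at_left_filter; exact: cF.
- by move=> x _; rewrite derive1E; case: (dF x).
Qed.

End RealIntegral.

(** * Modulus of complex numbers and integrals of complex-valued functions *)

Section ComplexNorm.
Variable R : realType.
Local Notation C := (Cplx R).

(** The norm of [Cplx R] takes values in [Cplx R] itself; the real modulus allows real arithmetic in
    the estimates. *)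
Definition nrm (z : C) : R := ComplexField.Normc.normc z.

Lemma normCE (z : C) : `|z| = (nrm z)%:C :> C. Proof. by []. Qed.

Lemma nrmD (x y : C) : nrm (x + y) <= nrm x + nrm y.
Proof. exact: le_normcD. Qed.
Lemma nrmM (x y : C) : nrm (x * y) = nrm x * nrm y.
Proof. exact: ComplexField.Normc.normcM. Qed.
Lemma nrmN (x : C) : nrm (- x) = nrm x.
Proof. exact: normcN. Qed.
Lemma nrmV (x : C) : nrm x^-1 = (nrm x)^-1.
Proof. exact: ComplexField.Normc.normcV. Qed.
Lemma nrm0 : nrm 0 = 0. Proof. exact: ComplexField.Normc.normc0. Qed.
Lemma nrm_ge0 (x : C) : 0 <= nrm x.
Proof. by rewrite -lecR -normCE normr_ge0. Qed.
Lemma nrm_eq0 (x : C) : (nrm x == 0) = (x == 0).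
Proof.
apply/eqP/eqP => [/ComplexField.Normc.eq0_normc//|->]; exact: nrm0.
Qed.
Lemma nrm_gt0 (x : C) : (0 < nrm x) = (x != 0).
Proof. by rewrite lt_neqAle nrm_ge0 andbT eq_sym nrm_eq0. Qed.
Lemma nrmB (x y : C) : nrm (x - y) = nrm (y - x).
Proof. by rewrite -nrmN opprB. Qed.
Lemma nrm_tri (y x z : C) : nrm (x - z) <= nrm (x - y) + nrm (y - z).
Proof. by rewrite -[x - z](subrKA y) nrmD. Qed.

Lemma nrm_real (r : R) : nrm r%:C = `|r|.
Proof. by rewrite /nrm /= expr0n addr0 sqrtr_sqr. Qed.
Lemma nrm_i : nrm 'i = 1.
Proof. by rewrite /nrm /= expr0n /= add0r expr1n sqrtr1. Qed.

Lemma Re_le_nrm (z : C) : `|Re z| <= nrm z.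
Proof.
case: z => a b; rewrite /nrm /= -sqrtr_sqr ler_sqrt ?addr_ge0 ?sqr_ge0//.
by rewrite lerDl sqr_ge0.
Qed.
Lemma Im_le_nrm (z : C) : `|Im z| <= nrm z.
Proof.
case: z => a b; rewrite /nrm /= -sqrtr_sqr ler_sqrt ?addr_ge0 ?sqr_ge0//.
by rewrite lerDr sqr_ge0.
Qed.

Lemma complexRI (z : C) : z = (Re z)%:C + 'i * (Im z)%:C.
Proof. exact: complexE. Qed.

Lemma nrm_le_ReIm (z : C) : nrm z <= `|Re z| + `|Im z|.
Proof. by rewrite {1}[z]complexRI (le_trans (nrmD _ _))// nrmM nrm_i mul1r !nrm_real. Qed.

Lemma Re_add (x y : C) : Re (x + y) = Re x + Re y. Proof. by case: x y => ? ? []. Qed.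
Lemma Im_add (x y : C) : Im (x + y) = Im x + Im y. Proof. by case: x y => ? ? []. Qed.
Lemma Re_opp (x : C) : Re (- x) = - Re x. Proof. by case: x. Qed.
Lemma Im_opp (x : C) : Im (- x) = - Im x. Proof. by case: x. Qed.
Lemma Re_mul (x y : C) : Re (x * y) = Re x * Re y - Im x * Im y.
Proof. by case: x y => ? ? []. Qed.
Lemma Im_mul (x y : C) : Im (x * y) = Re x * Im y + Im x * Re y.
Proof. by case: x y => ? ? []. Qed.

Lemma ball_nrm (x y : C) (e : R) : ball x e%:C y = (nrm (x - y) < e) :> Prop.
Proof. by rewrite -ball_normE /ball_ /= normCE ltcR. Qed.

Lemma posC (e : C) : 0 < e -> exists2 r : R, 0 < r & e = r%:C.
Proof.
move=> e0; have /complex_realP[r re] : e \is Num.real by apply: gtr0_real.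
by exists r => //; rewrite -ltcR -re.
Qed.

Lemma nbhs_nrm (x : C) (A : set C) :
  nbhs x A <-> exists2 e : R, 0 < e & forall y, nrm (x - y) < e -> A y.
Proof.
split=> [/nbhs_ballP[e /= /posC[r r0 ->] eA]|[e e0 eA]].
  by exists r => // y xy; apply: eA; rewrite ball_nrm.
apply/nbhs_ballP; exists e%:C; first by rewrite /= ltcR.
by move=> y; rewrite ball_nrm; apply: eA.
Qed.

Lemma cvg_nrm (T : Type) (F : set_system T) (FF : Filter F) (f : T -> C) (l : C) :
  f @ F --> l <-> forall e : R, 0 < e -> \forall t \near F, nrm (l - f t) < e.
Proof.
split=> [fl e e0|H].
  by have := fl [set y | nrm (l - y) < e]; apply; apply/nbhs_nrm; exists e.
by move=> A /nbhs_nrm[e e0 eA]; near=> t; apply: eA; near: t; exact: H.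
Unshelve. all: by end_near. Qed.

Lemma Re_continuous : continuous (fun z : C => Re z : R).
Proof.
move=> z; apply: (proj2 (@cvgrPdist_lt _ _ _ _ (nbhs_filter (z : C)) _ _)) => e e0; apply/nbhs_nrm; exists e => // y zy.
by rewrite -Re_opp -Re_add (le_lt_trans (Re_le_nrm _)).
Qed.

Lemma Im_continuous : continuous (fun z : C => Im z : R).
Proof.
move=> z; apply: (proj2 (@cvgrPdist_lt _ _ _ _ (nbhs_filter (z : C)) _ _)) => e e0; apply/nbhs_nrm; exists e => // y zy.
by rewrite -Im_opp -Im_add (le_lt_trans (Im_le_nrm _)).
Qed.

Lemma real_complex_continuous : continuous (fun t : R => t%:C : C).
Proof.
move=> t; apply/cvg_nrm => e e0; near=> s.
rewrite -rmorphB nrm_real; near: s.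
by apply: (@cvgr_dist_lt _ R) => //; exact: cvg_id.
Unshelve. all: by end_near. Qed.

End ComplexNorm.
Arguments nrm {R} z : simpl never.

Section ComplexIntegral.
Variable R : realType.
Local Notation C := (Cplx R).
Implicit Types (f g : R -> C) (a b c M : R).

Definition ci f a b : C :=
  ri (fun t => Re (f t)) a b +i* ri (fun t => Im (f t)) a b.

Lemma continuous_on_Re f a b : continuous_on f a b ->
  continuous_on (fun t => Re (f t)) a b.
Proof.
move=> cf t tab; apply: (@continuous_comp _ _ _ f (fun z : C => Re z)); first exact: cf.
exact: Re_continuous.
Qed.

Lemma continuous_on_Im f a b : continuous_on f a b ->
  continuous_on (fun t => Im (f t)) a b.
Proof.
move=> cf t tab; apply: (@continuous_comp _ _ _ f (fun z : C => Im z)); first exact: cf.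
exact: Im_continuous.
Qed.

Lemma continuous_onD f g a b : continuous_on f a b -> continuous_on g a b ->
  continuous_on (fun t => f t + g t) a b.
Proof. by move=> cf cg t tab; apply: cvgD; [exact: cf|exact: cg]. Qed.

Lemma continuous_onM f g a b : continuous_on f a b -> continuous_on g a b ->
  continuous_on (fun t => f t * g t) a b.
Proof. by move=> cf cg t tab; apply: cvgM; [exact: cf|exact: cg]. Qed.

Lemma continuous_on_real a b : continuous_on (fun t : R => t%:C : C) a b.
Proof. by move=> t _; exact: real_complex_continuous. Qed.

Lemma ci_cat f a b c : a <= c <= b -> continuous_on f a b ->
  ci f a b = ci f a c + ci f c b.
Proof.
move=> acb cf; rewrite /ci (@ri_cat _ _ a b c)//; last exact: continuous_on_Re.
by rewrite (@ri_cat _ (fun t => Im (f t)) a b c)//; exact: continuous_on_Im.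
Qed.

Lemma eq_ci f g a b : (forall t, a <= t <= b -> f t = g t) -> ci f a b = ci g a b.
Proof. by move=> fg; rewrite /ci; congr Complex; apply: eq_ri => t /fg ->. Qed.

Lemma ciD f g a b : continuous_on f a b -> continuous_on g a b ->
  ci (fun t => f t + g t) a b = ci f a b + ci g a b.
Proof.
move=> cf cg; rewrite /ci.
under eq_ri do rewrite Re_add.
under [X in _ +i* X]eq_ri do rewrite Im_add.
by rewrite !riD//; (exact: continuous_on_Re || exact: continuous_on_Im).
Qed.

Lemma ciZ (k : C) f a b : continuous_on f a b ->
  ci (fun t => k * f t) a b = k * ci f a b.
Proof.
move=> cf; have [cR cI] := (continuous_on_Re cf, continuous_on_Im cf).
have cZ (h : R -> R) r : continuous_on h a b -> continuous_on (fun t => r * h t) a b.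
  by move=> ch t tab; apply: cvgM; [exact: cvg_cst|exact: ch].
rewrite /ci.
under eq_ri do rewrite Re_mul -mulNr.
under [X in _ +i* X]eq_ri do rewrite Im_mul.
rewrite !riD ?riZ//; try exact: cZ.
by case: k => u v /=; rewrite mulNr.
Qed.

(** Real and imaginary parts are bounded separately, which costs the factor 2. *)
Lemma ci_norm f a b M : a <= b -> continuous_on f a b ->
  (forall t, a <= t <= b -> nrm (f t) <= M) -> nrm (ci f a b) <= 2 * M * (b - a).
Proof.
move=> ab cf fM; rewrite (le_trans (nrm_le_ReIm _))//= -mulrA mulr_natl mulr2n.
rewrite lerD//; apply: ri_norm => //.
- exact: continuous_on_Re.
- by move=> t /fM; exact/le_trans/Re_le_nrm.
- exact: continuous_on_Im.
- by move=> t /fM; exact/le_trans/Im_le_nrm.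
Qed.

Lemma ci_cst (k : C) a b : a <= b -> ci (fun _ => k) a b = k * (b - a)%:C.
Proof. by move=> ab; rewrite /ci !ri_cst//; case: k => x y; simpc. Qed.

Lemma ci_id a b : a <= b -> ci (fun t => t%:C) a b = (b%:C ^+ 2 - a%:C ^+ 2) / 2%:R.
Proof.
move=> ab; rewrite /ci /= ri_cst// mul0r ri_id//.
rewrite -[LHS]/(((b ^+ 2 - a ^+ 2) / 2)%:C).
by rewrite rmorphM rmorphB !rmorphXn /= fmorphV rmorph_nat.
Qed.

End ComplexIntegral.
Arguments ci {R} f a b : simpl never.

(** * Boundary integrals over rectangles *)

Section Rectangles.
Variable R : realType.
Local Notation C := (Cplx R).
Implicit Types (phi psi : C -> C) (a b c d : R) (z : C).

Definition pt (x y : R) : C := x%:C + 'i * y%:C.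

Lemma Re_pt x y : Re (pt x y) = x.
Proof. by rewrite /pt Re_add Re_mul /= !(mul0r, mulr0, subr0, addr0). Qed.
Lemma Im_pt x y : Im (pt x y) = y.
Proof. by rewrite /pt Im_add Im_mul /= !(mul0r, mul1r, mulr0, add0r, addr0). Qed.

Definition rect a b c d : set C := [set z | a <= Re z <= b /\ c <= Im z <= d].

(** The counterclockwise contour integral along the boundary of [rect a b c d]; on the vertical
    sides dz is ['i] dt. *)
Definition bd phi a b c d : C :=
  ci (fun t => phi (pt t c)) a b + 'i * ci (fun t => phi (pt b t)) c d
  - ci (fun t => phi (pt t d)) a b - 'i * ci (fun t => phi (pt a t)) c d.

Definition edges_continuous phi a b c d :=
  [/\ continuous_on (fun t => phi (pt t c)) a b,
      continuous_on (fun t => phi (pt b t)) c d,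
      continuous_on (fun t => phi (pt t d)) a b &
      continuous_on (fun t => phi (pt a t)) c d].

Lemma continuous_pt1 y : continuous (fun t => pt t y).
Proof. by move=> t; apply: cvgD; [exact: real_complex_continuous|exact: cvg_cst]. Qed.

Lemma continuous_pt2 x : continuous (fun t => pt x t).
Proof.
move=> t; apply: cvgD; first exact: cvg_cst.
by apply: cvgM; [exact: cvg_cst|exact: real_complex_continuous].
Qed.

Lemma continuous_on_pt1 phi a b y :
  (forall t, a <= t <= b -> {for pt t y, continuous phi}) ->
  continuous_on (fun t => phi (pt t y)) a b.
Proof.
move=> cphi t tab; apply: (@continuous_comp _ _ _ (fun t => pt t y) phi).
  exact: continuous_pt1.
exact: cphi.
Qed.

Lemma continuous_on_pt2 phi a b x :
  (forall t, a <= t <= b -> {for pt x t, continuous phi}) ->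
  continuous_on (fun t => phi (pt x t)) a b.
Proof.
move=> cphi t tab; apply: (@continuous_comp _ _ _ (fun t => pt x t) phi).
  exact: continuous_pt2.
exact: cphi.
Qed.

Lemma rect_edges_continuous phi a b c d : a <= b -> c <= d ->
  (forall z, rect a b c d z -> {for z, continuous phi}) ->
  edges_continuous phi a b c d.
Proof.
move=> ab cd cphi.
by split; (apply: continuous_on_pt1 || apply: continuous_on_pt2) => t tI;
  apply: cphi; split; rewrite ?Re_pt ?Im_pt ?lexx ?ab ?cd.
Qed.

Lemma bd_splitH phi a m b c d : a <= m <= b ->
  continuous_on (fun t => phi (pt t c)) a b ->
  continuous_on (fun t => phi (pt t d)) a b ->
  bd phi a b c d = bd phi a m c d + bd phi m b c d.
Proof.
by move=> amb cc cd; rewrite /bd (ci_cat amb cc) (ci_cat amb cd); ring.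
Qed.

Lemma bd_splitV phi a b c m d : c <= m <= d ->
  continuous_on (fun t => phi (pt a t)) c d ->
  continuous_on (fun t => phi (pt b t)) c d ->
  bd phi a b c d = bd phi a b c m + bd phi a b m d.
Proof.
by move=> cmd ca cb; rewrite /bd (ci_cat cmd ca) (ci_cat cmd cb); ring.
Qed.

Lemma bdD phi psi a b c d :
  edges_continuous phi a b c d -> edges_continuous psi a b c d ->
  bd (fun z => phi z + psi z) a b c d = bd phi a b c d + bd psi a b c d.
Proof.
by move=> [? ? ? ?] [? ? ? ?]; rewrite /bd !ciD//; ring.
Qed.

Lemma bdZ (k : C) phi a b c d : edges_continuous phi a b c d ->
  bd (fun z => k * phi z) a b c d = k * bd phi a b c d.
Proof.
by move=> [? ? ? ?]; rewrite /bd !ciZ//; ring.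
Qed.

Lemma eq_bd phi psi a b c d : a <= b -> c <= d ->
  (forall z, rect a b c d z -> (Re z \in [:: a; b]) || (Im z \in [:: c; d]) ->
   phi z = psi z) ->
  bd phi a b c d = bd psi a b c d.
Proof.
move=> ab cd e; rewrite /bd.
by congr (_ + _ * _ - _ - _ * _); apply: eq_ci => t tI;
  (apply: e; [split|]); rewrite ?Re_pt ?Im_pt ?lexx ?ab ?cd ?inE ?eqxx ?orbT.
Qed.

Lemma bd_norm phi a b c d M : a <= b -> c <= d -> edges_continuous phi a b c d ->
  (forall z, rect a b c d z -> (Re z \in [:: a; b]) || (Im z \in [:: c; d]) ->
   nrm (phi z) <= M) ->
  nrm (bd phi a b c d) <= 4 * M * ((b - a) + (d - c)).
Proof.
move=> ab cd [c1 c2 c3 c4] pM.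
have b1 : nrm (ci (fun t => phi (pt t c)) a b) <= 2 * M * (b - a).
  by apply: ci_norm => // t tI; (apply: pM; [split|]);
    rewrite ?Re_pt ?Im_pt ?lexx ?ab ?cd ?inE ?eqxx ?orbT.
have b2 : nrm (ci (fun t => phi (pt b t)) c d) <= 2 * M * (d - c).
  by apply: ci_norm => // t tI; (apply: pM; [split|]);
    rewrite ?Re_pt ?Im_pt ?lexx ?ab ?cd ?inE ?eqxx ?orbT.
have b3 : nrm (ci (fun t => phi (pt t d)) a b) <= 2 * M * (b - a).
  by apply: ci_norm => // t tI; (apply: pM; [split|]);
    rewrite ?Re_pt ?Im_pt ?lexx ?ab ?cd ?inE ?eqxx ?orbT.
have b4 : nrm (ci (fun t => phi (pt a t)) c d) <= 2 * M * (d - c).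
  by apply: ci_norm => // t tI; (apply: pM; [split|]);
    rewrite ?Re_pt ?Im_pt ?lexx ?ab ?cd ?inE ?eqxx ?orbT.
rewrite /bd; set x1 := ci _ _ _ in b1 *; set x2 := ci _ _ _ in b2 *.
set x3 := ci _ _ _ in b3 *; set x4 := ci _ _ _ in b4 *.
have := nrmD (x1 + 'i * x2 - x3) (- ('i * x4)).
have := nrmD (x1 + 'i * x2) (- x3).
have := nrmD x1 ('i * x2).
rewrite !nrmN !nrmM !nrm_i !mul1r; lra.
Qed.

Lemma bd_affine (k l : C) a b c d : a <= b -> c <= d ->
  bd (fun z => k + l * z) a b c d = 0.
Proof.
move=> ab cd.
have cst1 (x y : C) u v : continuous_on (fun t => x + y * t%:C) u v.
  by apply: continuous_onD; [|apply: continuous_onM];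
    rewrite ?/(continuous_on _ _ _) => t _; (exact: cvg_cst || exact: real_complex_continuous).
have ciA (x y : C) u v : u <= v -> ci (fun t => x + y * t%:C) u v =
    x * (v - u)%:C + y * ((v%:C ^+ 2 - u%:C ^+ 2) / 2%:R).
  move=> uv; rewrite ciD; last 2 first.
  - by move=> t _; exact: cvg_cst.
  - by apply: continuous_onM => t _; (exact: cvg_cst || exact: real_complex_continuous).
  rewrite ciZ ?ci_cst ?ci_id//; exact: continuous_on_real.
have E1 y u v : u <= v -> ci (fun t => k + l * pt t y) u v =
    (k + l * ('i * y%:C)) * (v - u)%:C + l * ((v%:C ^+ 2 - u%:C ^+ 2) / 2%:R).
  move=> uv; rewrite -ciA//; apply: eq_ci => t _; rewrite /pt; ring.
have E2 x u v : u <= v -> ci (fun t => k + l * pt x t) u v =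
    (k + l * x%:C) * (v - u)%:C + (l * 'i) * ((v%:C ^+ 2 - u%:C ^+ 2) / 2%:R).
  move=> uv; rewrite -ciA//; apply: eq_ci => t _; rewrite /pt; ring.
rewrite /bd !E1// !E2// !rmorphB /=.
have i2 : ('i : C) * 'i = -1 by rewrite -expr2 sqr_i.
ring: i2.
Qed.

End Rectangles.
Arguments pt {R} x y : simpl never.
Arguments bd {R} phi a b c d : simpl never.

(** * Goursat's theorem *)

Section Goursat.
Variable R : realType.
Local Notation C := (Cplx R).
Implicit Types (phi q : C -> C) (a b c d : R).

Lemma differentiable_linear_approx phi (z : C) : differentiable phi z ->
  exists l : C, forall e : R, 0 < e -> exists2 dl : R, 0 < dl &
    forall y, nrm (y - z) < dl -> nrm (phi y - phi z - l * (y - z)) <= e * nrm (y - z).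
Proof.
move=> /derivable1_diffP dphi; exists ('D_1 phi z) => e e0.
have /cvg_nrm /(_ _ e0) nr : (fun h : C => h^-1 *: ((phi \o shift z) (h *: (1 : C)) - phi z)) @ 0^'
    --> 'D_1 phi z by exact: dphi.
have /nbhs_nrm[dl dl0 H] : nbhs (0 : C) [set h : C | h != 0 ->
   nrm ('D_1 phi z - h^-1 *: ((phi \o shift z) (h *: (1 : C)) - phi z)) < e] by exact: nr.
exists dl => // y yz.
have [->|ynz] := eqVneq y z.
  by rewrite !subrr mulr0 subrr nrm0 mulr0.
have h0 : y - z != 0 by rewrite subr_eq0.
have := H (y - z); rewrite sub0r nrmN => /(_ yz h0) /=.
rewrite /shift /= /GRing.scale /= mulr1 subrK => /ltW K.
have -> : phi y - phi z - 'D_1 phi z * (y - z) =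
    ((y - z)^-1 * (phi y - phi z) - 'D_1 phi z) * (y - z) by field.
by rewrite nrmM nrmB ler_wpM2r// nrm_ge0.
Qed.

Lemma rect_nrm a b c d (x y : C) : rect a b c d x -> rect a b c d y ->
  nrm (x - y) <= (b - a) + (d - c).
Proof.
move=> [/andP[? ?] /andP[? ?]] [/andP[? ?] /andP[? ?]].
rewrite (le_trans (nrm_le_ReIm _))// Re_add Im_add Re_opp Im_opp lerD// ler_norml; lra.
Qed.

Lemma rect_bdS a b c d a' b' c' d' : a <= a' -> b' <= b -> c <= c' -> d' <= d ->
  rect a' b' c' d' `<=` rect a b c d.
Proof. by move=> ? ? ? ? z [/andP[? ?] /andP[? ?]]; split; apply/andP; split; lra. Qed.

Lemma continuous_affine (k l z : C) : {for z, continuous (fun z : C => k + l * z)}.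
Proof.
apply: (@cvgD _ _ _ (nbhs z) _ (fun _ => k) (fun z => l * z)); first exact: cvg_cst.
by apply: (@cvgM _ _ (nbhs z) _ (fun _ => l) (fun z => z)); [exact: cvg_cst|exact: cvg_id].
Qed.

(** By [bd_affine], [phi] may be replaced by the error of its linear approximation at [z0], which is
    at most [e] times the half-perimeter. *)
Lemma bd_small phi (z0 : C) a b c d (l : C) (e dl : R) : 0 <= e ->
  a <= b -> c <= d -> rect a b c d z0 ->
  (forall z, rect a b c d z -> {for z, continuous phi}) ->
  (forall y, nrm (y - z0) < dl -> nrm (phi y - phi z0 - l * (y - z0)) <= e * nrm (y - z0)) ->
  (b - a) + (d - c) < dl ->
  nrm (bd phi a b c d) <= 4 * e * ((b - a) + (d - c)) ^+ 2.
Proof.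
move=> e0 ab cd rz0 cphi H small.
pose k : C := phi z0 - l * z0.
have ca : edges_continuous (fun z => (- k) + (- l) * z) a b c d.
  by apply: (rect_edges_continuous ab cd) => z _; exact: continuous_affine.
have cp := rect_edges_continuous ab cd cphi.
have -> : bd phi a b c d = bd (fun z => phi z + ((- k) + (- l) * z)) a b c d.
  by rewrite bdD// bd_affine// addr0.
rewrite expr2 mulrA -[4 * e * _]mulrA; apply: (bd_norm ab cd).
  have [c1 c2 c3 c4] := cp; have [d1 d2 d3 d4] := ca.
  by split; [exact: (continuous_onD c1)|exact: (continuous_onD c2)
            |exact: (continuous_onD c3)|exact: (continuous_onD c4)].
move=> z rz _; have zz0 := rect_nrm rz rz0.
have -> : phi z + (- k + - l * z) = phi z - phi z0 - l * (z - z0) by rewrite /k; ring.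
by apply: le_trans (H _ (le_lt_trans zz0 small)) _; rewrite ler_wpM2l.
Qed.

Lemma bd_quarter phi a c w h : 0 <= w -> 0 <= h ->
  (forall z, rect a (a + w) c (c + h) z -> {for z, continuous phi}) ->
  exists2 s : R * R,
    [/\ a <= s.1, s.1 + w / 2 <= a + w, c <= s.2 & s.2 + h / 2 <= c + h] &
    nrm (bd phi a (a + w) c (c + h)) / 4 <=
      nrm (bd phi s.1 (s.1 + w / 2) s.2 (s.2 + h / 2)).
Proof.
move=> w0 h0 cphi.
have cH y : c <= y <= c + h -> continuous_on (fun t => phi (pt t y)) a (a + w).
  by move=> yI; apply: continuous_on_pt1 => t tI; apply: cphi; split; rewrite ?Re_pt ?Im_pt.
have cV x : a <= x <= a + w -> continuous_on (fun t => phi (pt x t)) c (c + h).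
  by move=> xI; apply: continuous_on_pt2 => t tI; apply: cphi; split; rewrite ?Re_pt ?Im_pt.
have E : bd phi a (a + w) c (c + h) =
   (bd phi a (a + w / 2) c (c + h / 2) + bd phi a (a + w / 2) (c + h / 2) (c + h)) +
   (bd phi (a + w / 2) (a + w) c (c + h / 2) + bd phi (a + w / 2) (a + w) (c + h / 2) (c + h)).
  rewrite (@bd_splitH _ phi a (a + w / 2)); [|lra|apply: cH; lra|apply: cH; lra].
  by congr (_ + _); rewrite (@bd_splitV _ phi _ _ c (c + h / 2))//; try lra; apply: cV; lra.
set x1 := bd phi a (a + w / 2) c (c + h / 2) in E.
set x2 := bd phi a (a + w / 2) (c + h / 2) (c + h) in E.
set x3 := bd phi (a + w / 2) (a + w) c (c + h / 2) in E.
set x4 := bd phi (a + w / 2) (a + w) (c + h / 2) (c + h) in E.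
have ew : a + w / 2 + w / 2 = a + w by lra.
have eh : c + h / 2 + h / 2 = c + h by lra.
clear cH cV cphi; rewrite E; clear E.
set K := nrm (x1 + x2 + (x3 + x4)) / 4.
have [k1|k1] := leP K (nrm x1); first by exists (a, c); [clear k1 K x1 x2 x3 x4; split=> /=; lra|exact: k1].
have [k2|k2] := leP K (nrm x2).
  by exists (a, c + h / 2); [clear k1 k2 K x1 x2 x3 x4; split=> /=; lra|rewrite /= eh].
have [k3|k3] := leP K (nrm x3).
  by exists (a + w / 2, c); [clear k1 k2 k3 K x1 x2 x3 x4; split=> /=; lra|rewrite /= ew].
exists (a + w / 2, c + h / 2); rewrite /= ?ew ?eh.
  by clear k1 k2 k3 K x1 x2 x3 x4; split=> /=; lra.
rewrite -/x4; clearbody x1 x2 x3 x4.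
have := nrmD (x1 + x2) (x3 + x4); have := nrmD x1 x2; have := nrmD x3 x4.
move: k1 k2 k3; rewrite /K; clear; lra.
Qed.

Lemma geometric_small (L dl : R) : 0 < dl -> exists n, L / 2 ^+ n < dl.
Proof.
move=> dl0; have [n nL] : exists n, `|L| / dl < n%:R.
  by exists (Num.bound (`|L| / dl)); rewrite (le_lt_trans _ (archi_boundP _))// divr_ge0// ltW.
exists n; rewrite ltr_pdivrMr ?exprn_gt0// mulrC -ltr_pdivrMr//.
apply: le_lt_trans (lt_le_trans nL _); first by rewrite ler_pM2r ?invr_gt0// ler_norm.
by rewrite -natrX ler_nat ltnW// ltn_expl.
Qed.

Lemma nested_point (s l : nat -> R) :
  (forall n, s n <= s n.+1 /\ s n.+1 + l n.+1 <= s n + l n) -> (forall n, 0 <= l n) ->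
  exists x, forall n, s n <= x <= s n + l n.
Proof.
move=> H l0.
have mono n k : s n <= s (n + k)%N /\ s (n + k)%N + l (n + k)%N <= s n + l n.
  elim: k => [|k [IH1 IH2]]; first by rewrite addn0.
  by rewrite addnS; have [h1 h2] := H (n + k)%N; split; lra.
have ub m n : s m <= s n + l n.
  have [mn|nm] := leqP m n.
    by have [h1 _] := mono m (n - m)%N; rewrite subnKC// in h1; have := l0 n; lra.
  have [_ h2] := mono n (m - n)%N; rewrite subnKC 1?ltnW// in h2; have := l0 m; lra.
exists (sup (range s)) => n; apply/andP; split.
  apply: ub_le_sup; last by exists n.
  by exists (s 0%N + l 0%N) => _ [m _ <-].
by apply: ge_sup; [exists (s 0%N); exists 0%N|move=> _ [m _ <-]].
Qed.

(** Repeated quartering keeps at least 4^-n of the integral while the rectangles shrink to a point,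
    where differentiability gives a bound of smaller order. *)
Lemma goursat phi a b c d : a <= b -> c <= d ->
  (forall z, rect a b c d z -> differentiable phi z) -> bd phi a b c d = 0.
Proof.
move=> ab cd dphi; pose w := b - a; pose h := d - c.
have w0 : 0 <= w by rewrite subr_ge0.
have h0 : 0 <= h by rewrite subr_ge0.
have cphi z : rect a b c d z -> {for z, continuous phi}.
  by move=> /dphi /differentiable_continuous.
pose wn n := w / 2 ^+ n; pose hn n := h / 2 ^+ n.
have pos2 n : 0 < (2 ^+ n)^-1 :> R by rewrite invr_gt0 exprn_gt0.
have wnS n : wn n / 2 = wn n.+1 by rewrite /wn exprS invfM; lra.
have hnS n : hn n / 2 = hn n.+1 by rewrite /hn exprS invfM; lra.
have wn0 n : 0 <= wn n by rewrite mulr_ge0// ltW.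
have hn0 n : 0 <= hn n by rewrite mulr_ge0// ltW.
pose bdn n (s : R * R) := bd phi s.1 (s.1 + wn n) s.2 (s.2 + hn n).
pose good n (s t : R * R) := [/\ s.1 <= t.1, t.1 + wn n.+1 <= s.1 + wn n, s.2 <= t.2,
  t.2 + hn n.+1 <= s.2 + hn n & nrm (bdn n s) / 4 <= nrm (bdn n.+1 t)].
(* The default value [S m] of the choice never occurs, by [step] and [inS]. *)
pose fix S n := if n is m.+1 then xget (S m) [set t | good m (S m) t] else (a, c).
pose In n (s : R * R) := [/\ a <= s.1, s.1 + wn n <= b, c <= s.2 & s.2 + hn n <= d].
have step m : In m (S m) -> good m (S m) (S m.+1).
  move=> [i1 i2 i3 i4].
  have [|t [t1 t2 t3 t4] t5] := @bd_quarter phi (S m).1 (S m).2 _ _ (wn0 m) (hn0 m).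
    by move=> z rz; apply: cphi; apply: rect_bdS rz.
  have gt : good m (S m) t by rewrite /good /bdn -wnS -hnS; split.
  exact: (@xgetI _ (S m) [set t | good m (S m) t] t gt).
have inS n : In n (S n).
  elim: n => [|n IH].
    by rewrite /In /wn /hn expr0 !divr1 /w /h !subrKC; split.
  have [k1 k2 k3 k4 _] := step n IH; case: IH => j1 j2 j3 j4.
  by split; [exact: le_trans k1|exact: le_trans k2 j2|exact: le_trans k3|exact: le_trans k4 j4].
have big n : nrm (bd phi a b c d) / 4 ^+ n <= nrm (bdn n (S n)).
  elim: n => [|n IH].
    by rewrite /bdn /wn /hn expr0 !divr1 /w /h /= !subrKC.
  have [_ _ _ _] := step n (inS n); apply: le_trans.
  by rewrite exprSr invfM mulrA ler_pM2r// invr_gt0.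
have [x xS] := @nested_point (fun n => (S n).1) wn
  (fun n => let: And5 k1 k2 _ _ _ := step n (inS n) in conj k1 k2) wn0.
have [y yS] := @nested_point (fun n => (S n).2) hn
  (fun n => let: And5 _ _ k3 k4 _ := step n (inS n) in conj k3 k4) hn0.
have rn n : rect (S n).1 ((S n).1 + wn n) (S n).2 ((S n).2 + hn n) (pt x y).
  by split; rewrite ?Re_pt ?Im_pt.
have sub n : rect (S n).1 ((S n).1 + wn n) (S n).2 ((S n).2 + hn n) `<=` rect a b c d.
  by have [? ? ? ?] := inS n; apply: rect_bdS.
have [l Hl] := differentiable_linear_approx (dphi _ (sub 0%N _ (rn 0%N))).
apply/eqP; rewrite -nrm_eq0; apply/negPn/negP => K0.
have {}K0 : 0 < nrm (bd phi a b c d) by rewrite lt_def K0 nrm_ge0.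
set K := nrm _ in K0 big.
(* The summand 1 keeps [L] positive for degenerate rectangles; the 8 in [e] makes the upper bound at
   most half of [K]. *)
pose L := w + h + 1; have L0 : 0 < L by rewrite /L; move: w0 h0; clear; lra.
pose e := K / (8 * L ^+ 2).
have e0 : 0 < e by rewrite divr_gt0// mulr_gt0// exprn_gt0.
have [dl dl0 H] := Hl e e0.
have [n nL] := geometric_small L dl0.
have whn : (S n).1 + wn n - (S n).1 + ((S n).2 + hn n - (S n).2) = (w + h) / 2 ^+ n.
  by rewrite mulrDl -/(wn n) -/(hn n); move: (S n) (wn n) (hn n); clear=> s u v; lra.
have := @bd_small phi (pt x y) (S n).1 ((S n).1 + wn n) (S n).2 ((S n).2 + hn n) l e dl (ltW e0).
rewrite !lerDl => /(_ (wn0 n) (hn0 n) (rn n) (fun z rz => cphi z (sub n z rz)) H).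
rewrite whn.
have small : (w + h) / 2 ^+ n < dl.
  by apply: le_lt_trans nL; rewrite ler_pM2r// /L lerDl.
move=> /(_ small) le1; have := le_trans (big n) le1.
have -> : 4 * e * ((w + h) / 2 ^+ n) ^+ 2 = (4 * e * (w + h) ^+ 2) / 4 ^+ n.
  by rewrite expr_div_n -exprM mulnC exprM -[2 ^+ 2]natrX /= mulrA.
rewrite ler_pM2r ?invr_gt0 ?exprn_gt0// /e; apply/negP; rewrite -ltNge.
have -> : 4 * (K / (8 * L ^+ 2)) * (w + h) ^+ 2 = K * ((w + h) ^+ 2 / L ^+ 2) / 2.
  by have := lt0r_neq0 L0; clear; move=> ?; field.
have : (w + h) ^+ 2 / L ^+ 2 <= 1.
  have wL : w + h <= L by rewrite lerDl.
  rewrite ler_pdivrMr ?exprn_gt0// mul1r; apply: lerXn2r wL; rewrite nnegrE; [exact: addr_ge0|exact: ltW L0].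
move: K0; clear; set q := (_ / _ ^+ 2); clearbody K q => K0 q1.
have : K * q <= K by rewrite ler_piMr// ltW.
by move: K0; clear; lra.
Qed.

End Goursat.

(** * Cauchy's formula on squares centred at the origin *)

Section Cauchy.
Variable R : realType.
Local Notation C := (Cplx R).
Implicit Types (phi q : C -> C) (a b c d r : R) (y z : C).

Definition frame a b c d : set C :=
  [set z | rect a b c d z /\ ((Re z \in [:: a; b]) || (Im z \in [:: c; d]))].

Lemma frame_edges_continuous phi a b c d : a <= b -> c <= d ->
  (forall z, frame a b c d z -> differentiable phi z) ->
  edges_continuous phi a b c d.
Proof.
move=> ab cd dphi.
by split; [apply: continuous_on_pt1|apply: continuous_on_pt2|apply: continuous_on_pt1
  |apply: continuous_on_pt2] => t tI; apply: differentiable_continuous; apply: dphi;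
  (split; [split|]); rewrite ?Re_pt ?Im_pt ?lexx ?ab ?cd ?inE ?eqxx ?orbT.
Qed.

(** The region between the rectangles is cut into full-height strips left and right of the inner one
    and two pieces below and above it; [goursat] applies to each. *)
Lemma bd_annulus phi a b c d a' b' c' d' :
  a <= a' -> a' < b' -> b' <= b -> c <= c' -> c' < d' -> d' <= d ->
  (forall z, rect a b c d z -> ~ (a' < Re z < b' /\ c' < Im z < d') ->
    differentiable phi z) ->
  bd phi a b c d = bd phi a' b' c' d'.
Proof.
move=> aa ab bb cc cd dd dphi.
have cphi z : rect a b c d z -> ~ (a' < Re z < b' /\ c' < Im z < d') ->
    {for z, continuous phi}.
  by move=> rz /(dphi _ rz) /differentiable_continuous.
have cH (y : R) : c <= y <= d -> ~ (c' < y < d') ->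
    continuous_on (fun t => phi (pt t y)) a b.
  move=> yI ny; apply: continuous_on_pt1 => t tI; apply: cphi.
    by split; rewrite ?Re_pt ?Im_pt.
  by rewrite Im_pt => -[].
have cV (x : R) : a <= x <= b -> ~ (a' < x < b') ->
    continuous_on (fun t => phi (pt x t)) c d.
  move=> xI nx; apply: continuous_on_pt2 => t tI; apply: cphi.
    by split; rewrite ?Re_pt ?Im_pt.
  by rewrite Re_pt => -[].
have G u v s t : a <= u -> u <= v -> v <= b -> c <= s -> s <= t -> t <= d ->
    (v <= a' \/ b' <= u) \/ (t <= c' \/ d' <= s) -> bd phi u v s t = 0.
  move=> au uv vb cs st td out; apply: goursat => // z rz.
  apply: dphi; first exact: rect_bdS rz.
  case: rz => /andP[r1 r2] /andP[r3 r4] [/andP[r5 r6] /andP[r7 r8]].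
  by case: out => -[] o; move: o r1 r2 r3 r4 r5 r6 r7 r8; clear; lra.
have ltI (u v : R) : u <= v -> ~ (v < u) by move=> uv; apply/negP; rewrite -leNgt.
rewrite (@bd_splitH _ phi a a'); last 3 first.
- by move: aa ab bb; clear; lra.
- by apply: cH; [move: cc cd dd; clear; lra|move: cc; clear=> ? /andP[]; lra].
- by apply: cH; [move: cc cd dd; clear; lra|move: dd; clear=> ? /andP[]; lra].
rewrite (G a a')//; last 3 first.
- by move: ab bb; clear; lra.
- by move: cc cd dd; clear; lra.
- by left; left.
rewrite add0r (@bd_splitH _ phi a' b'); last 3 first.
- by move: aa ab bb; clear; lra.
- apply: (@continuous_onS _ _ _ a b) => //.
  by apply: cH; [move: cc cd dd; clear; lra|move: cc; clear=> ? /andP[]; lra].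
- apply: (@continuous_onS _ _ _ a b) => //.
  by apply: cH; [move: cc cd dd; clear; lra|move: dd; clear=> ? /andP[]; lra].
rewrite (G b' b)//; last 3 first.
- by move: aa ab; clear; lra.
- by move: cc cd dd; clear; lra.
- by left; right.
rewrite addr0 (@bd_splitV _ phi _ _ c c'); last 3 first.
- by move: cc cd dd; clear; lra.
- by apply: cV; [move: aa ab bb; clear; lra|clear=> /andP[]; lra].
- by apply: cV; [move: aa ab bb; clear; lra|clear=> /andP[]; lra].
rewrite (G _ _ c c')//; last 3 first.
- by move: ab; clear; lra.
- by move: cd dd; clear; lra.
- by right; left.
rewrite add0r (@bd_splitV _ phi _ _ c' d'); last 3 first.
- by move: cc cd dd; clear; lra.
- apply: (@continuous_onS _ _ _ c d) => //.
  by apply: cV; [move: aa ab bb; clear; lra|clear=> /andP[]; lra].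
- apply: (@continuous_onS _ _ _ c d) => //.
  by apply: cV; [move: aa ab bb; clear; lra|clear=> /andP[]; lra].
rewrite (G _ _ d' d)//; last 3 first.
- by move: ab; clear; lra.
- by move: cc cd; clear; lra.
- by right; right.
by rewrite addr0.
Qed.

Lemma differentiable_subVr y z : z != y -> differentiable (fun z : C => (z - y)^-1) z.
Proof.
move=> zy; apply: (@differentiableV _ _ (fun z => z - y)); last by rewrite subr_eq0.
by apply: differentiableB.
Qed.

Lemma differentiable_div q y z : differentiable q z -> z != y ->
  differentiable (fun z => q z / (z - y)) z.
Proof.
by move=> dq zy; exact: (differentiableM dq (differentiable_subVr zy)).
Qed.

Lemma Re_inv (z : C) : Re z^-1 = Re z / (Re z ^+ 2 + Im z ^+ 2).
Proof. by case: z. Qed.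
Lemma Im_inv (z : C) : Im z^-1 = - (Im z / (Re z ^+ 2 + Im z ^+ 2)).
Proof. by case: z. Qed.

Definition bsq phi r : C := bd phi (- r) r (- r) r.
Definition fsq r : set C := frame (- r) r (- r) r.

Lemma fsq_nrm_ge r z : 0 < r -> fsq r z -> r <= nrm z.
Proof.
move=> r0 [_]; rewrite !inE => /orP[|] /orP[|] /eqP e;
  [apply: le_trans (Re_le_nrm z)|apply: le_trans (Re_le_nrm z)
  |apply: le_trans (Im_le_nrm z)|apply: le_trans (Im_le_nrm z)];
  by rewrite e ?normrN ger0_norm// ltW.
Qed.

Lemma fsq_rect r : fsq r `<=` rect (- r) r (- r) r.
Proof. by move=> z []. Qed.

Lemma rect_sq_nrm r z : rect (- r) r (- r) r z -> nrm z <= 2 * r.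
Proof.
move=> [rz iz]; apply: le_trans (nrm_le_ReIm z) _; rewrite mulr_natl mulr2n.
by rewrite lerD// ler_norml.
Qed.

Lemma nrm_rect_sq r z : nrm z <= r -> rect (- r) r (- r) r z.
Proof.
by move=> zr; split; rewrite -ler_norml; [exact: le_trans (Re_le_nrm z) zr|exact: le_trans (Im_le_nrm z) zr].
Qed.

Lemma fsq_neq r z y : nrm y < r -> fsq r z -> z != y.
Proof.
move=> yr fz; apply/eqP => zy; move: (fsq_nrm_ge (le_lt_trans (nrm_ge0 y) yr) fz).
by rewrite zy leNgt yr.
Qed.

Lemma bsq_norm phi r M : 0 < r -> (forall z, fsq r z -> differentiable phi z) ->
  (forall z, fsq r z -> nrm (phi z) <= M) -> nrm (bsq phi r) <= 16 * M * r.
Proof.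
move=> r0 dphi pM; have rr : - r <= r by move: r0; clear; lra.
have -> : 16 * M * r = 4 * M * ((r - - r) + (r - - r)) by ring.
apply: bd_norm => //; first exact: frame_edges_continuous.
by move=> z rz ez; apply: pM.
Qed.

Lemma bsq_annulus phi r r' : 0 < r -> r <= r' ->
  (forall z, rect (- r') r' (- r') r' z -> r <= nrm z -> differentiable phi z) ->
  bsq phi r' = bsq phi r.
Proof.
move=> r0 rr dphi; apply: bd_annulus; try by move: r0 rr; clear; lra.
move=> z rz nz; apply: dphi => //; rewrite leNgt; apply/negP => zr; apply: nz.
by split; rewrite -ltr_norml; [exact: le_lt_trans (Re_le_nrm z) zr|exact: le_lt_trans (Im_le_nrm z) zr].
Qed.

(* This is 2 pi i, but only its nonvanishing matters. *)
Definition lam : C := bsq GRing.inv 1.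

Lemma differentiable_inv z : z != 0 -> differentiable (GRing.inv : C -> C) z.
Proof. exact: differentiable_Rinv. Qed.

(* The integrand of the imaginary part is 1 / (1 + t^2) on each of the sides. *)
Lemma lam_neq0 : lam != 0.
Proof.
have n11 : (-1 : R) <= 1 by lra.
have [c1 c2 c3 c4] : edges_continuous (GRing.inv : C -> C) (- 1) 1 (- 1) 1.
  apply: (frame_edges_continuous n11 n11) => z fz; apply: differentiable_inv.
  by apply: (@fsq_neq 1) fz; rewrite nrm0.
have cc (k : R) : continuous_on (cst k : R -> R) (- 1) 1 by move=> t _; exact: cvg_cst.
have P (t : R) : -1 <= t <= 1 -> 1 / 2 <= 1 / (t ^+ 2 + 1).
  move=> t1; rewrite !div1r lef_pV2 ?posrE//; last by rewrite ltr_wpDl ?sqr_ge0.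
  have : t ^+ 2 <= 1 by move: t1; clear => /andP[]; nra.
  by clear; lra.
have h1 : ri (cst (1 / 2)) (- 1) 1 = 1 :> R by rewrite ri_cst//; lra.
have h2 : ri (cst (- (1 / 2))) (- 1) 1 = - 1 :> R by rewrite ri_cst//; lra.
have e1 : 1 <= ri (fun t : R => Im (pt t (- 1))^-1) (- 1) 1.
  rewrite -[X in X <= _]h1; apply: le_ri; [exact: cc|exact: continuous_on_Im c1|] => t /P.
  by rewrite Im_inv Re_pt Im_pt sqrrN expr1n mulNr opprK.
have e2 : 1 <= ri (fun t : R => Re (pt 1 t)^-1) (- 1) 1.
  rewrite -[X in X <= _]h1; apply: le_ri; [exact: cc|exact: continuous_on_Re c2|] => t /P.
  by rewrite Re_inv Re_pt Im_pt expr1n [1 + _]addrC.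
have e3 : ri (fun t : R => Im (pt t 1)^-1) (- 1) 1 <= - 1.
  rewrite -[X in _ <= X]h2; apply: le_ri; [exact: continuous_on_Im c3|exact: cc|] => t /P.
  by rewrite Im_inv Re_pt Im_pt expr1n lerN2.
have e4 : ri (fun t : R => Re (pt (- 1) t)^-1) (- 1) 1 <= - 1.
  rewrite -[X in _ <= X]h2; apply: le_ri; [exact: continuous_on_Re c4|exact: cc|] => t /P.
  by rewrite Re_inv Re_pt Im_pt sqrrN expr1n [1 + _]addrC mulNr lerN2.
apply/eqP => l0; have : 4 <= Im lam.
  rewrite /lam /bsq /bd !Im_add !Im_opp !Im_mul /=.
  move: e1 e2 e3 e4; set x1 := ri _ _ _; set x2 := ri _ _ _; set x3 := ri _ _ _.
  set x4 := ri _ _ _.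
  rewrite /ci /= !mul0r !add0r !mul1r -/x1 -/x2 -/x3 -/x4; clear; lra.
by rewrite l0 /=; clear; lra.
Qed.

End Cauchy.

Section CauchyFormula.
Variable R : realType.
Local Notation C := (Cplx R).
Local Notation lam := (@lam R).
Implicit Types (phi psi q : C -> C) (a b c d r : R) (y z : C).

Lemma bsqD phi psi r : 0 < r -> (forall z, fsq r z -> differentiable phi z) ->
  (forall z, fsq r z -> differentiable psi z) ->
  bsq (fun z => phi z + psi z) r = bsq phi r + bsq psi r.
Proof.
move=> r0 dphi dpsi; have rr : - r <= r by move: r0; clear; lra.
by apply: bdD; exact: frame_edges_continuous.
Qed.

Lemma bsqZ (k : C) phi r : 0 < r -> (forall z, fsq r z -> differentiable phi z) ->
  bsq (fun z => k * phi z) r = k * bsq phi r.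
Proof.
move=> r0 dphi; have rr : - r <= r by move: r0; clear; lra.
by apply: bdZ; exact: frame_edges_continuous.
Qed.

Lemma eq_bsq phi psi r : 0 < r -> (forall z, fsq r z -> phi z = psi z) ->
  bsq phi r = bsq psi r.
Proof.
move=> r0 e; have rr : - r <= r by move: r0; clear; lra.
by apply: eq_bd => // z rz ez; apply: e.
Qed.

Lemma lt_all_eq0 (x : R) : 0 <= x -> (forall e, 0 < e -> x <= e) -> x = 0.
Proof.
rewrite le_eqVlt => /predU1P[//|x0] /(_ (x / 2)); rewrite divr_gt0// => /(_ isT).
by move: x0; clear; lra.
Qed.

Lemma differentiableDc phi psi z : differentiable phi z -> differentiable psi z ->
  differentiable (fun z => phi z + psi z) z.
Proof. by move=> dp dq; exact: differentiableD. Qed.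

Lemma differentiableMc phi psi z : differentiable phi z -> differentiable psi z ->
  differentiable (fun z => phi z * psi z) z.
Proof. by move=> dp dq; exact: differentiableM. Qed.

Lemma differentiableZc (k : C) phi z : differentiable phi z ->
  differentiable (fun z => k * phi z) z.
Proof. by move=> dp; exact: (differentiableMc (differentiable_cst k z) dp). Qed.

Lemma bsq_inv0 r : 0 < r -> bsq (GRing.inv : C -> C) r = lam.
Proof.
move=> r0; rewrite /lam; have [r1|r1] := leP r 1.
  apply/esym; apply: (bsq_annulus r0 r1) => z _ rz; apply: differentiable_inv.
  by rewrite -nrm_gt0 (lt_le_trans r0).
apply: (bsq_annulus ltr01 (ltW r1)) => z _ rz; apply: differentiable_inv.
by rewrite -nrm_gt0 (lt_le_trans _ rz)// ltr01.
Qed.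

(** The difference to [z^-1] is y / ((z - y) z). Its integral is the same over all larger squares,
    and tends to 0 by quadratic decay. *)
Lemma bsq_inv r y : nrm y < r -> bsq (fun z => (z - y)^-1) r = lam.
Proof.
move=> yr; have r0 := le_lt_trans (nrm_ge0 y) yr.
pose D z := (z - y)^-1 + (- 1) * z^-1.
have dD z : nrm y < nrm z -> differentiable D z.
  move=> yz; apply: differentiableDc.
    by apply: differentiable_subVr; apply: contraTneq yz => ->; rewrite ltxx.
  apply: differentiableZc; apply: differentiable_inv.
  by rewrite -nrm_gt0 (le_lt_trans (nrm_ge0 y) yz).
suff D0 : bsq D r = 0.
  have d1 z : fsq r z -> differentiable (fun z => (z - y)^-1) z.
    by move=> fz; apply: differentiable_subVr; exact: fsq_neq fz.
  have d2 z : fsq r z -> differentiable (GRing.inv : C -> C) z.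
    move=> fz; apply: differentiable_inv.
    by rewrite -nrm_gt0 (lt_le_trans r0)//; exact: fsq_nrm_ge fz.
  move: D0; rewrite /D (bsqD r0 d1 (fun z fz => differentiableZc _ (d2 z fz))) (bsqZ _ r0 d2).
  by rewrite bsq_inv0// mulN1r => /eqP; rewrite subr_eq0 => /eqP.
apply/eqP; rewrite -nrm_eq0; apply/eqP/lt_all_eq0; first exact: nrm_ge0.
(* The summands provide in turn [r <= S], [nrm y <= S / 2] and the final estimate
   [32 * nrm y / S <= e]. *)
move=> e e0; pose S := r + 2 * nrm y + 32 * nrm y / e.
have y0 := nrm_ge0 y.
have k0 : 0 <= 32 * nrm y / e by rewrite divr_ge0 ?mulr_ge0// ltW.
have rS : r <= S by move: k0 y0; rewrite /S; clear; lra.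
have S0 : 0 < S := lt_le_trans r0 rS.
have yS : nrm y <= S / 2 by move: k0 y0 r0; rewrite /S; clear; lra.
rewrite -(bsq_annulus r0 rS (fun z _ rz => dD z (lt_le_trans yr rz))).
apply: (@le_trans _ _ (16 * (2 * nrm y / S ^+ 2) * S)).
  apply: (bsq_norm S0).
    by move=> z fz; apply: dD; apply: lt_le_trans (fsq_nrm_ge S0 fz); exact: lt_le_trans yr rS.
  move=> z fz; have Sz := fsq_nrm_ge S0 fz.
  have z0 : z != 0 by rewrite -nrm_gt0 (lt_le_trans S0).
  have zy : z - y != 0 by rewrite subr_eq0; apply: fsq_neq fz; exact: lt_le_trans rS.
  have -> : D z = y / ((z - y) * z) by rewrite /D; field; rewrite zy z0.
  rewrite nrmM nrmV nrmM [2 * _]mulrC -mulrA ler_wpM2l//.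
  have zyS : S / 2 <= nrm (z - y).
    by have := nrm_tri y z 0; rewrite !subr0; move: yS Sz; clear; lra.
  have -> : 2 / S ^+ 2 = (S / 2 * S)^-1 by have := lt0r_neq0 S0; clear; move=> ?; field.
  rewrite lef_pV2 ?posrE.
  - by rewrite ler_pM// ?divr_ge0// ltW.
  - by rewrite mulr_gt0// nrm_gt0.
  - by rewrite mulr_gt0// divr_gt0.
have -> : 16 * (2 * nrm y / S ^+ 2) * S = 32 * nrm y / S.
  by have := lt0r_neq0 S0; clear; move=> ?; field.
rewrite ler_pdivrMr// [e * S]mulrC -ler_pdivrMr//.
by move: r0 y0 k0; rewrite /S; clear; lra.
Qed.

(** After subtraction of q(y) / (z - y) the contour can be shrunk to a small square around [y], on
    which continuity makes the numerator small. *)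
Lemma cauchy_formula q r y : nrm y < r ->
  (forall z, rect (- r) r (- r) r z -> differentiable q z) ->
  bsq (fun z => q z / (z - y)) r = lam * q y.
Proof.
move=> yr dq; have r0 := le_lt_trans (nrm_ge0 y) yr.
have dqf z : fsq r z -> differentiable q z by move=> /fsq_rect; exact: dq.
pose D z := q z / (z - y) + (- q y) * (z - y)^-1.
have dV z : fsq r z -> differentiable (fun z => (z - y)^-1) z.
  by move=> fz; apply: differentiable_subVr; exact: fsq_neq fz.
have ry : rect (- r) r (- r) r y by apply: nrm_rect_sq; exact: ltW.
suff D0 : bsq D r = 0.
  move: D0; rewrite /D (bsqD r0 (fun z fz => differentiableMc (dqf z fz) (dV z fz))
    (fun z fz => differentiableZc _ (dV z fz))) (bsqZ _ r0 dV) bsq_inv// mulNr => /eqP; rewrite subr_eq0 => /eqP ->.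
  by rewrite mulrC.
apply/eqP; rewrite -nrm_eq0; apply/eqP/lt_all_eq0; first exact: nrm_ge0.
move=> e e0; have cq : {for y, continuous q} by exact: differentiable_continuous (dq y ry).
have e16 : 0 < e / 16 by rewrite divr_gt0.
have /nbhs_nrm[dl dl0 H] := (cvg_nrm (nbhs_filter y) q (q y)).1 cq _ e16.
(* The first bound keeps the small square within distance [dl] of [y], the second keeps it inside
   the large one. *)
pose de := Num.min (dl / 8) (r - nrm y).
have de0 : 0 < de by rewrite lt_min divr_gt0//= subr_gt0.
have de1 : de <= dl / 8 by rewrite ge_min lexx.
have de2 : de <= r - nrm y by rewrite ge_min lexx orbT.
have := Re_le_nrm y; have := Im_le_nrm y; rewrite !ler_norml => /andP[i1 i2] /andP[r1 r2].
have -> : bsq D r = bd D (Re y - de) (Re y + de) (Im y - de) (Im y + de).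
  apply: bd_annulus; try by move: de0 de2 i1 i2 r1 r2; clear; lra.
  move=> z rz nz; have zy : z != y.
    apply: contra_notN nz => /eqP ->.
    by move: de0; clear; split; apply/andP; split; lra.
  apply: differentiableDc; first by apply: differentiableMc; [exact: dq|exact: differentiable_subVr].
  by apply: differentiableZc; exact: differentiable_subVr.
have fy z : frame (Re y - de) (Re y + de) (Im y - de) (Im y + de) z ->
    de <= nrm (z - y) /\ nrm (z - y) < dl.
  move=> [rz fz]; split.
    have [rn im] := (Re_le_nrm (z - y), Im_le_nrm (z - y)).
    rewrite Re_add Re_opp in rn; rewrite Im_add Im_opp in im.
    by rewrite !inE in fz; case/orP: fz => /orP[|] /eqP e1;
      [move: rn|move: rn|move: im|move: im]; rewrite e1 addrAC subrr add0r ?normrN ger0_norm// ltW.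
  have ryy : rect (Re y - de) (Re y + de) (Im y - de) (Im y + de) y.
    by move: de0; clear; split; apply/andP; split; lra.
  by have := rect_nrm rz ryy; move: de1 dl0 de0; clear; lra.
have neq z : frame (Re y - de) (Re y + de) (Im y - de) (Im y + de) z -> z != y.
  by move=> /fy[+ _]; apply: contraTneq => ->; rewrite subrr nrm0 -ltNge.
have dd (x : R) : x - de <= x + de by move: de0; clear; lra.
have -> : e = 4 * (e / 16 / de) * ((Re y + de - (Re y - de)) + (Im y + de - (Im y - de))).
  by have := lt0r_neq0 de0; clear; move=> ?; field.
apply: (bd_norm (dd _) (dd _)).
- apply: (frame_edges_continuous (dd _) (dd _)) => z fz; have zy := neq _ fz.
  have rz : rect (- r) r (- r) r z.
    case: fz => rz _; move: rz; apply: rect_bdS; by move: de0 de2 i1 i2 r1 r2; clear; lra.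
  apply: differentiableDc; first by apply: differentiableMc; [exact: dq|exact: differentiable_subVr].
  by apply: differentiableZc; exact: differentiable_subVr.
- move=> z rz ez; have [f1 f2] := fy z (conj rz ez).
  rewrite /D -mulrDl nrmM nrmV ler_pM ?nrm_ge0 ?invr_ge0 ?nrm_ge0//.
    by rewrite nrmB; apply/ltW/H; rewrite nrmB.
  by rewrite lef_pV2 ?posrE// (lt_le_trans de0).
Qed.

End CauchyFormula.

(** * Liouville's theorem and Taylor expansions with remainder *)

Section CauchyEstimates.
Variable R : realType.
Local Notation C := (Cplx R).
Local Notation lam := (@lam R).
Implicit Types (phi psi q F : C -> C) (r M : R) (y z : C).

(** Liouville's theorem, from Cauchy's formula at the centre for [F (a + z) - L] over large
    squares. *)
Lemma entire_limit F (L : C) : (forall z, differentiable F z) ->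
  (forall e, 0 < e -> exists B : R, forall z, B <= nrm z -> nrm (F z - L) <= e) ->
  forall a, F a = L.
Proof.
move=> dF FL a; apply/eqP; rewrite -subr_eq0 -nrm_eq0.
suff : nrm lam * nrm (F a - L) == 0.
  have l0 : nrm lam != 0 by rewrite nrm_eq0 lam_neq0.
  by rewrite mulf_eq0 (negbTE l0).
apply/eqP/lt_all_eq0; first by rewrite mulr_ge0 ?nrm_ge0.
move=> e e0; have e16 : 0 < e / 16 by rewrite divr_gt0.
have [B HB] := FL _ e16.
pose G z := F (a + z) + (- L).
have dG z : differentiable G z.
  apply: differentiableDc; last exact: differentiable_cst.
  apply: (@differentiable_comp _ _ _ _ (fun z => a + z) F); last exact: dF.
  by apply: differentiableDc; [exact: differentiable_cst|exact: ex_diff].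
pose r := `|B| + nrm a + 1.
have r0 : 0 < r by rewrite ltr_wpDl// addr_ge0 ?nrm_ge0.
have y0 : nrm (0 : C) < r by rewrite nrm0.
have := cauchy_formula y0 (fun z _ => dG z); rewrite {2}/G addr0 -nrmM => <-.
have -> : e = 16 * (e / 16 / r) * r by have := lt0r_neq0 r0; clear; move=> ?; field.
apply: (bsq_norm r0).
  by move=> z fz; apply: differentiable_div; [exact: dG|exact: fsq_neq fz].
move=> z fz; have rz := fsq_nrm_ge r0 fz.
rewrite subr0 nrmM nrmV ler_pM ?nrm_ge0 ?invr_ge0 ?nrm_ge0//.
  apply: HB; have := nrmD (a + z) (- a); rewrite nrmN addrAC subrr add0r.
  by have := ler_norm B; move: rz; rewrite /r; clear; lra.
by rewrite lef_pV2 ?posrE// (lt_le_trans r0).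
Qed.

(** The identity 1/(z - y) = 1/z + y / (z (z - y)), integrated. Iteration yields Taylor coefficients
    with a remainder; writing [z - 0] lets the result be fed to [cauchy_formula] and to the lemma
    itself. *)
Lemma bsq_step q r y : nrm y < r -> (forall z, fsq r z -> differentiable q z) ->
  bsq (fun z => q z / (z - y)) r =
  bsq (fun z => q z / (z - 0)) r + y * bsq (fun z => q z / (z - 0) / (z - y)) r.
Proof.
move=> yr dq; have r0 := le_lt_trans (nrm_ge0 y) yr.
have n0r : nrm (0 : C) < r by rewrite nrm0.
have d0 z : fsq r z -> differentiable (fun z => q z / (z - 0)) z.
  by move=> fz; apply: differentiable_div; [exact: dq|exact: fsq_neq fz].
have d1 z : fsq r z -> differentiable (fun z => q z / (z - 0) / (z - y)) z.
  by move=> fz; apply: differentiable_div; [exact: d0|exact: fsq_neq fz].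
rewrite -(bsqZ y r0 d1) -(bsqD r0 d0 (fun z fz => differentiableZc y (d1 z fz))).
apply: (eq_bsq r0) => z fz; have z0 := fsq_neq n0r fz.
have zy : z - y != 0 by rewrite subr_eq0; exact: fsq_neq fz.
by rewrite subr0; field; rewrite z0 zy.
Qed.

Lemma bsq_div_bound q r y M : nrm y <= r / 2 -> 0 < r ->
  (forall z, fsq r z -> differentiable q z) -> (forall z, fsq r z -> nrm (q z) <= M) ->
  nrm (bsq (fun z => q z / (z - y)) r) <= 32 * M.
Proof.
move=> yr r0 dq qM; have yr' : nrm y < r by move: yr r0; clear; lra.
have -> : 32 * M = 16 * (M / (r / 2)) * r.
  by have := lt0r_neq0 r0; clear; move=> ?; field.
apply: (bsq_norm r0).
  by move=> z fz; apply: differentiable_div; [exact: dq|exact: fsq_neq fz].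
move=> z fz; have zy : r / 2 <= nrm (z - y).
  have := fsq_nrm_ge r0 fz; have := nrm_tri y z 0; rewrite !subr0.
  by move: yr; clear; lra.
have r2 : 0 < r / 2 by rewrite divr_gt0.
rewrite nrmM nrmV ler_pM ?nrm_ge0 ?invr_ge0 ?nrm_ge0 ?qM//.
by rewrite lef_pV2 ?posrE// (lt_le_trans r2).
Qed.

Lemma div0_bound q r M z : 0 < r -> nrm (q z) <= M -> fsq r z -> nrm (q z / (z - 0)) <= M / r.
Proof.
move=> r0 qM fz; have rz := fsq_nrm_ge r0 fz.
rewrite subr0 nrmM nrmV ler_pM ?nrm_ge0 ?invr_ge0 ?nrm_ge0//.
by rewrite lef_pV2 ?posrE// (lt_le_trans r0).
Qed.

Lemma cauchy_lipschitz q r M y : 0 < r ->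
  (forall z, rect (- r) r (- r) r z -> differentiable q z) ->
  (forall z, fsq r z -> nrm (q z) <= M) -> nrm y <= r / 2 ->
  nrm (q y - q 0) <= 32 * M / r / nrm lam * nrm y.
Proof.
move=> r0 dq qM yr; have l0 : 0 < nrm lam by rewrite nrm_gt0 lam_neq0.
have yr' : nrm y < r by move: yr r0; clear; lra.
have n0r : nrm (0 : C) < r by rewrite nrm0.
have dqf z : fsq r z -> differentiable q z by move=> /fsq_rect; exact: dq.
have := bsq_step yr' dqf; rewrite (cauchy_formula yr' dq) (cauchy_formula n0r dq) => e.
have {}e : lam * (q y - q 0) = y * bsq (fun z => q z / (z - 0) / (z - y)) r.
  by rewrite mulrBr e addrC addKr.
rewrite -(ler_pM2l l0) -nrmM e nrmM.
have -> : nrm lam * (32 * M / r / nrm lam * nrm y) = nrm y * (32 * (M / r)).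
  by have := lt0r_neq0 l0; have := lt0r_neq0 r0; clear; move=> ? ?; field; apply/andP.
rewrite ler_wpM2l ?nrm_ge0//; apply: bsq_div_bound => //.
  by move=> z fz; apply: differentiable_div; [exact: dqf|exact: fsq_neq fz].
by move=> z fz; apply: div0_bound => //; exact: qM.
Qed.

(** Three uses of [bsq_step], the last integral being bounded by [bsq_div_bound]. *)
Lemma cauchy_taylor2 q r M : 0 < r ->
  (forall z, rect (- r) r (- r) r z -> differentiable q z) ->
  (forall z, fsq r z -> nrm (q z) <= M) ->
  exists c1 c2 : C, exists K : R, forall y, nrm y <= r / 2 ->
  nrm (q y - q 0 - c1 * y - c2 * y ^+ 2) <= K * nrm y ^+ 3.
Proof.
move=> r0 dq qM; have l0 : 0 < nrm lam by rewrite nrm_gt0 lam_neq0.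
have n0r : nrm (0 : C) < r by rewrite nrm0.
have dqf z : fsq r z -> differentiable q z by move=> /fsq_rect; exact: dq.
pose q1 z := q z / (z - 0); pose q2 z := q1 z / (z - 0); pose q3 z := q2 z / (z - 0).
have d1 z : fsq r z -> differentiable q1 z.
  by move=> fz; apply: differentiable_div; [exact: dqf|exact: fsq_neq fz].
have d2 z : fsq r z -> differentiable q2 z.
  by move=> fz; apply: differentiable_div; [exact: d1|exact: fsq_neq fz].
have d3 z : fsq r z -> differentiable q3 z.
  by move=> fz; apply: differentiable_div; [exact: d2|exact: fsq_neq fz].
have b3 z : fsq r z -> nrm (q3 z) <= M / r / r / r.
  by move=> fz; do 3!(apply: div0_bound => //); exact: qM.
exists (lam^-1 * bsq q2 r), (lam^-1 * bsq q3 r), (32 * (M / r / r / r) / nrm lam).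
move=> y yr; have yr' : nrm y < r by move: yr r0; clear; lra.
have := bsq_step yr' dqf; rewrite (cauchy_formula yr' dq) (cauchy_formula n0r dq).
rewrite (bsq_step yr' d1) (bsq_step yr' d2).
rewrite -/(q1 _) -/q2 -/q3 => e.
rewrite -(ler_pM2l l0) -nrmM.
have -> : lam * (q y - q 0 - lam^-1 * bsq q2 r * y - lam^-1 * bsq q3 r * y ^+ 2) =
    y ^+ 3 * bsq (fun z => q3 z / (z - y)) r.
  have := @lam_neq0 R; move: e; move: (bsq _ r) (bsq q2 r) (bsq q3 r) (q y) (q 0) => B B2 B3 u v.
  move: (lam) => l; clear => e ln.
  have -> : u = l^-1 * (l * v + y * (B2 + y * (B3 + y * B))) by rewrite -e mulrA mulVf// mul1r.
  by field.
have -> : nrm lam * (32 * (M / r / r / r) / nrm lam * nrm y ^+ 3) =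
    nrm y ^+ 3 * (32 * (M / r / r / r)).
  by have := lt0r_neq0 l0; have := lt0r_neq0 r0; clear; move=> ? ?; field; apply/andP.
have -> : nrm y ^+ 3 = nrm (y ^+ 3) by rewrite !exprS !expr0 !mulr1 !nrmM.
by rewrite nrmM ler_wpM2l ?nrm_ge0//; exact: bsq_div_bound.
Qed.

End CauchyEstimates.

(** * Holomorphic functions of two variables *)

Section Differentiability.
Variables (K : numFieldType) (V W : normedModType K).

Lemma differentiable_small (e : V -> W) (x : V) : e x = 0 ->
  (forall eps : K, 0 < eps -> \forall h \near (0 : V), `|e (h + x)| <= eps * `|h|) ->
  differentiable e x.
Proof.
move=> ex small.
have E : e \o shift x = cst (e x) + (\0 : V -> W) +o_ 0 id.
  apply/eqaddoP => eps eps0; near=> h.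
  have -> : (e \o shift x - (cst (e x) + (\0 : V -> W))) h = e (h + x).
    rewrite -[LHS]/(e (h + x) - (e x + 0)); by rewrite ex addr0 subr0.
  by near: h; exact: small.
have c0 : continuous (\0 : V -> W) by move=> y; exact: cvg_cst.
have D : 'd e x = (\0 : {linear V -> W}) :> (V -> W) by apply: diff_unique.
by apply/diff_locallyP; rewrite D; split.
Unshelve. all: by end_near. Qed.

Lemma near_differentiable (f g : V -> W) (x : V) :
  (\forall y \near x, f y = g y) -> differentiable f x -> differentiable g x.
Proof.
move=> fg df.
have -> : g = f + (fun y => g y - f y).
  by apply/funext => y; rewrite -[RHS]/(f y + (g y - f y)) addrC subrK.
apply: differentiableD => //; apply: differentiable_small.
  by rewrite (nbhs_singleton fg) subrr.
move=> eps eps0.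
have : \forall h \near (0 : V), f (h + x) = g (h + x).
  by move: fg; rewrite [X in X -> _](near_shift 0 x) /= subr0.
apply: filterS => h ->; rewrite subrr normr0 mulr_ge0//; exact: ltW.
Qed.

End Differentiability.

Section Slices.
Variable R : realType.
Local Notation C := (Cplx R).
Local Notation C2 := (C * C)%type.

Lemma differentiable_slice1 (h : C2 -> C) (a b : C) :
  differentiable h (a, b) -> differentiable (fun z : C => h (z, b)) a.
Proof. by move=> dh; apply: (@differentiable_comp _ _ _ _ (fun z : C => (z, b)) h). Qed.

Lemma differentiable_slice2 (h : C2 -> C) (a b : C) :
  differentiable h (a, b) -> differentiable (fun z : C => h (a, z)) b.
Proof. by move=> dh; apply: (@differentiable_comp _ _ _ _ (fun z : C => (a, z)) h). Qed.

Lemma differentiable_c1 (x : C2) : differentiable (fun x : C2 => x.1) x.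
Proof. by apply: (@linear_differentiable _ _ _ fst) => y; exact: cvg_fst. Qed.

Lemma differentiable_c2 (x : C2) : differentiable (fun x : C2 => x.2) x.
Proof. by apply: (@linear_differentiable _ _ _ snd) => y; exact: cvg_snd. Qed.

Lemma differentiable2D (f g : C2 -> C) x : differentiable f x ->
  differentiable g x -> differentiable (fun x => f x + g x) x.
Proof. by move=> df dg; exact: differentiableD. Qed.

Lemma differentiable2M (f g : C2 -> C) x : differentiable f x ->
  differentiable g x -> differentiable (fun x => f x * g x) x.
Proof. by move=> df dg; exact: differentiableM. Qed.

Lemma differentiable2Z (k : C) (f : C2 -> C) x : differentiable f x ->
  differentiable (fun x => k * f x) x.
Proof. by move=> df; exact: (differentiable2M (differentiable_cst k x) df). Qed.

Lemma differentiable2V (f : C2 -> C) x : differentiable f x -> f x != 0 ->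
  differentiable (fun x => (f x)^-1) x.
Proof. by move=> df; exact: differentiableV. Qed.

Definition nrm2 (x : C2) : R := Num.max (nrm x.1) (nrm x.2).

Lemma normC2E (x : C2) : `|x| = (nrm2 x)%:C.
Proof.
have E : `|x| = Num.max `|x.1| `|x.2| :> C by [].
rewrite E !normCE /nrm2 !maxEle lecR; by case: ifP.
Qed.

Lemma nbhs_nrm2 (x : C2) (A : set C2) :
  nbhs x A <-> exists2 e : R, 0 < e &
    forall y, nrm (x.1 - y.1) < e -> nrm (x.2 - y.2) < e -> A y.
Proof.
split=> [/nbhs_ballP[e /= /posC[r r0 ->] eA]|[e e0 eA]].
  by exists r => // y xy1 xy2; apply: eA; split; rewrite ball_nrm.
apply/nbhs_ballP; exists e%:C; first by rewrite /= ltcR.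
by move=> y [] /=; rewrite !ball_nrm; apply: eA.
Qed.

Lemma differentiable_quadratic (k : C2 -> C) (a b : C) (B r : R) : 0 < r ->
  (forall x : C2, nrm x.1 < r -> nrm x.2 < r ->
     nrm (k x - k (0, 0) - a * x.1 - b * x.2) <= B * (nrm x.1 + nrm x.2) ^+ 2) ->
  differentiable k ((0, 0) : C2).
Proof.
move=> r0 H.
pose e x := k x - k (0, 0) - a * x.1 - b * x.2.
have -> : k = (fun x => (e x + k (0, 0)) + (a * x.1 + b * x.2)).
  by apply/funext => x; rewrite /e; ring.
apply: differentiable2D; last first.
  by apply: differentiable2D; apply: differentiable2Z;
    [exact: differentiable_c1|exact: differentiable_c2].
apply: differentiable2D; last exact: differentiable_cst.
apply: differentiable_small; first by rewrite /e /= !mulr0 !subr0 subrr.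
move=> _ /posC[eps eps0 ->]; apply/nbhs_nrm2.
have B0 : 0 < `|B| * 4 + 1 by rewrite ltr_wpDl// mulr_ge0.
exists (Num.min r (eps / (`|B| * 4 + 1))); first by rewrite lt_min r0 divr_gt0.
move=> h; rewrite !sub0r !nrmN !lt_min => /andP[h1 h2] /andP[h3 h4].
rewrite /= normC2E normCE -rmorphM lecR addr0.
apply: le_trans (H h h1 h3) _.
have n1 := nrm_ge0 h.1; have n2 := nrm_ge0 h.2.
set n := nrm2 h; have hn1 : nrm h.1 <= n by rewrite le_max lexx.
have hn2 : nrm h.2 <= n by rewrite le_max lexx orbT.
have n0 : 0 <= n := le_trans n1 hn1.
have nn : n <= eps / (`|B| * 4 + 1) by rewrite ge_max !ltW.
apply: (@le_trans _ _ ((`|B| * 4 + 1) * n * n)).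
  have BB := ler_norm B; have b0 := normr_ge0 B.
  move: `|B| BB b0 (nrm h.1) (nrm h.2) n1 n2 hn1 hn2 n0 => {H}; clear.
  move=> b bB b0 u v u0 v0 un vn n0.
  have : (u + v) ^+ 2 <= 4 * n ^+ 2 by nra.
  have : 0 <= (u + v) ^+ 2 by exact: sqr_ge0.
  move: ((u + v) ^+ 2) => w w0 w1.
  have : B * w <= b * w by rewrite ler_wpM2r.
  have : b * w <= b * (4 * n ^+ 2) by rewrite ler_wpM2l.
  have : 0 <= n ^+ 2 by exact: sqr_ge0.
  have -> : (b * 4 + 1) * n * n = b * (4 * n ^+ 2) + n ^+ 2 by ring.
  by move: (b * (4 * n ^+ 2)) (b * w) (B * w) (n ^+ 2) => *; lra.
by rewrite ler_wpM2r// mulrC -ler_pdivlMr.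
Qed.

Lemma rect_nbhd (r rho : R) z : 2 * r < rho -> rect (- r) r (- r) r z -> nrm z < rho.
Proof. by move=> rr /rect_sq_nrm; move/le_lt_trans; apply. Qed.

(** * Division by a coordinate and extension over the origin *)

Section Division.
Variables h1 h2 : C2 -> C.

(* h1 / x.1 = h2 / x.2, extended to the origin where both denominators vanish. *)
Definition div_coord (x : C2) : C :=
  if x.1 != 0 then h1 x / x.1 else if x.2 != 0 then h2 x / x.2
  else 'D_((1, 0) : C2) h1 0.

Variables (rho M : R).
Hypothesis rho0 : 0 < rho.
Let bidisc (x : C2) := nrm x.1 < rho /\ nrm x.2 < rho.
Hypothesis dh1 : forall x, bidisc x -> differentiable h1 x.
Hypothesis dh2 : forall x, bidisc x -> differentiable h2 x.
Hypothesis bh1 : forall x, bidisc x -> nrm (h1 x) <= M.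
Hypothesis bh2 : forall x, bidisc x -> nrm (h2 x) <= M.
Hypothesis h12 : forall x, bidisc x -> x.2 * h1 x = x.1 * h2 x.

Let r := rho / 4.
Let r0 : 0 < r. Proof. by rewrite divr_gt0. Qed.
Let r2 : 2 * r < rho. Proof. by rewrite /r; have := rho0; lra. Qed.
Let rd (z : C) : nrm z <= r / 2 -> nrm z < rho.
Proof. by rewrite /r; have := rho0; lra. Qed.

Let div1 x : x.1 != 0 -> div_coord x = h1 x / x.1.
Proof. by rewrite /div_coord => ->. Qed.

Let div2 x : bidisc x -> x.2 != 0 -> div_coord x = h2 x / x.2.
Proof.
move=> bx x2; rewrite /div_coord x2; case: eqP => //= /eqP x1.
by apply/eqP; rewrite eqr_div// mulrC h12// mulrC.
Qed.

Let M0 : 0 <= M.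
Proof. by apply: le_trans (nrm_ge0 _) (bh1 (x := 0) _); split; rewrite /= nrm0. Qed.

(* Uniform Lipschitz bound in x1 along the boundary of the square in x2. *)
Let lip : exists2 K : R, 0 <= K & forall x1 eta, fsq r eta -> nrm x1 <= r / 2 ->
  nrm (div_coord (x1, eta) - div_coord (0, eta)) <= K * nrm x1.
Proof.
exists (32 * (M / r) / r / nrm (lam R)); first by rewrite !(mulr_ge0, invr_ge0) ?nrm_ge0// ltW.
move=> x1 eta fe x1r.
have n0r : nrm (0 : C) < r by rewrite nrm0.
have eta0 := fsq_neq n0r fe.
have er : nrm eta < rho by apply: rect_nbhd r2 (fsq_rect fe).
pose q z := h2 (z, eta) * eta^-1.
have dq z : rect (- r) r (- r) r z -> differentiable q z.
  move=> rz; apply: (@differentiableMc R); last exact: differentiable_cst.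
  by apply: differentiable_slice1; apply: dh2; split=> //=; exact: rect_nbhd r2 rz.
have bq z : fsq r z -> nrm (q z) <= M / r.
  move=> fz; rewrite /q nrmM nrmV ler_pM ?nrm_ge0 ?invr_ge0 ?nrm_ge0//.
    by apply: bh2; split=> //=; exact: rect_nbhd r2 (fsq_rect fz).
  have re := fsq_nrm_ge r0 fe.
  by rewrite lef_pV2 ?posrE// (lt_le_trans r0).
have := cauchy_lipschitz r0 dq bq x1r; rewrite /q.
by rewrite !div2//=; split=> //=; rewrite ?nrm0//; exact: rd.
Qed.

(** The relation [h12] makes [h1] vanish on the axis [x.1 = 0] off the origin; continuity does the
    rest. *)
Let h10 : h1 (0, 0) = 0.
Proof.
apply/eqP; rewrite -nrm_eq0; apply/eqP/lt_all_eq0; first exact: nrm_ge0.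
move=> e e0.
have b0 : bidisc (0, 0) by split; rewrite /= nrm0.
have ch := differentiable_continuous (differentiable_slice2 (dh1 b0)).
have /nbhs_nrm[dl dl0 H] := (cvg_nrm (nbhs_filter (0 : C)) _ _).1 ch _ e0.
pose t : R := Num.min dl rho / 2.
have t0 : 0 < t by rewrite divr_gt0// lt_min dl0.
have nt : nrm (t%:C : C) = t by rewrite nrm_real gtr0_norm.
have m0 : 0 < Num.min dl rho by rewrite lt_min dl0.
have tm : t < Num.min dl rho by rewrite ltr_pdivrMr// ltr_pMr// ltr1n.
move: tm; rewrite lt_min => /andP[tdl trho].
have tC0 : (t%:C : C) != 0 by rewrite -nrm_gt0 nt.
have z0 : h1 (0, t%:C) = 0.
  have := h12 (x := (0, t%:C)); rewrite /= mul0r => /(_ _)/eqP.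
  rewrite mulf_eq0 (negbTE tC0) /= => E; apply/eqP/E.
  by split; rewrite /= ?nrm0 ?nt.
by have := H t%:C; rewrite sub0r nrmN nt z0 subr0 => /(_ tdl) /ltW.
Qed.

(** For fixed [x1 != 0] the slice in [x2] is holomorphic, with boundary values bounded uniformly
    through h2 / x.2. By [lip] its first Taylor coefficient differs by O(|x1|) from [b], which is
    formed with the values at x1 = 0; those are used on the boundary of the square only, away from a
    possible pole. *)
Let dir2 : exists b : C, exists2 K : R, 0 <= K & forall x1 x2 : C, x1 != 0 ->
  nrm x1 <= r / 2 -> nrm x2 <= r / 2 ->
  nrm (div_coord (x1, x2) - div_coord (x1, 0) - b * x2) <= K * nrm x2 * (nrm x1 + nrm x2).
Proof.
have [Kl Kl0 HKl] := lip.
have l0 : 0 < nrm (lam R) by rewrite nrm_gt0 lam_neq0.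
have n0r : nrm (0 : C) < r by rewrite nrm0.
have n0r2 : nrm (0 : C) <= r / 2 by rewrite nrm0 divr_ge0// ltW.
pose k0 (z : C) := h2 (0, z) / (z - 0).
have k0E z : fsq r z -> div_coord (0, z) = k0 z.
  move=> fz; rewrite div2/=; first by rewrite /k0 subr0.
    by split=> /=; [rewrite nrm0|exact: rect_nbhd r2 (fsq_rect fz)].
  exact: fsq_neq fz.
have dk0 z : fsq r z -> differentiable k0 z.
  move=> fz; apply: differentiable_div; last exact: fsq_neq fz.
  apply: differentiable_slice2; apply: dh2.
  by split=> /=; [rewrite nrm0|exact: rect_nbhd r2 (fsq_rect fz)].
pose k1 z := k0 z / (z - 0).
have dk1 z : fsq r z -> differentiable k1 z.
  by move=> fz; apply: differentiable_div; [exact: dk0|exact: fsq_neq fz].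
exists ((lam R)^-1 * bsq (fun z => k1 z / (z - 0)) r).
exists (32 * (Kl / r + M / r / r / r) / nrm (lam R)).
  by rewrite !(mulr_ge0, addr_ge0, invr_ge0) ?nrm_ge0// ltW.
move=> x1 x2 x10 x1r x2r.
have x2r' : nrm x2 < r by move: x2r; have := r0; lra.
pose q z := h1 (x1, z) * x1^-1.
have qE z : div_coord (x1, z) = q z by rewrite div1.
have dq z : rect (- r) r (- r) r z -> differentiable q z.
  move=> rz; apply: (@differentiableMc R); last exact: differentiable_cst.
  by apply: differentiable_slice2; apply: dh1; split=> /=; [exact: rd|exact: rect_nbhd r2 rz].
have dqf z : fsq r z -> differentiable q z by move=> /fsq_rect; exact: dq.
have bq z : fsq r z -> nrm (q z) <= M / r.
  move=> fz; rewrite -qE div2 /=; last exact: fsq_neq fz.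
    rewrite nrmM nrmV ler_pM ?nrm_ge0 ?invr_ge0 ?nrm_ge0//.
      by apply: bh2; split=> /=; [exact: rd|exact: rect_nbhd r2 (fsq_rect fz)].
    have re := fsq_nrm_ge r0 fz.
    by rewrite lef_pV2 ?posrE// (lt_le_trans r0).
  by split=> /=; [exact: rd|exact: rect_nbhd r2 (fsq_rect fz)].
pose q1 z := q z / (z - 0); pose q2 z := q1 z / (z - 0).
have d1 z : fsq r z -> differentiable q1 z.
  by move=> fz; apply: differentiable_div; [exact: dqf|exact: fsq_neq fz].
have d2 z : fsq r z -> differentiable q2 z.
  by move=> fz; apply: differentiable_div; [exact: d1|exact: fsq_neq fz].
pose D z := q z + (-1) * k0 z; pose D1 z := D z / (z - 0).
have dD z : fsq r z -> differentiable D z.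
  by move=> fz; exact: (differentiableDc (dqf z fz) (differentiableZc (-1) (dk0 z fz))).
have dD1 z : fsq r z -> differentiable D1 z.
  by move=> fz; apply: differentiable_div; [exact: dD|exact: fsq_neq fz].
have bD z : fsq r z -> nrm (D z) <= Kl * nrm x1.
  by move=> fz; have := HKl x1 z fz x1r; rewrite qE (k0E _ fz) /D mulN1r.
have B1 : nrm (bsq (fun z => D1 z / (z - 0)) r) <= 32 * (Kl * nrm x1 / r).
  apply: (bsq_div_bound n0r2 r0 dD1) => z fz.
  by apply: div0_bound => //; exact: bD.
have B2 : nrm (bsq (fun z => q2 z / (z - x2)) r) <= 32 * (M / r / r / r).
  apply: (bsq_div_bound x2r r0 d2) => z fz.
  by do 2!(apply: div0_bound => //); exact: bq.
have E1 : bsq (fun z => D1 z / (z - 0)) r = bsq (fun z => q1 z / (z - 0)) r - bsq (fun z => k1 z / (z - 0)) r.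
  have dq2 z : fsq r z -> differentiable (fun z => q1 z / (z - 0)) z by exact: d2.
  have dk2 z : fsq r z -> differentiable (fun z => k1 z / (z - 0)) z.
    by move=> fz; apply: differentiable_div; [exact: dk1|exact: fsq_neq fz].
  rewrite -[X in _ = _ + X]mulN1r -(bsqZ (-1) r0 dk2) -(bsqD r0 dq2 (fun z fz => differentiableZc (-1) (dk2 z fz))).
  by apply: (eq_bsq r0) => z fz; rewrite /D1 /D /q1 /k1; ring.
have := bsq_step x2r' dqf; rewrite (cauchy_formula x2r' dq) (cauchy_formula n0r dq).
rewrite (bsq_step x2r' d1) -/q1 -/q2 => e.
have {}E : lam R * (q x2 - q 0 - (lam R)^-1 * bsq (fun z => k1 z / (z - 0)) r * x2) =
   x2 * (bsq (fun z => D1 z / (z - 0)) r + x2 * bsq (fun z => q2 z / (z - x2)) r).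
  rewrite E1; have := @lam_neq0 R; move: e.
  move: (bsq (fun z => q2 z / (z - x2)) r) (bsq (fun z => q1 z / (z - 0)) r) => b1 b2.
  move: (bsq _ r) (lam R) (q x2) (q 0) => b3 l u v e ln.
  have -> : u = l^-1 * (l * v + x2 * (b2 + x2 * b1)) by rewrite -e mulrA mulVf// mul1r.
  by field.
rewrite !qE -(ler_pM2l l0) -nrmM E nrmM.
have -> : nrm (lam R) * (32 * (Kl / r + M / r / r / r) / nrm (lam R) * nrm x2 * (nrm x1 + nrm x2)) =
   nrm x2 * (32 * (Kl / r + M / r / r / r) * (nrm x1 + nrm x2)).
  by have := lt0r_neq0 l0; have := lt0r_neq0 r0; move=> ? ?; field; apply/andP.
rewrite ler_wpM2l ?nrm_ge0//; apply: le_trans (nrmD _ _) _; rewrite nrmM.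
have n1 := nrm_ge0 x1; have n2 := nrm_ge0 x2.
have K1 : 0 <= Kl / r by rewrite divr_ge0// ltW.
have K2 : 0 <= M / r / r / r by rewrite !divr_ge0// ltW.
have := ler_wpM2l n2 B2.
move: B1; rewrite [Kl * _ / r]mulrAC.
move: (Kl / r) (M / r / r / r) K1 K2 (nrm x1) (nrm x2) n1 n2 (nrm (bsq _ r)) (nrm (bsq _ r)).
by move=> a b a0 b0 u v u0 v0 s t; nra.
Qed.

(** The second-order Taylor expansion of [h1] along the axis [x.2 = 0], divided by [x1]. *)
Let dir1 : exists c1 c2 : C, exists2 K : R, 0 <= K & forall x1 : C, x1 != 0 ->
  nrm x1 <= r / 2 -> nrm (div_coord (x1, 0) - c1 - c2 * x1) <= K * nrm x1 ^+ 2.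
Proof.
have [||c1 [c2 [K HK]]] := @cauchy_taylor2 R (fun z => h1 (z, 0)) r M r0.
- move=> z rz; apply: differentiable_slice1; apply: dh1.
  by split=> /=; [exact: rect_nbhd r2 rz|rewrite nrm0].
- move=> z fz; apply: bh1.
  by split=> /=; [exact: rect_nbhd r2 (fsq_rect fz)|rewrite nrm0].
exists c1, c2, `|K| => // x1 x10 x1r; have := HK x1 x1r.
rewrite h10 subr0 div1//= => H.
have n1 : 0 < nrm x1 by rewrite nrm_gt0.
rewrite -(ler_pM2r n1) -nrmM.
have -> : (h1 (x1, 0) / x1 - c1 - c2 * x1) * x1 = h1 (x1, 0) - c1 * x1 - c2 * x1 ^+ 2 by field.
apply: le_trans H _; rewrite -mulrA -exprSr.
by rewrite ler_pM2r ?exprn_gt0// ler_norm.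
Qed.

(** Together [dir1] and [dir2] give an affine approximation with quadratic error where [x.1 != 0].
    The bound passes to the axis [x.1 = 0] by a limit, and [c1] is identified with the derivative
    chosen as value at the origin. *)
Lemma differentiable_div_coord0 : differentiable div_coord ((0, 0) : C2).
Proof.
have [c1 [c2 [K1 K10 H1]]] := dir1; have [b [K2 K20 H2]] := dir2.
have r02 : 0 < r / 2 by rewrite divr_gt0.
have Dc1 : 'D_((1, 0) : C2) h1 0 = c1.
  apply: cvg_lim => //; apply/cvg_nrm => e e0.
  have k0 : 0 < nrm c2 + K1 * (r / 2) + 1 by rewrite ltr_wpDl// addr_ge0 ?nrm_ge0// mulr_ge0// ltW.
  apply: (proj2 (nbhs_nrm (0 : C) _)).
  exists (Num.min (r / 2) (e / (nrm c2 + K1 * (r / 2) + 1))).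
    by rewrite lt_min r02 divr_gt0.
  move=> t; rewrite sub0r nrmN lt_min => /andP[t1 t2] t0.
  have -> : t^-1 *: ((h1 \o shift 0) (t *: ((1, 0) : C2)) - h1 0) = div_coord (t, 0).
    rewrite div1//= [h1 0]h10 subr0 addr0 -[LHS]/(t^-1 * _) mulrC; congr (h1 _ / _).
    by rewrite -[LHS]/(t * 1, t * 0) mulr1 mulr0.
  have := H1 t t0 (ltW t1) => H.
  have -> : c1 - div_coord (t, 0) = - ((div_coord (t, 0) - c1 - c2 * t) + c2 * t) by ring.
  rewrite nrmN; apply: le_lt_trans (nrmD _ _) _; rewrite nrmM.
  have nt := nrm_ge0 t; have nc := nrm_ge0 c2.
  move: t2; rewrite ltr_pdivlMr// => t2.
  have : K1 * nrm t ^+ 2 <= K1 * (r / 2) * nrm t.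
    by rewrite expr2 mulrA ler_wpM2r// ler_wpM2l// ltW.
  move: H t2 nt; move: (K1 * nrm t ^+ 2) (K1 * (r / 2)) (nrm _) => *; nra.
pose B := K1 + K2.
have near1 x1 x2 : x1 != 0 -> nrm x1 <= r / 2 -> nrm x2 <= r / 2 ->
   nrm (div_coord (x1, x2) - c1 - c2 * x1 - b * x2) <= B * (nrm x1 + nrm x2) ^+ 2.
  move=> x10 x1r x2r.
  have -> : div_coord (x1, x2) - c1 - c2 * x1 - b * x2 =
    (div_coord (x1, x2) - div_coord (x1, 0) - b * x2) + (div_coord (x1, 0) - c1 - c2 * x1) by ring.
  apply: le_trans (nrmD _ _) _.
  have := H1 x1 x10 x1r; have := H2 x1 x2 x10 x1r x2r.
  have := nrm_ge0 x1; have := nrm_ge0 x2; rewrite /B.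
  move: (nrm x1) (nrm x2) => u v v0 u0 h h'.
  have u2 : u ^+ 2 <= (u + v) ^+ 2 by apply: lerXn2r; rewrite ?nnegrE ?addr_ge0 ?lerDl.
  have v2 : v * (u + v) <= (u + v) ^+ 2 by rewrite expr2 ler_wpM2r ?addr_ge0// lerDr.
  rewrite mulrDl addrC lerD//.
    by apply: le_trans h' _; rewrite ler_wpM2l.
  by apply: le_trans h _; rewrite -mulrA ler_wpM2l.
have div00 : div_coord (0, 0) = c1 by rewrite /div_coord /= eqxx.
apply: (@differentiable_quadratic _ c2 b B (r / 2) r02) => -[x1 x2] /= x1r x2r.
rewrite div00; have [x10|x10] := eqVneq x1 0; last by apply: near1 => //; exact: ltW.
have [x20|x20] := eqVneq x2 0.
  by rewrite x10 x20 div00 subrr !mulr0 !subr0 nrm0 addr0 expr0n mulr0.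
have bx2 z : nrm z <= r / 2 -> bidisc (z, x2) by split=> /=; apply: rd => //; exact: ltW.
(* The error term on the axis, as the value at 0 of a function continuous in the first coordinate;
   at small real t > 0 it is bounded by [near1]. *)
pose G (t : C) := h2 (t, x2) * x2^-1 - c1 - c2 * t - b * x2.
have cG : {for (0 : C), continuous G}.
  have d0 : differentiable (fun z => h2 (z, x2)) (0 : C).
    by apply: differentiable_slice1; apply: dh2; apply: bx2; rewrite nrm0 ltW.
  apply: differentiable_continuous; apply: (@differentiableDc R); last exact: differentiable_cst.
  apply: (@differentiableDc R).
    apply: (@differentiableDc R); last exact: differentiable_cst.
    by apply: (@differentiableMc R); [exact: d0|exact: differentiable_cst].
  by apply: differentiableN; apply: (@differentiableZc R c2 (fun z => z)); exact: ex_diff.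
rewrite x10.
have -> : div_coord (0, x2) - c1 - c2 * 0 - b * x2 = G 0.
  by rewrite /G div2//; apply: bx2; rewrite nrm0 ltW.
rewrite nrm0 add0r; apply/ler_addgt0Pr => e e0.
have B0 : 0 <= B by rewrite addr_ge0.
have L0 : 0 < B * (2 * nrm x2 + r) + 1 by rewrite ltr_wpDl// mulr_ge0// addr_ge0 ?mulr_ge0 ?nrm_ge0// ltW.
have e2 : 0 < e / 2 by rewrite divr_gt0.
have /nbhs_nrm[dl dl0 HG] := (cvg_nrm (nbhs_filter (0 : C)) _ _).1 cG _ e2.
pose t : R := Num.min (Num.min (dl / 2) (r / 2)) (e / 2 / (B * (2 * nrm x2 + r) + 1)).
have t0 : 0 < t by rewrite !lt_min !divr_gt0.
have tdl : t <= dl / 2 by rewrite !ge_min lexx.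
have tr : t <= r / 2 by rewrite !ge_min lexx orbT.
have te : t <= e / 2 / (B * (2 * nrm x2 + r) + 1) by rewrite !ge_min lexx orbT.
have nt : nrm (t%:C : C) = t by rewrite nrm_real gtr0_norm.
have tC0 : (t%:C : C) != 0 by rewrite -nrm_gt0 nt.
have := HG t%:C; rewrite sub0r nrmN nt => /(_ _) HGt.
have {}HGt : nrm (G 0 - G t%:C) < e / 2 by apply: HGt; move: tdl; have := dl0; lra.
have := near1 t%:C x2 tC0; rewrite nt => /(_ tr (ltW x2r)).
have -> : div_coord (t%:C, x2) = h2 (t%:C, x2) * x2^-1.
  by rewrite div2//; apply: bx2; rewrite nt.
rewrite -/(G _) => Gt.
have := nrm_tri (G t%:C) (G 0) 0; rewrite !subr0.
move: te; rewrite ler_pdivlMr// => te.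
have := nrm_ge0 x2.
move: HGt Gt te B0 t0 tr; move: (nrm (G 0 - _)) (nrm (G _)) (nrm (G 0)) (nrm x2) => s u v w.
move=> h1' h2' h3 h4 h5 h6 h7 h8.
have : B * (t + w) ^+ 2 <= B * w ^+ 2 + t * (B * (2 * w + r) + 1).
  have -> : B * w ^+ 2 + t * (B * (2 * w + r) + 1) = B * (t + w) ^+ 2 + (B * (t * (r - t)) + t) by ring.
  rewrite lerDl; apply: addr_ge0; last exact: ltW.
  apply: mulr_ge0 => //; apply: mulr_ge0; first exact: ltW.
  by move: h6; have := r0; lra.
by move: h1' h2' h3 h8; lra.
Qed.

End Division.
End Slices.

Section HolomorphicDivision.
Variable R : realType.
Local Notation C := (Cplx R).
Local Notation C2 := (C * C)%type.
Implicit Types (W : set C2) (f g h : C2 -> C).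

Lemma open_bidisc W (x : C2) : open W -> W x -> exists2 rho : R, 0 < rho &
  forall y : C2, nrm (x.1 - y.1) < rho -> nrm (x.2 - y.2) < rho -> W y.
Proof. by move=> oW Wx; apply/nbhs_nrm2; exact: open_nbhs_nbhs. Qed.

Lemma locally_bounded h (x : C2) : differentiable h x -> exists2 rho : R, 0 < rho &
  forall y : C2, nrm (x.1 - y.1) < rho -> nrm (x.2 - y.2) < rho -> nrm (h y) <= nrm (h x) + 1.
Proof.
move=> /differentiable_continuous ch.
have /nbhs_nrm2[rho rho0 H] := (cvg_nrm (nbhs_filter x) _ _).1 ch 1 ltr01.
exists rho => // y y1 y2; have := H y y1 y2; rewrite nrmB => hy.
by have := nrm_tri (h x) (h y) 0; rewrite !subr0; move: hy; clear; lra.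
Qed.

(** Near any point other than the origin one of the two quotients is a quotient by a nonvanishing
    function; the origin is [differentiable_div_coord0]. *)
Lemma holo_div_coord W (h1 h2 : C2 -> C) : open W -> holo W h1 -> holo W h2 ->
  (forall x, W x -> x.2 * h1 x = x.1 * h2 x) -> holo W (div_coord h1 h2).
Proof.
move=> oW dh1 dh2 h12 x Wx.
have div2 y : W y -> y.2 != 0 -> div_coord h1 h2 y = h2 y / y.2.
  move=> Wy y2; rewrite /div_coord y2; case: eqP => //= /eqP y1.
  by apply/eqP; rewrite eqr_div// mulrC h12// mulrC.
have oWx : nbhs x W by exact: open_nbhs_nbhs.
have [x1|x1] := eqVneq x.1 0; last first.
  apply: (near_differentiable (f := fun y => h1 y * (y.1)^-1)).
    apply/nbhs_nrm2; exists (nrm x.1); first by rewrite nrm_gt0.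
    move=> y xy _; rewrite /div_coord; case: eqP => //= y1.
    by move: xy; rewrite y1 subr0 ltxx.
  by apply: differentiable2M; [exact: dh1|apply: differentiable2V => //; exact: differentiable_c1].
have [x2|x2] := eqVneq x.2 0; last first.
  have [rho rho0 H] := open_bidisc oW Wx.
  apply: (near_differentiable (f := fun y => h2 y * (y.2)^-1)).
    apply/nbhs_nrm2; exists (Num.min rho (nrm x.2)); first by rewrite lt_min rho0 nrm_gt0.
    move=> y; rewrite !lt_min => /andP[a1 a2] /andP[b1 b2]; rewrite div2//; first exact: H.
    by apply/eqP => y2; move: b2; rewrite y2 subr0 ltxx.
  by apply: differentiable2M; [exact: dh2|apply: differentiable2V => //; exact: differentiable_c2].
have x0 : x = (0, 0) by rewrite [x]surjective_pairing x1 x2.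
rewrite x0 in Wx *.
have [rho rho0 H] := open_bidisc oW Wx.
have [r1 r10 H1] := locally_bounded (dh1 _ Wx).
have [r2 r20 H2] := locally_bounded (dh2 _ Wx).
pose r := Num.min rho (Num.min r1 r2).
have r0 : 0 < r by rewrite !lt_min rho0 r10.
have bd (y : C2) : nrm y.1 < r /\ nrm y.2 < r ->
  [/\ W y, nrm (h1 y) <= nrm (h1 (0, 0)) + 1 & nrm (h2 y) <= nrm (h2 (0, 0)) + 1].
  by rewrite !lt_min => -[/and3P[a1 a2 a3] /and3P[b1 b2 b3]]; split;
    [apply: H|apply: H1|apply: H2]; rewrite sub0r nrmN.
apply: (@differentiable_div_coord0 R h1 h2 r
  (Num.max (nrm (h1 (0, 0)) + 1) (nrm (h2 (0, 0)) + 1)) r0).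
- by move=> y /bd[Wy _ _]; exact: dh1.
- by move=> y /bd[Wy _ _]; exact: dh2.
- by move=> y /bd[_ b1 _]; rewrite le_max b1.
- by move=> y /bd[_ _ b2]; rewrite le_max b2 orbT.
- by move=> y /bd[Wy _ _]; exact: h12.
Qed.

(** Points of the axis are approached horizontally by points with [x.1 != 0]. This reduces
    identities for [div_coord] to places where [x.1] is invertible. *)
Lemma holo_eq_dense W f g : open W -> holo W f -> holo W g ->
  (forall x, W x -> x.1 != 0 -> f x = g x) -> forall x, W x -> f x = g x.
Proof.
move=> oW df dg fg x Wx.
have [x1|] := eqVneq x.1 0; last exact: fg.
apply/eqP; rewrite -subr_eq0 -nrm_eq0; apply/eqP/lt_all_eq0; first exact: nrm_ge0.
move=> e e0; have e2 : 0 < e / 2 by rewrite divr_gt0.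
have cf := differentiable_continuous (df _ Wx).
have cg := differentiable_continuous (dg _ Wx).
have /nbhs_nrm2[r1 r10 H1] := (cvg_nrm (nbhs_filter x) _ _).1 cf _ e2.
have /nbhs_nrm2[r2 r20 H2] := (cvg_nrm (nbhs_filter x) _ _).1 cg _ e2.
have [r3 r30 H3] := open_bidisc oW Wx.
pose t : R := Num.min r1 (Num.min r2 r3) / 2.
have m0 : 0 < Num.min r1 (Num.min r2 r3) by rewrite !lt_min r10 r20.
have t0 : 0 < t by rewrite divr_gt0.
have tm : t < Num.min r1 (Num.min r2 r3) by rewrite ltr_pdivrMr// ltr_pMr// ltr1n.
move: tm; rewrite !lt_min => /and3P[t1 t2 t3].
have nt : nrm (t%:C : C) = t by rewrite nrm_real gtr0_norm.
pose y : C2 := (t%:C, x.2).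
have y1 : nrm (x.1 - y.1) = t by rewrite x1 sub0r nrmN nt.
have y2 : nrm (x.2 - y.2) = 0 by rewrite subrr nrm0.
have Hf : nrm (f x - f y) < e / 2 by apply: H1; rewrite ?y1 ?y2.
have Hg : nrm (g x - g y) < e / 2 by apply: H2; rewrite ?y1 ?y2.
have fgy : f y = g y by apply: fg; [apply: H3; rewrite ?y1 ?y2|rewrite -nrm_gt0 nt].
have := nrm_tri (f y) (f x) (g x); rewrite {2}fgy [nrm (g y - g x)]nrmB.
by move: Hf Hg; clear; lra.
Qed.

End HolomorphicDivision.

(** With m > n, the coordinates of the [v i] in a spanning family of [n] elements are linearly
    dependent, which puts a nontrivial combination into [N]. It bounds both summands of the charge
    from below. *)
Lemma quotient_dim_ge (R : realType) (V : lmodType (Cplx R)) (S N : set V) (n m : nat)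
    (v : 'I_m -> V) : quotient_dim S N n ->
  N 0 -> (forall x y, N x -> N y -> N (x + y)) -> (forall c x, N x -> N (c *: x)) ->
  (forall i, S (v i)) ->
  (forall c : 'I_m -> Cplx R, N (\sum_i c i *: v i) -> forall i, c i = 0) -> (m <= n)%N.
Proof.
move=> [e [_ span _]] N0 ND NZ Sv ind; rewrite leqNgt; apply/negP => nm.
have /choice[A HA] : forall i, exists c : 'I_n -> Cplx R, N (v i - \sum_k c k *: e k).
  by move=> i; exact: span.
have [a a0 aA] := kernel_vector (\matrix_(i < m, k < n) A i k) nm.
move: a0; rewrite (_ : a = 0) ?eqxx//; apply/rowP => i; rewrite mxE; move: i.
apply: ind.
have Z : \sum_i \sum_k a 0 i *: (A i k *: e k) = 0.
  rewrite exchange_big big1//= => k _; under eq_bigr do rewrite scalerA.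
  rewrite -scaler_suml; move/rowP: aA => /(_ k); rewrite !mxE => aA.
  by move: aA; under eq_bigr do rewrite mxE; move=> ->; rewrite scale0r.
have -> : \sum_i a 0 i *: v i = \sum_i a 0 i *: (v i - \sum_k A i k *: e k).
  by under [RHS]eq_bigr do rewrite scalerBr scaler_sumr; rewrite sumrB Z subr0.
by elim/big_ind: _ => // i _; apply: NZ; exact: HA.
Qed.

Lemma differentiable2X (R : realType) (f : Cplx R * Cplx R -> Cplx R) n x :
  differentiable f x -> differentiable (fun x => f x ^+ n) x.
Proof.
move=> df; elim: n => [|n IH].
  by under eq_fun do rewrite expr0; exact: differentiable_cst.
by under eq_fun do rewrite exprS; exact: differentiable2M.
Qed.

(** * Entire functions and polynomials seen from infinity *)

Section EntirePolynomials.
Variable R : realType.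
Local Notation C := (Cplx R).
Implicit Types (F G : C -> C) (q : {poly C}).

(** Continuity of [G] at 0 is a limit of [F] at infinity; this is how data regular on both charts of
    ell become constant. *)
Lemma entire_glue F G : (forall z, differentiable F z) -> {for 0, continuous G} ->
  (forall z, z != 0 -> F z = G z^-1) -> forall z, F z = G 0.
Proof.
move=> dF cG FG; apply: entire_limit => // e e0.
have /nbhs_nrm[dl dl0 H] := (cvg_nrm (nbhs_filter (0 : C)) _ _).1 cG e e0.
exists (2 / dl) => z zdl; have d2 : 0 < 2 / dl by rewrite divr_gt0.
have nz : 0 < nrm z := lt_le_trans d2 zdl.
rewrite FG -?nrm_gt0// nrmB; apply/ltW/H; rewrite sub0r nrmN nrmV.
by rewrite invf_plt ?posrE// (lt_le_trans _ zdl)// ltr_pdivlMr// mulVf ?gt_eqF// ltr1n.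
Qed.

Lemma poly_eq0 q : (forall z, z != 0 -> q.[z] = 0) -> q = 0.
Proof.
move=> q0; apply/eqP; apply: contraT => qn0.
have := @max_poly_roots _ q [seq i.+1%:R | i <- iota 0 (size q)] qn0.
rewrite size_map size_iota ltnn; apply.
  by apply/allP => _ /mapP[i _ ->]; rewrite rootE q0 ?pnatr_eq0.
rewrite map_inj_uniq ?iota_uniq// => i k /eqP; rewrite eqr_nat eqSS => /eqP; exact.
Qed.

Lemma differentiable_horner q z : differentiable (fun z => q.[z]) z.
Proof.
elim/poly_ind: q => [|q c IH].
  by under eq_fun do rewrite horner0; exact: differentiable_cst.
under eq_fun do rewrite hornerMXaddC.
apply: differentiableDc; last exact: differentiable_cst.
by apply: (differentiableMc IH); exact: ex_diff.
Qed.

(** The reciprocal polynomial xi^n q(1/xi), by which polynomials in z are read in the coordinate xi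
    of V. *)
Definition revp (n : nat) q : {poly C} := \poly_(i < n.+1) q`_(n - i).

Lemma horner_revp n q (z : C) : (size q <= n.+1)%N -> z != 0 ->
  (revp n q).[z^-1] = z ^- n * q.[z].
Proof.
move=> sq z0; rewrite horner_poly (horner_coef_wide _ sq) mulr_sumr.
rewrite (reindex_inj rev_ord_inj) /=; apply: eq_bigr => i _.
have i_n : (i <= n)%N by rewrite -ltnS.
rewrite subSS subKn// mulrCA; congr (_ * _).
by rewrite exprVn expfB_cond ?(negbTE z0)// invf_div mulrC.
Qed.

End EntirePolynomials.

(** * The charge *)

Arguments sections {R} _ _ _.
Arguments zeros {R} _ _ _.
Arguments zero_germ {R} _ _ _.
Arguments global_section {R} _ _.
Arguments global_zero {R} _ _.
Arguments bidual_map {R} _ _.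

Section Germs.
Variables (R : realType) (F : presheaf R).
Hypothesis zeros0 : forall W, zeros F W 0.
Hypothesis zerosD : forall W s t, zeros F W s -> zeros F W t -> zeros F W (s + t).
Hypothesis zerosZ : forall W c s, zeros F W s -> zeros F W (c *: s).
Hypothesis zerosS : forall W W' s, W' `<=` W -> zeros F W s -> zeros F W' s.

Lemma global_zero0 : global_zero F 0.
Proof. by move=> x; exists setT; split => //; exact: openT. Qed.

Lemma global_zeroD s t : global_zero F s -> global_zero F t ->
  global_zero F (s + t).
Proof.
move=> sz tz x; have [W [oW Wx sW]] := sz x; have [W' [oW' Wx' tW]] := tz x.
exists (W `&` W'); split; [exact: openI|by []|apply: zerosD].
- exact: (zerosS (@subIsetl _ _ _) sW).
- exact: (zerosS (@subIsetr _ _ _) tW).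
Qed.

Lemma global_zeroZ c s : global_zero F s -> global_zero F (c *: s).
Proof.
by move=> sz x; have [W [oW Wx sW]] := sz x; exists W; split => //; exact: zerosZ.
Qed.

Lemma constant_global_section (s : ambient F) : sections F setT s ->
  global_section F (fun=> s).
Proof.
move=> Fs x; exists setT; split=> //; first exact: openT.
by move=> y _; exists setT; split => //; [exact: openT|rewrite subrr].
Qed.

End Germs.

(** * Lower bound for the first direct image *)

Section FirstDirectImage.
Variables (R : realType) (j : nat) (p : coeffs R j).
Hypothesis j2 : (2 <= j)%N.
Local Notation C := (Cplx R).
Local Notation C2 := (C * C)%type.
Local Notation F := (first_direct_image p).

Lemma vholoD W (s t : C2 -> 'cV[C]_2) : vholo W s -> vholo W t -> vholo W (s + t).
Proof.
move=> ds dt i x Wx.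
have -> : (fun x => (s + t) x i 0) = (fun x => s x i 0 + t x i 0).
  by apply/funext => y; rewrite -[(s + t) y]/(s y + t y) mxE.
by apply: differentiable2D; [exact: ds|exact: dt].
Qed.

Lemma vholoZ W c (s : C2 -> 'cV[C]_2) : vholo W s -> vholo W (c *: s).
Proof.
move=> ds i x Wx.
have -> : (fun x => (c *: s) x i 0) = (fun x => c * s x i 0).
  by apply/funext => y; rewrite -[(c *: s) y]/(c *: s y) mxE.
by apply: differentiable2Z; exact: ds.
Qed.

Lemma vholo0 W : vholo W (0 : C2 -> 'cV[C]_2).
Proof.
move=> i x Wx; have -> : (fun x => (0 : C2 -> 'cV[C]_2) x i 0) = (fun=> 0).
  by apply/funext => y; rewrite -[(0 : C2 -> 'cV[C]_2) y]/(0 : 'cV[C]_2) mxE.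
exact: differentiable_cst.
Qed.

Lemma vholoS W W' (s : C2 -> 'cV[C]_2) : W' `<=` W -> vholo W s -> vholo W' s.
Proof. by move=> WW ds i x Wx; apply: ds; exact: WW. Qed.

Lemma fdi_zeros0 W : zeros F W 0.
Proof.
exists 0, 0; split; [exact: vholo0|exact: vholo0|].
by move=> x _ _; rewrite -[(0 : C2 -> 'cV[C]_2) _]/(0 : 'cV[C]_2) mulmx0 subr0.
Qed.

Lemma fdi_zerosD W s t : zeros F W s -> zeros F W t -> zeros F W (s + t).
Proof.
move=> [sU [sV [h1 h2 h3]]] [tU [tV [k1 k2 k3]]].
exists (sU + tU), (sV + tV); split; [exact: vholoD|exact: vholoD|].
move=> x xUV Wx; rewrite -[(s + t) x]/(s x + t x) h3// k3//.
by rewrite -[(sV + tV) _]/(sV _ + tV _) -[(sU + tU) _]/(sU _ + tU _) mulmxDr opprD addrACA.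
Qed.

Lemma fdi_zerosZ W c s : zeros F W s -> zeros F W (c *: s).
Proof.
move=> [sU [sV [h1 h2 h3]]].
exists (c *: sU), (c *: sV); split; [exact: vholoZ|exact: vholoZ|].
move=> x xUV Wx; rewrite -[(c *: s) x]/(c *: s x) h3//.
by rewrite -[(c *: sV) _]/(c *: sV _) -[(c *: sU) _]/(c *: sU _) -scalemxAr scalerBr.
Qed.

Lemma fdi_zerosS W W' s : W' `<=` W -> zeros F W s -> zeros F W' s.
Proof.
move=> WW [sU [sV [h1 h2 h3]]]; exists sU, sV; split.
- by apply: vholoS h1 => x; exact: WW.
- by apply: vholoS h2 => x; exact: WW.
- by move=> x xUV /WW; exact: h3.
Qed.

Lemma pfun_u0 (z : C) : pfun p (z, 0) = 0.
Proof. by rewrite /pfun big1// => i _; rewrite mulr0. Qed.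

(* A class z^m with 0 < m < j in the upper component does not split on ell: its
   splitting would extend to a bounded entire function. *)
Lemma first_direct_image_dim n : h0 F n -> (j.-1 <= n)%N.
Proof.
move=> hn; pose mon (m : 'I_j.-1) : C2 -> 'cV[C]_2 :=
  fun x => \col_(i < 2) if i == 0 then x.1 ^+ m.+1 else 0.
apply: (@quotient_dim_ge R _ _ _ n j.-1 (fun m _ => mon m) hn).
- exact: (global_zero0 fdi_zeros0).
- exact: (global_zeroD fdi_zerosD fdi_zerosS).
- exact: (global_zeroZ fdi_zerosZ).
- move=> m; apply: (constant_global_section fdi_zeros0) => /= i x _.
  have -> : (fun x => mon m x i 0) = (fun x => if i == 0 then x.1 ^+ m.+1 else 0).
    by apply/funext => y; rewrite mxE.
  case: (i == 0); last exact: differentiable_cst.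
  by apply: differentiable2X; exact: differentiable_c1.
(* The germ at the origin is enough: tau contracts ell to the origin, so the splitting is defined
   along all of ell. *)
move=> c cN; have [W [oW W0 [sU [sV [dU dV E]]]]] := cN (0, 0).
pose q : {poly C} := \poly_(i < j.-1) (if insub i is Some m then c m else 0).
have qE (z : C) : \sum_i c i * z ^+ i.+1 = z * q.[z].
  rewrite horner_poly mulr_sumr; apply: eq_bigr => i _.
  by rewrite valK exprS mulrCA.
pose f z := sU (z, 0) 0 0; pose g z := sV (z, 0) 0 0.
have df z : differentiable f z.
  apply: (@differentiable_slice1 R (fun x => sU x 0 0) z 0); apply: dU.
  by rewrite /preimage /tauU /= mulr0.
have dg z : differentiable g z.
  apply: (@differentiable_slice1 R (fun x => sV x 0 0) z 0); apply: dV.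
  by rewrite /preimage /tauV /= mulr0.
have eq0 z : z != 0 -> z * q.[z] = g z^-1 - z ^+ j * f z.
  move=> z0; have := E (z, 0) z0; rewrite /tauU /= mulr0 => /(_ W0)/matrixP/(_ 0 0).
  rewrite mxE [in RHS]mxE !mxE big_ord_recl big_ord1 !mxE /= pfun_u0 mul0r addr0.
  rewrite /Defs.glue /= mulr0 => e.
  apply: etrans e; rewrite -qE !fct_sumE summxE.
  by apply: eq_bigr => i _; rewrite !mxE.
(* Solved for [f], the relation expresses it by 1/z; both terms of [G] carry a factor xi, so the
   limit at infinity is 0. *)
have F0 z : f z = 0.
  pose G (xi : C) := xi ^+ j * g xi - xi * (revp j.-2 q).[xi].
  have cG : {for 0, continuous G}.
    apply: differentiable_continuous; apply: (@differentiableDc R).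
      apply: (@differentiableMc R); last exact: dg.
      have -> : (fun xi : C => xi ^+ j) = (fun xi => 'X^j.[xi]).
        by apply/funext => xi; rewrite hornerXn.
      exact: differentiable_horner.
    apply: differentiableN; apply: (@differentiableMc R); first exact: ex_diff.
    exact: differentiable_horner.
  rewrite (entire_glue df cG) /G ?mul0r ?subr0 ?expr0n.
    by case: (j) j2 => //= ? _; rewrite mul0r.
  move=> y y0; rewrite horner_revp//; last first.
    by rewrite (leq_trans (size_poly _ _))//; case: (j) j2 => // -[].
  have -> : f y = y ^- j * (g y^-1 - y * q.[y]).
    by rewrite eq0// opprB addrC subrK mulKf// expf_neq0.
  have [m jm] : exists m, j = m.+2 by case: (j) j2 => [|[|m]] // _; exists m.
  rewrite jm exprVn !exprS; have : y ^+ m != 0 by rewrite expf_neq0.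
  move: (y ^+ m) (g _) (q.[y]) => a b c' a0; field.
  by rewrite a0 y0.
(* Now z q(z) = g(1/z) is entire with a limit at infinity, hence constant, and it vanishes at 0. *)
have q0 : q = 0.
  suff : 'X * q = 0 by move/eqP; rewrite mulf_eq0 polyX_eq0 => /eqP.
  have cg : {for 0, continuous g} by exact: differentiable_continuous.
  have qg z : ('X * q).[z] = g 0.
    apply: entire_glue cg _ z => [z|z z0]; first exact: differentiable_horner.
    by rewrite hornerM hornerX eq0// F0 mulr0 subr0.
  have g0 : g 0 = 0 by rewrite -(qg 0) hornerM hornerX mul0r.
  by apply: poly_eq0 => z _; rewrite qg g0.
move=> i; have := congr1 (fun q : {poly C} => q`_i) q0.
by rewrite coef_poly ltn_ord valK coef0.
Qed.

End FirstDirectImage.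

Arguments scal {R} _ _ _.

(** * Elements of the bidual obtained by division *)

Section Bidual.
Variables (R : realType) (j : nat) (p : coeffs R j).
Hypothesis j2 : (2 <= j)%N.
Local Notation C := (Cplx R).
Local Notation C2 := (C * C)%type.
Local Notation F := (direct_image p).

Definition col2 (a b : C) : 'cV[C]_2 := \col_i if i == 0 then a else b.

Lemma pfunE (z u : C) : z != 0 ->
  pfun p (z, u) = z ^- j.-2 * (rVpoly p).[z] * u.
Proof.
move=> z0; rewrite horner_poly mulr_sumr mulr_suml; apply: eq_bigr => i _ /=.
rewrite valK; have -> : i%:Z + 2 - j%:Z = i%:Z - (j.-2)%:Z by lia.
by rewrite expfzDr// -exprnP -exprnN; ring.
Qed.

Lemma holo_horner1 W (q : {poly C}) : holo W (fun x : C2 => q.[x.1]).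
Proof.
move=> x _; apply: (@differentiable_comp _ _ _ _ (fun x : C2 => x.1) (fun z => q.[z])).
  exact: differentiable_c1.
exact: differentiable_horner.
Qed.

Lemma holo_col2 W (a b : C2 -> C) : holo W a -> holo W b -> vholo W (fun x => col2 (a x) (b x)).
Proof.
move=> da db i x Wx.
have -> : (fun x => col2 (a x) (b x) i 0) = if i == 0 then a else b.
  by apply/funext => y; rewrite mxE; case: (i == 0).
by case: (i == 0); [exact: da|exact: db].
Qed.

Lemma holoM W (f g : C2 -> C) : holo W f -> holo W g -> holo W (fun x => f x * g x).
Proof. by move=> df dg x Wx; apply: differentiable2M; [exact: df|exact: dg]. Qed.
Lemma holoD W (f g : C2 -> C) : holo W f -> holo W g -> holo W (fun x => f x + g x).
Proof. by move=> df dg x Wx; apply: differentiable2D; [exact: df|exact: dg]. Qed.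
Lemma holo_cst W (k : C) : holo W (fun=> k).
Proof. by move=> x _; exact: differentiable_cst. Qed.
Lemma holo1 W : holo W (fun x : C2 => x.1).
Proof. by move=> x _; exact: differentiable_c1. Qed.
Lemma holo2 W : holo W (fun x : C2 => x.2).
Proof. by move=> x _; exact: differentiable_c2. Qed.
Lemma holoS W W' (f : C2 -> C) : W' `<=` W -> holo W f -> holo W' f.
Proof. by move=> WW df x /WW; exact: df. Qed.

Lemma di_sections0 W : sections F W 0.
Proof.
split; [exact: vholo0|exact: vholo0|] => x _ _.
by rewrite -[(0 : ambient F).1 x]/(0 : 'cV[C]_2) mulmx0.
Qed.

Lemma di_sectionsD W s t : sections F W s -> sections F W t -> sections F W (s + t).
Proof.
move=> [h1 h2 h3] [k1 k2 k3]; split; [exact: vholoD|exact: vholoD|] => x xUV Wx.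
rewrite -[(s + t).2 _]/(s.2 _ + t.2 _) -[(s + t).1 _]/(s.1 _ + t.1 _).
by rewrite h3// k3// mulmxDr.
Qed.

Lemma di_sectionsZ W c s : sections F W s -> sections F W (c *: s).
Proof.
move=> [h1 h2 h3]; split; [exact: vholoZ|exact: vholoZ|] => x xUV Wx.
rewrite -[(c *: s).2 _]/(c *: s.2 _) -[(c *: s).1 _]/(c *: s.1 _).
by rewrite h3// scalemxAr.
Qed.

Lemma di_sectionsS W W' s : W' `<=` W -> sections F W s -> sections F W' s.
Proof.
move=> WW [h1 h2 h3]; split.
- by apply: vholoS h1 => x; exact: WW.
- by apply: vholoS h2 => x; exact: WW.
- by move=> x xUV /WW; exact: h3.
Qed.

Lemma dual_sectionsS W W' phi : W' `<=` W -> sections (dual F) W phi ->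
  sections (dual F) W' phi.
Proof. by move=> WW dphi W'' oW'' sW''; apply: dphi => // x /sW''; exact: WW. Qed.

Lemma dual_section0 W phi x : open W -> sections (dual F) W phi -> W x -> phi W 0 x = 0.
Proof.
move=> oW dphi Wx; have [_ z _ _] := dphi W oW (@subset_refl _ W).
exact: (z 0 (di_sections0 W) (conj (fun _ _ => erefl) (fun _ _ => erefl)) x Wx).
Qed.

Section Extension.
Variables e1 e2 : ambient F.
Hypothesis Fe1 : sections F setT e1.
Hypothesis Fe2 : sections F setT e2.
Hypothesis e12 : scal F (fun x => x.2) e1 = scal F (fun x => x.1) e2.

(* The element e1 / x.1 = e2 / x.2 of the bidual. *)
Definition bidual_div : ambient (dual (dual F)) :=
  fun W phi => div_coord (phi W e1) (phi W e2).

Lemma Fe1S W : sections F W e1. Proof. exact: (di_sectionsS (@subsetT _ W)). Qed.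
Lemma Fe2S W : sections F W e2. Proof. exact: (di_sectionsS (@subsetT _ W)). Qed.

Lemma dual_relation W phi x : open W -> sections (dual F) W phi -> W x ->
  x.2 * phi W e1 x = x.1 * phi W e2 x.
Proof.
move=> oW dphi Wx; have [_ _ lin _] := dphi W oW (@subset_refl _ W).
have Z := dual_section0 oW dphi Wx.
have L1 := lin _ e1 0 (@holo2 W) (Fe1S W) (di_sections0 W) x Wx.
have L2 := lin _ e2 0 (@holo1 W) (Fe2S W) (di_sections0 W) x Wx.
by move: L1 L2; rewrite !addr0 Z !addr0 e12 => <- <-.
Qed.

Lemma dual_holo W phi : open W -> sections (dual F) W phi ->
  holo W (phi W e1) /\ holo W (phi W e2).
Proof.
move=> oW dphi; have [hol _ _ _] := dphi W oW (@subset_refl _ W).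
by split; apply: hol; [exact: Fe1S|exact: Fe2S].
Qed.

Lemma bidual_div_holo W phi : open W -> sections (dual F) W phi ->
  holo W (bidual_div W phi).
Proof.
move=> oW dphi; have [d1 d2] := dual_holo oW dphi.
by apply: (holo_div_coord oW d1 d2) => x; exact: dual_relation.
Qed.

Lemma bidual_divE W phi x : x.1 != 0 -> bidual_div W phi x = phi W e1 x / x.1.
Proof. by move=> x1; rewrite /bidual_div /div_coord x1. Qed.

(** Holomorphy is [holo_div_coord]. The remaining conditions are identities that are immediate where
    [x.1 != 0] and extend by [holo_eq_dense]. *)
Lemma bidual_div_section : sections (dual (dual F)) setT bidual_div.
Proof.
move=> W oW _; split.
- by move=> phi; exact: bidual_div_holo.
- move=> phi dphi zphi; apply: (holo_eq_dense oW (bidual_div_holo oW dphi) (holo_cst _)).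
  move=> x Wx x1; rewrite bidual_divE//.
  by rewrite (zphi W e1 oW (@subset_refl _ W) (Fe1S W) x Wx) mul0r.
- move=> a phi psi da dphi dpsi.
  have [d1 d2] := dual_holo oW dphi; have [k1 k2] := dual_holo oW dpsi.
  apply: (holo_eq_dense oW).
  + apply: (holo_div_coord oW (holoD (holoM da d1) k1) (holoD (holoM da d2) k2)).
    move=> x Wx /=; by rewrite !mulrDr !(mulrCA _ (a x)) !dual_relation.
  + exact: (holoD (holoM da (bidual_div_holo oW dphi)) (bidual_div_holo oW dpsi)).
  + move=> x Wx x1; rewrite !bidual_divE//.
    rewrite -[(_ + psi) W e1 x]/(a x * phi W e1 x + psi W e1 x).
    by rewrite mulrDl mulrA.
- move=> W'' phi oW'' sW dphi.
  have dphi'' : sections (dual F) W'' phi by exact: dual_sectionsS dphi.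
  apply: (holo_eq_dense oW''); first exact: bidual_div_holo.
    by apply: holoS sW _; exact: bidual_div_holo.
  move=> x Wx x1; rewrite !bidual_divE//.
  have [_ _ _ res] := dphi W oW (@subset_refl _ W).
  by rewrite (res W'' e1 oW'' sW (Fe1S W) x Wx).
Qed.

End Extension.

Lemma bq_zeros0 W : zeros (bidual_quotient F) W 0.
Proof.
exists 0; first exact: di_sections0.
by move=> W' phi oW' sW dphi x Wx; rewrite -[LHS]/(0 - phi W' 0 x) (dual_section0 oW' dphi)// subr0.
Qed.

Lemma dual_sectionD W phi s t x : open W -> sections (dual F) W phi ->
  sections F W s -> sections F W t -> W x -> phi W (s + t) x = phi W s x + phi W t x.
Proof.
move=> oW dphi Fs Ft Wx; have [_ _ lin _] := dphi W oW (@subset_refl _ W).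
have := lin (fun=> 1) s t (holo_cst _) Fs Ft x Wx; rewrite mul1r => <-.
by congr (phi W (_ + t) x); rewrite /=; case: (s) => a b; congr pair; apply/funext => y /=; rewrite scale1r.
Qed.

Lemma dual_sectionZ W phi c s x : open W -> sections (dual F) W phi ->
  sections F W s -> W x -> phi W (c *: s) x = c * phi W s x.
Proof.
move=> oW dphi Fs Wx; have [_ _ lin _] := dphi W oW (@subset_refl _ W).
have := lin (fun=> c) s 0 (holo_cst _) Fs (di_sections0 W) x Wx.
by rewrite addr0 (dual_section0 oW dphi)// addr0 => <-.
Qed.

Lemma bq_zerosD W s t : zeros (bidual_quotient F) W s -> zeros (bidual_quotient F) W t ->
  zeros (bidual_quotient F) W (s + t).
Proof.
move=> [u Fu zu] [v Fv zv]; exists (u + v); first exact: di_sectionsD.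
move=> W' phi oW' sW dphi x Wx.
rewrite -[LHS]/(s W' phi x + t W' phi x - phi W' (u + v) x).
rewrite (dual_sectionD oW' dphi)//; try exact: (di_sectionsS sW).
have := zu W' phi oW' sW dphi x Wx; have := zv W' phi oW' sW dphi x Wx.
rewrite -[X in X = 0 -> _]/(t W' phi x - phi W' v x).
rewrite -[X in _ -> X = 0 -> _]/(s W' phi x - phi W' u x) => a b.
by rewrite opprD addrACA a b addr0.
Qed.

Lemma bq_zerosZ W c s : zeros (bidual_quotient F) W s ->
  zeros (bidual_quotient F) W (c *: s).
Proof.
move=> [u Fu zu]; exists (c *: u); first exact: di_sectionsZ.
move=> W' phi oW' sW dphi x Wx.
rewrite -[LHS]/(c * s W' phi x - phi W' (c *: u) x).
rewrite (dual_sectionZ _ oW' dphi)//; last exact: (di_sectionsS sW).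
have := zu W' phi oW' sW dphi x Wx.
rewrite -[X in X = 0 -> _]/(s W' phi x - phi W' u x) => a.
by rewrite -mulrBr a mulr0.
Qed.

Lemma bq_zerosS W W' s : W' `<=` W -> zeros (bidual_quotient F) W s ->
  zeros (bidual_quotient F) W' s.
Proof.
move=> WW [u Fu zu]; exists u; first exact: di_sectionsS Fu.
by move=> W'' phi oW'' sW; apply: zu => // x /sW; exact: WW.
Qed.

End Bidual.

(** * From the charge to the rank of the Toeplitz matrix *)

Section ChargeRank.
Variables (R : realType) (j : nat) (p : coeffs R j).
Hypothesis j2 : (2 <= j)%N.
Local Notation C := (Cplx R).
Local Notation C2 := (C * C)%type.
Local Notation F := (direct_image p).
Local Notation P := (rVpoly p).
Local Notation toeplitz := (toeplitz j P).

Section Elements.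
Variables f lo hi : {poly C}.
Hypothesis sf : (size f <= j)%N.
Hypothesis slo : (size lo <= j.-1)%N.
Hypothesis gap : P * f = lo + 'X^(2 * j - 2) * hi.

(** In the coordinates (u, zu) of C^2, [ext1] divided by u and [ext2] divided by zu are the same
    section of the bundle off ell, equal to (- hi, f / u) on U. The entry - hi cancels the terms of
    pi f with exponents at least j; by the gap what is left comes from [lo] and is regular on V. *)
Definition ext1 : ambient F :=
  (fun x => col2 (- (x.2 * hi.[x.1])) f.[x.1],
   fun y => col2 (y.1 * y.2 * (revp j.-2 lo).[y.1]) (y.1 * (revp j.-1 f).[y.1])).

Definition ext2 : ambient F :=
  (fun x => col2 (- (x.1 * x.2 * hi.[x.1])) (x.1 * f.[x.1]),
   fun y => col2 (y.2 * (revp j.-2 lo).[y.1]) ((revp j.-1 f).[y.1])).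

Lemma ext12 : scal F (fun x => x.2) ext1 = scal F (fun x => x.1) ext2.
Proof.
rewrite /=; congr pair; apply/funext => x; apply/colP => i; rewrite !mxE /=;
  by case: (i == 0); ring.
Qed.

Lemma holoN W (g : C2 -> C) : holo W g -> holo W (fun x => - g x).
Proof. by move=> dg x Wx; apply: differentiableN; exact: dg. Qed.

Lemma gap_eval (z : C) : z != 0 ->
  z ^- j.-2 * P.[z] * f.[z] - z ^+ j * hi.[z] = (revp j.-2 lo).[z^-1].
Proof.
move=> z0; rewrite horner_revp//; last by rewrite (leq_trans slo)//; case: (j) j2 => [|[]].
have -> : lo = P * f - 'X^(2 * j - 2) * hi by rewrite gap addrK.
rewrite hornerD hornerN !hornerM hornerXn mulrBr !mulrA; congr (_ - _ * _).
have -> : (2 * j - 2 = j.-2 + j)%N by case: (j) j2 => [|[|k]] // _; lia.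
by rewrite exprD mulrA mulVf ?mul1r// expf_neq0.
Qed.

Lemma transition_col2 (x : C2) (a b : C) :
  transition p x *m col2 a b = col2 (x.1 ^+ j * a + pfun p x * b) (x.1 ^- j * b).
Proof.
apply/colP => i; rewrite !mxE big_ord_recl big_ord1 !mxE /=.
by case: i => [[|[|//]] ilt] /=; rewrite ?mul0r ?add0r.
Qed.

Lemma revf (z : C) : z != 0 -> z^-1 * (revp j.-1 f).[z^-1] = z ^- j * f.[z].
Proof.
move=> z0; rewrite horner_revp ?prednK//; try by case: (j) j2.
by rewrite mulrA -invfM -exprS prednK//; case: (j) j2.
Qed.

Lemma ext1_section W : sections F W ext1.
Proof.
split.
- apply: holo_col2; last exact: holo_horner1.
  by apply: holoN; apply: holoM; [exact: holo2|exact: holo_horner1].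
- apply: holo_col2; last by apply: holoM; [exact: holo1|exact: holo_horner1].
  by apply: holoM; [apply: holoM; [exact: holo1|exact: holo2]|exact: holo_horner1].
- move=> [z u] z0 _; have {}z0 : z != 0 := z0; rewrite transition_col2 /= pfunE// revf//.
  by congr col2; rewrite mulKf// -gap_eval//; ring.
Qed.

Lemma ext2_section W : sections F W ext2.
Proof.
split.
- apply: holo_col2; last by apply: holoM; [exact: holo1|exact: holo_horner1].
  by apply: holoN; apply: holoM; [apply: holoM; [exact: holo1|exact: holo2]|exact: holo_horner1].
- apply: holo_col2; last exact: holo_horner1.
  by apply: holoM; [exact: holo2|exact: holo_horner1].
- move=> [z u] z0 _; have {}z0 : z != 0 := z0; rewrite transition_col2 /= pfunE//; congr col2.
    by rewrite -gap_eval//; ring.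
  by rewrite mulrCA -revf// mulrA mulfV// mul1r.
Qed.

End Elements.

Let UVx : set C2 := [set x | x.1 != 0].

Lemma open_neq0 : open UVx.
Proof.
rewrite openE => x x1; apply/nbhs_nrm2; exists (nrm x.1); first by rewrite nrm_gt0.
by move=> y xy _; apply/eqP => y1; move: xy; rewrite y1 subr0 ltxx.
Qed.

(** Over [x.1 != 0] the point (y.2 / y.1, y.1) of U is the preimage of [y] under tau, so reading the
    lower entry there is linear over functions of the base. It is the entry in which [f] appears. *)
Definition detect : ambient (dual F) :=
  fun W s y => s.1 (y.2 / y.1, y.1) 1 0.

Lemma detect_section W : W `<=` UVx -> sections (dual F) W detect.
Proof.
move=> WU W' oW' sW; have tauK y : W' y -> tauU (y.2 / y.1, y.1) = y.
  by move=> Wy; rewrite /tauU /= divfK -?surjective_pairing//; exact: WU (sW _ Wy).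
split.
- move=> s [ds _ _] y Wy.
  apply: (@differentiable_comp _ _ _ _ (fun y : C2 => (y.2 / y.1, y.1)) (fun x => s.1 x 1 0)).
    apply: differentiable_pair; last exact: differentiable_c1.
    apply: differentiable2M; first exact: differentiable_c2.
    by apply: differentiable2V; [exact: differentiable_c1|exact: WU (sW _ Wy)].
  by apply: ds; rewrite /preimage /= tauK.
- by move=> s _ [z1 _] y Wy; rewrite /detect z1 ?tauK// mxE.
- move=> a s t _ _ _ y Wy; rewrite /detect.
  rewrite -[(scal F a s + t).1 _]/(a (tauU _) *: s.1 _ + t.1 _) tauK//.
  by rewrite !mxE.
- by [].
Qed.

(** Pairing with [detect] turns membership in the direct image near the origin into sum c_i f_i(z) =
    u s(z, u) with [s] holomorphic, and u tends to 0. *)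
Lemma bidual_independent n (f lo hi : 'I_n -> {poly C}) (c : 'I_n -> C) :
  global_zero (bidual_quotient F)
    (\sum_i c i *: (fun=> bidual_div (ext1 (f i) (lo i) (hi i)) (ext2 (f i) (lo i) (hi i)))) ->
  \sum_i c i *: f i = 0.
Proof.
move=> /(_ (0, 0))[W [oW W0 [s Fs]]] zs; apply: poly_eq0 => z _.
pose W' := W `&` UVx.
have oW' : open W' by apply: openI => //; exact: open_neq0.
have dd : sections (dual F) W' detect by apply: detect_section => x [].
have E x : W' x -> \sum_i c i * ((f i).[x.2 / x.1] / x.1) = s.1 (x.2 / x.1, x.1) 1 0.
  move=> [Wx x1]; have := zs W' detect oW' (@subIsetl _ _ _) dd x (conj Wx x1).
  move=> /eqP; rewrite -[X in X == 0]/(_ W' detect x - s.1 (x.2 / x.1, x.1) 1 0).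
  rewrite subr_eq0 => /eqP <-; rewrite !fct_sumE.
  by apply: eq_bigr => i _; rewrite -[RHS]/(c i * _) /bidual_div /div_coord x1 /detect mxE.
(* Here z is fixed and [x.1] plays the part of u; the second coordinate is a dummy that makes
   [holo_eq_dense] applicable. *)
pose W0' : set C2 := (fun x : C2 => tauU (z, x.1)) @^-1` W.
have dt (x : C2) : differentiable (fun x : C2 => tauU (z, x.1)) x.
  apply: differentiable_pair; first exact: differentiable_c1.
  by apply: differentiable2Z; exact: differentiable_c1.
have oW0' : open W0'.
  by apply: open_comp => // x _; apply: differentiable_continuous; exact: dt.
have hs : holo W0' (fun x => s.1 (z, x.1) 1 0).
  move=> x Wx.
  apply: (@differentiable_comp _ _ _ _ (fun x : C2 => (z, x.1)) (fun x => s.1 x 1 0)).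
    by apply: differentiable_pair; [exact: differentiable_cst|exact: differentiable_c1].
  by case: Fs => ds _ _; apply: ds.
have := holo_eq_dense oW0' (@holo_cst R W0' (\sum_i c i *: f i).[z])
  (holoM (@holo1 R W0') hs).
move=> /(_ _ (0, 0)) /= -> //; first by rewrite mul0r.
  move=> x Wx x1; have := E (x.1, z * x.1) (conj Wx x1).
  rewrite /= mulfK// => <-; rewrite horner_sum mulr_sumr; apply: eq_bigr => i _.
  by rewrite hornerZ mulrCA; congr (_ * _); rewrite mulrC divfK.
by rewrite /W0' /preimage /tauU /= mulr0.
Qed.

(** The first direct image takes at least j - 1 of the charge, so [w <= 1]; the kernel of the
    Toeplitz matrix embeds in the bidual quotient, so its dimension is at most 1. *)
Lemma charge_rank : Defs.charge p j -> \rank toeplitz = j.-1.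
Proof.
move=> [w [h [hw /(first_direct_image_dim j2) hh jwh]]].
have rk := rank_leq_col toeplitz.
pose K := row_base (kermx toeplitz).
have K0 i : row i K *m toeplitz = 0.
  apply/eqP; rewrite -sub_kermx; apply: submx_trans (row_sub _ _) _.
  by rewrite eq_row_base.
pose f i := rVpoly (row i K).
pose lo i := take_poly j.-1 (P * f i); pose hi i := drop_poly (2 * j - 2) (P * f i).
have sf i : (size (f i) <= j)%N by exact: size_poly.
have slo i : (size (lo i) <= j.-1)%N by exact: size_take_poly.
have gap i : P * f i = lo i + 'X^(2 * j - 2) * hi i by exact: kernel_gap.
have dimw : (\rank (kermx toeplitz) <= w)%N.
  apply: (@quotient_dim_ge R _ _ _ w _ (fun i _ =>
    bidual_div (ext1 (f i) (lo i) (hi i)) (ext2 (f i) (lo i) (hi i))) hw).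
  - exact: (global_zero0 (@bq_zeros0 _ _ p)).
  - exact: (global_zeroD (@bq_zerosD _ _ p) (@bq_zerosS _ _ p)).
  - exact: (global_zeroZ (@bq_zerosZ _ _ p)).
  - move=> i; apply: (constant_global_section (@bq_zeros0 _ _ p)).
    apply: bidual_div_section; [exact: ext1_section|exact: ext2_section|exact: ext12].
  move=> c /bidual_independent cf i.
  have : (\row_i c i) *m K = 0.
    apply: (can_inj rVpolyK); rewrite linear0 -cf mulmx_sum_row linear_sum /=.
    by apply: eq_bigr => k _; rewrite linearZ mxE.
  rewrite -[RHS](mul0mx _ K) => /(row_free_inj (row_base_free _)) /rowP /(_ i).
  by rewrite !mxE.
move: dimw; rewrite mxrank_ker; lia.
Qed.

End ChargeRank.

(** * The Poisson structure along the zero section *)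

Section PoissonConstant.
Variable R : realType.
Local Notation C := (Cplx R).
Local Notation C2 := (C * C)%type.

(* sU(z, 0) = - z sV(1/z, 0) has a limit at infinity because sV(0, 0) = 0. *)
Lemma minimally_degenerate_const (sU sV : C2 -> C) : minimally_degenerate sU sV ->
  exists2 s0 : C, s0 != 0 & forall z, sU (z, 0) = s0.
Proof.
move=> [[dU dV gl] fib nell].
pose f z := sU (z, 0); pose g z := sV (z, 0).
have df z : differentiable f z by apply: differentiable_slice1; exact: dU.
have dg z : differentiable g z by apply: differentiable_slice1; exact: dV.
have [l Hl] := differentiable_linear_approx (dg 0).
have g0 : g 0 = 0 by exact: fib.
(* Since sV(0, 0) = 0, this quotient tends to minus the derivative [l] of sV(., 0) at 0. *)
pose G xi := if xi == 0 then - l else - (g xi / xi).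
have cG : {for 0, continuous G}.
  apply: (proj2 (cvg_nrm (nbhs_filter (0 : C)) _ _)) => e e0; apply/nbhs_nrm.
  have e2 : 0 < e / 2 by rewrite divr_gt0.
  have [dl dl0 H] := Hl _ e2; exists dl => // y; rewrite sub0r nrmN => ydl.
  rewrite /G eqxx; case: eqP => [_|/eqP y0]; first by rewrite subrr nrm0.
  have := H y; rewrite !subr0 g0 subr0 => /(_ ydl).
  have -> : - l - - (g y / y) = (g y - l * y) / y by field.
  rewrite nrmM nrmV => h; have ny : 0 < nrm y by rewrite nrm_gt0.
  apply: (@le_lt_trans _ _ (e / 2)); first by rewrite ler_pdivrMr.
  by rewrite ltr_pdivrMr// ltr_pMr// ltr1n.
have fG z : z != 0 -> f z = G z^-1.
  move=> z0; rewrite /G invr_eq0 (negbTE z0) invrK /g.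
  have := gl (z, 0) z0; rewrite /Defs.glue /= mulr0 => ->.
  by rewrite mulNr mulNr opprK mulrAC mulVf// mul1r.
have fE := entire_glue df cG fG.
exists (G 0) => [|z]; last exact: fE.
apply/eqP => G0; apply: nell; split=> [z|xi].
  by rewrite -[LHS]/(f z) fE.
have [->|xi0] := eqVneq xi 0; first exact: fib.
have xiV : xi^-1 != 0 by rewrite invr_eq0.
have := gl (xi^-1, 0) xiV; rewrite /Defs.glue /= mulr0 invrK => ->.
by rewrite -[sU _]/(f _) fE G0 mulr0.
Qed.

End PoissonConstant.

(** * Star products of matrices *)

Section MatrixCalculus.
Variable R : realType.
Local Notation C := (Cplx R).
Local Notation C2 := (C * C)%type.
Local Notation qfun := ((C2 -> C) * (C2 -> C))%type.
Local Notation dz := ((1, 0) : C2).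
Local Notation du := ((0, 1) : C2).
Implicit Types (f g : C2 -> C) (x v : C2) (X Y : C2 -> 'M[C]_2) (A B : 'M[qfun]_2).

(* [is_derive] is a class, whose instances would be inferred too eagerly. *)
Definition der x v f (a : C) : Prop := is_derive x v f a.

Lemma der_eq x v f a b : der x v f a -> a = b -> der x v f b.
Proof. by move=> + <-. Qed.

Lemma derD f g x v a b : der x v f a -> der x v g b ->
  der x v (fun x => f x + g x) (a + b).
Proof. by rewrite /der => df dg; exact: is_deriveD. Qed.

Lemma derN f x v a : der x v f a -> der x v (fun x => - f x) (- a).
Proof. by rewrite /der => df; exact: is_deriveN. Qed.

Lemma derM f g x v a b : der x v f a -> der x v g b ->
  der x v (fun x => f x * g x) (a * g x + f x * b).
Proof.
rewrite /der => df dg; apply: is_derive_eq; rewrite /GRing.scale /=.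
by rewrite addrC [g x * a]mulrC.
Qed.

Lemma der_const (k : C) x v : der x v (fun=> k) 0.
Proof. exact: is_derive_cst. Qed.

Lemma der_coord1 x v : der x v (fun x : C2 => x.1) v.1.
Proof.
apply: DeriveDef; first by apply: diff_derivable; exact: differentiable_c1.
rewrite deriveE; last exact: differentiable_c1.
rewrite (@diff_lin _ _ _ fst)//; move=> y; exact: cvg_fst.
Qed.

Lemma der_coord2 x v : der x v (fun x : C2 => x.2) v.2.
Proof.
apply: DeriveDef; first by apply: diff_derivable; exact: differentiable_c2.
rewrite deriveE; last exact: differentiable_c2.
rewrite (@diff_lin _ _ _ snd)//; move=> y; exact: cvg_snd.
Qed.

Lemma der_horner (q : {poly C}) x v :
  der x v (fun x : C2 => q.[x.1]) (v.1 * q^`().[x.1]).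
Proof.
elim/poly_ind: q => [|q c IH].
  rewrite deriv0 horner0 mulr0; have -> : (fun x : C2 => (0 : {poly C}).[x.1]) = fun=> 0.
    by apply/funext => y; rewrite horner0.
  exact: der_const.
have -> : (fun x : C2 => (q * 'X + c%:P).[x.1]) = (fun x : C2 => q.[x.1] * x.1 + c).
  by apply/funext => y; rewrite hornerMXaddC.
apply: der_eq.
  apply: derD; last exact: der_const.
  by apply: derM; [exact: IH|exact: der_coord1].
rewrite derivD derivC addr0 derivM derivX !hornerE; ring.
Qed.

Lemma der_inv1 x v : x.1 != 0 ->
  der x v (fun x : C2 => x.1^-1) (- v.1 * (x.1^-1) ^+ 2).
Proof.
move=> x1; have d1 := der_coord1 x v.
apply: DeriveDef; first by apply: diff_derivable; apply: differentiable2V => //; exact: differentiable_c1.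
have := @deriveV _ _ (fun x : C2 => x.1) x v x1 (@ex_derive _ _ _ _ _ _ _ d1).
rewrite (@derive_val _ _ _ _ _ _ _ d1).
move=> E; apply: etrans; first exact: E.
rewrite /GRing.scale /= exprVn; ring.
Qed.

Lemma der_exp1 n x v : x.1 != 0 ->
  der x v (fun x : C2 => x.1 ^+ n) (n%:R * v.1 * x.1 ^+ n * x.1^-1).
Proof.
move=> x1; elim: n => [|n IH].
  rewrite !mul0r; have -> : (fun x : C2 => x.1 ^+ 0) = fun=> 1 by apply/funext => y; rewrite expr0.
  exact: der_const.
have -> : (fun x : C2 => x.1 ^+ n.+1) = (fun x : C2 => x.1 * x.1 ^+ n) by apply/funext => y; rewrite exprS.
apply: der_eq; first by apply: derM IH; exact: der_coord1.
by rewrite [x.1 ^+ n.+1]exprS -natr1; field.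
Qed.

Lemma der_expV1 n x v : x.1 != 0 ->
  der x v (fun x : C2 => x.1 ^- n) (- n%:R * v.1 * x.1 ^- n * x.1^-1).
Proof.
move=> x1; elim: n => [|n IH].
  rewrite oppr0 !mul0r; have -> : (fun x : C2 => x.1 ^- 0) = fun=> 1.
    by apply/funext => y; rewrite expr0 invr1.
  exact: der_const.
have -> : (fun x : C2 => x.1 ^- n.+1) = (fun x : C2 => x.1^-1 * x.1 ^- n).
  by apply/funext => y /=; rewrite exprS invfM.
apply: der_eq; first by apply: derM IH; exact: der_inv1.
by rewrite [x.1 ^+ n.+1]exprS invfM -natr1; ring.
Qed.

Lemma der_unique x v f a b : der x v f a -> der x v f b -> a = b.
Proof. by move=> [_ <-] [_ <-]. Qed.

Definition derm x v X (Y : 'M[C]_2) : Prop :=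
  forall i k, der x v (fun y => X y i k) (Y i k).

Lemma mulmx2E (X Y : 'M[C]_2) i k : (X *m Y) i k = X i 0 * Y 0 k + X i 1 * Y 1 k.
Proof.
rewrite mxE big_ord_recl big_ord1; congr (_ + X i _ * Y _ k); exact/val_inj.
Qed.

Lemma derm_unique x v X (Y Y' : 'M[C]_2) : derm x v X Y -> derm x v X Y' -> Y = Y'.
Proof. by move=> d d'; apply/matrixP => i k; exact: der_unique (d i k) (d' i k). Qed.

Lemma derm_const (K : 'M[C]_2) x v : derm x v (fun=> K) 0.
Proof. by move=> i k; rewrite mxE; exact: der_const. Qed.

Lemma derm_add x v X Y (X' Y' : 'M[C]_2) : derm x v X X' -> derm x v Y Y' ->
  derm x v (fun y => X y + Y y) (X' + Y').
Proof.
move=> dX dY i k; rewrite [_ i k]mxE.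
have -> : (fun y => (X y + Y y) i k) = (fun y => X y i k + Y y i k).
  by apply/funext => y; rewrite [LHS]mxE.
exact: derD.
Qed.

Lemma derm_opp x v X (X' : 'M[C]_2) : derm x v X X' -> derm x v (fun y => - X y) (- X').
Proof.
move=> dX i k; rewrite [_ i k]mxE.
have -> : (fun y => (- X y) i k) = (fun y => - X y i k).
  by apply/funext => y; rewrite [LHS]mxE.
exact: derN.
Qed.

Lemma derm_scale x v f a X (X' : 'M[C]_2) : der x v f a -> derm x v X X' ->
  derm x v (fun y => f y *: X y) (a *: X x + f x *: X').
Proof.
move=> df dX i k.
have -> : (a *: X x + f x *: X') i k = a * X x i k + f x * X' i k by rewrite !mxE.
have -> : (fun y => (f y *: X y) i k) = (fun y => f y * X y i k).
  by apply/funext => y; rewrite [LHS]mxE.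
exact: derM.
Qed.

Lemma derm_mul x v X Y (X' Y' : 'M[C]_2) : derm x v X X' -> derm x v Y Y' ->
  derm x v (fun y => X y *m Y y) (X' *m Y x + X x *m Y').
Proof.
move=> dX dY i k.
have -> : (X' *m Y x + X x *m Y') i k = (X' *m Y x) i k + (X x *m Y') i k by rewrite mxE.
rewrite !mulmx2E.
have -> : (fun y => (X y *m Y y) i k) = (fun y => X y i 0 * Y y 0 k + X y i 1 * Y y 1 k).
  by apply/funext => y; rewrite mulmx2E.
apply: der_eq; first by apply: derD; apply: derM; [exact: dX|exact: dY|exact: dX|exact: dY].
by rewrite /=; ring.
Qed.

Lemma derm_near x v X Y (X' : 'M[C]_2) W : open W -> W x -> (forall y, W y -> X y = Y y) ->
  derm x v X X' -> derm x v Y X'.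
Proof.
move=> oW Wx XY dX i k; have := dX i k; rewrite /der.
apply: near_eq_is_derive.
by apply: filterS (open_nbhs_nbhs (conj oW Wx)) => y /XY ->.
Qed.

Definition m1 A x : 'M[C]_2 := \matrix_(i, k) (A i k).1 x.
Definition m2 A x : 'M[C]_2 := \matrix_(i, k) (A i k).2 x.

Lemma m1_starmx s A B x : m1 (starmx s A B) x = m1 A x *m m1 B x.
Proof.
apply/matrixP => i k; rewrite mulmx2E ![m1 _ _ _ _]mxE [starmx _ _ _ _ _]mxE.
rewrite big_ord_recl big_ord1 /=.
by congr (_ + (A i _).1 x * (B _ k).1 x); exact/val_inj.
Qed.

Lemma m2_starmx s A B x Az Au Bz Bu :
  derm x dz (m1 A) Az -> derm x du (m1 A) Au ->
  derm x dz (m1 B) Bz -> derm x du (m1 B) Bu ->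
  m2 (starmx s A B) x =
  m1 A x *m m2 B x + m2 A x *m m1 B x + s x *: (Az *m Bu - Au *m Bz).
Proof.
move=> dAz dAu dBz dBu.
have e1 A' v (A'' : 'M[C]_2) : derm x v (m1 A') A'' -> forall i k, 'D_v (A' i k).1 x = A'' i k.
  move=> d i k; have := d i k; have -> : (fun y => m1 A' y i k) = (A' i k).1.
    by apply/funext => y; rewrite mxE.
  by case.
apply/matrixP => i k.
have DE (X Y : 'M[C]_2) : (X + Y) i k = X i k + Y i k by rewrite mxE.
have BE (X Y : 'M[C]_2) : (X - Y) i k = X i k - Y i k by rewrite !mxE.
have ZE a (X : 'M[C]_2) : (a *: X) i k = a * X i k by rewrite mxE.
rewrite !DE ZE BE !mulmx2E [m2 _ _ _ _]mxE [starmx _ _ _ _ _]mxE.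
rewrite big_ord_recl big_ord1 /= ![m1 _ _ _ _]mxE ![m2 _ _ _ _]mxE.
have -> : lift ord0 ord0 = 1 :> 'I_2 by exact/val_inj.
rewrite -[LHS]/((star s (A i 0) (B 0 k)).2 x + (star s (A i 1) (B 1 k)).2 x) /star /bracket /=.
by rewrite !(e1 _ _ _ dAz, e1 _ _ _ dAu, e1 _ _ _ dBz, e1 _ _ _ dBu); ring.
Qed.

Lemma eq_onP W A B : eq_on W A B <->
  forall x, W x -> m1 A x = m1 B x /\ m2 A x = m2 B x.
Proof.
split=> [h x Wx|h i k x /h[/matrixP/(_ i k) + /matrixP/(_ i k)]].
  by split; apply/matrixP => i k; rewrite !mxE; case: (h i k x Wx).
by rewrite !mxE.
Qed.

Lemma m1_one x : m1 (onemx R) x = 1%:M.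
Proof. by apply/matrixP => -[[|[|//]] ?] [[|[|//]] ?]; rewrite !mxE. Qed.
Lemma m2_one x : m2 (onemx R) x = 0.
Proof. by apply/matrixP => -[[|[|//]] ?] [[|[|//]] ?]; rewrite !mxE. Qed.

Definition hmx W X : Prop := forall i k, holo W (fun x => X x i k).

Definition qmx X Y : 'M[qfun]_2 := \matrix_(i, k) (fun x => X x i k, fun x => Y x i k).

Lemma m1_qmx X Y : m1 (qmx X Y) = X.
Proof. by apply/funext => x; apply/matrixP => i k; rewrite !mxE. Qed.
Lemma m2_qmx X Y : m2 (qmx X Y) = Y.
Proof. by apply/funext => x; apply/matrixP => i k; rewrite !mxE. Qed.

Lemma qholo_qmx W X Y : hmx W X -> hmx W Y -> qholo W (qmx X Y).
Proof. by move=> hX hY i k; rewrite mxE; split; [exact: hX|exact: hY]. Qed.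

Lemma hmx_const W (K : 'M[C]_2) : hmx W (fun=> K).
Proof. by move=> i k; exact: holo_cst. Qed.

Lemma hmx_mul W X Y : hmx W X -> hmx W Y -> hmx W (fun x => X x *m Y x).
Proof.
move=> hX hY i k.
have -> : (fun y => (X y *m Y y) i k) = (fun y => X y i 0 * Y y 0 k + X y i 1 * Y y 1 k).
  by apply/funext => y; rewrite mulmx2E.
by apply: holoD; apply: holoM; [exact: hX|exact: hY|exact: hX|exact: hY].
Qed.

Lemma hmx_add W X Y : hmx W X -> hmx W Y -> hmx W (fun x => X x + Y x).
Proof.
move=> hX hY i k; have -> : (fun y => (X y + Y y) i k) = (fun y => X y i k + Y y i k).
  by apply/funext => y; rewrite [LHS]mxE.
by apply: holoD; [exact: hX|exact: hY].
Qed.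

Lemma hmx_opp W X : hmx W X -> hmx W (fun x => - X x).
Proof.
move=> hX i k; have -> : (fun y => (- X y) i k) = (fun y => - X y i k).
  by apply/funext => y; rewrite [LHS]mxE.
by apply: holoN; exact: hX.
Qed.

Lemma hmx_scale W f X : holo W f -> hmx W X -> hmx W (fun x => f x *: X x).
Proof.
move=> hf hX i k; have -> : (fun y => (f y *: X y) i k) = (fun y => f y * X y i k).
  by apply/funext => y; rewrite [LHS]mxE.
by apply: holoM; [exact: hf|exact: hX].
Qed.

Section StarInverse.
Variables (s : C2 -> C) (W : set C2) (A : 'M[qfun]_2) (Az Au B Bz Bu : C2 -> 'M[C]_2).
Hypotheses (oW : open W) (hs : holo W s) (hA : qholo W A).
Hypotheses (dAz : forall x, W x -> derm x dz (m1 A) (Az x)).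
Hypotheses (dAu : forall x, W x -> derm x du (m1 A) (Au x)).
Hypotheses (dBz : forall x, W x -> derm x dz B (Bz x)).
Hypotheses (dBu : forall x, W x -> derm x du B (Bu x)).
Hypotheses (hAz : hmx W Az) (hAu : hmx W Au) (hB : hmx W B) (hBz : hmx W Bz) (hBu : hmx W Bu).
Hypothesis AB : forall x, W x -> m1 A x *m B x = 1%:M.

(** The hbar part solves A * (B + B' hbar) = 1, where [s x *: (Az x *m Bu x - Au x *m Bz x)] is the
    bracket of the classical parts. *)
Definition star_inv : 'M[qfun]_2 :=
  qmx B (fun x => - (B x *m (m2 A x *m B x + s x *: (Az x *m Bu x - Au x *m Bz x)))).

Let BA x : W x -> B x *m m1 A x = 1%:M.
Proof. by move=> Wx; apply: mulmx1C; exact: AB. Qed.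

Let dinv x v (A' B' : 'M[C]_2) : W x -> derm x v (m1 A) A' -> derm x v B B' -> B' = - (B x *m A' *m B x).
Proof.
move=> Wx dA dB; have := derm_unique (derm_mul dA dB).
move=> /(_ 0) E; have {}E : A' *m B x + m1 A x *m B' = 0.
  apply: E; apply: (@derm_near x v (fun=> 1%:M) _ _ W oW Wx); last exact: derm_const.
  by move=> y Wy; rewrite AB.
have := congr1 (mulmx (B x)) E; rewrite mulmxDr mulmx0 !mulmxA BA// mul1mx.
by move/eqP; rewrite addrC addr_eq0 => /eqP.
Qed.

Lemma hmx_m2 : hmx W (m2 A).
Proof.
move=> i k; have -> : (fun x => m2 A x i k) = (A i k).2 by apply/funext => x; rewrite mxE.
by case: (hA i k).
Qed.

(** A right inverse by construction. On the left, the derivatives of [B] are replaced by - B A' B,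
    after which the bracket terms cancel. *)
Lemma star_invP : star_inverse s W A star_inv.
Proof.
split.
- apply: qholo_qmx => //; apply: hmx_opp; apply: hmx_mul => //; apply: hmx_add.
    by apply: hmx_mul => //; exact: hmx_m2.
  apply: hmx_scale => //; apply: hmx_add; first exact: hmx_mul.
  by apply: hmx_opp; exact: hmx_mul.
- apply/eq_onP => x Wx; rewrite m1_starmx m1_one m2_one m1_qmx AB//; split=> //.
  have dz' : derm x dz (m1 star_inv) (Bz x) by rewrite m1_qmx; exact: dBz.
  have du' : derm x du (m1 star_inv) (Bu x) by rewrite m1_qmx; exact: dBu.
  rewrite (m2_starmx s (dAz Wx) (dAu Wx) dz' du') m1_qmx m2_qmx.
  by rewrite mulmxN mulmxA AB// mul1mx -addrA addNr.
- apply/eq_onP => x Wx; rewrite m1_starmx m1_one m2_one m1_qmx BA//; split=> //.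
  have dz' : derm x dz (m1 star_inv) (Bz x) by rewrite m1_qmx; exact: dBz.
  have du' : derm x du (m1 star_inv) (Bu x) by rewrite m1_qmx; exact: dBu.
  rewrite (m2_starmx s dz' du' (dAz Wx) (dAu Wx)) m1_qmx m2_qmx.
  rewrite (dinv Wx (dAz Wx) (dBz Wx)) (dinv Wx (dAu Wx) (dBu Wx)).
  set a := m1 A x; set b := B x; set c := Az x; set d := Au x; set e := m2 A x.
  have BAr (X : 'M[C]_2) : X *m b *m a = X by rewrite -mulmxA BA// mulmx1.
  have -> : c *m - (b *m d *m b) - d *m - (b *m c *m b) =
      (d *m b *m c - c *m b *m d) *m b.
    by rewrite mulmxBl !mulmxN opprK addrC !mulmxA.
  have -> : - (b *m c *m b) *m d - - (b *m d *m b) *m c = b *m (d *m b *m c - c *m b *m d).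
    by rewrite mulmxBr !mulNmx opprK addrC !mulmxA.
  rewrite mulNmx -[_ *m a]mulmxA scalemxAl -mulmxDl BAr mulmxDr opprD addNKr.
  by rewrite -scalemxAr addNr.
Qed.

End StarInverse.

End MatrixCalculus.

(** * Laurent polynomials and explicit 2 x 2 matrices *)

Section Laurent.
Variable R : realType.
Local Notation K := (Cplx R).
Implicit Types (h : K -> K) (q : {poly K}) (X Y : K -> 'M[K]_2).

Definition laurent h : Prop :=
  exists n q, forall z, z != 0 -> h z = z ^- n * q.[z].

Lemma laurentD h1 h2 : laurent h1 -> laurent h2 -> laurent (fun z => h1 z + h2 z).
Proof.
move=> [n1 [q1 E1]] [n2 [q2 E2]]; exists (n1 + n2)%N, ('X^n2 * q1 + 'X^n1 * q2) => z z0.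
by rewrite E1// E2// !hornerE exprD; field; rewrite !expf_neq0.
Qed.

Lemma laurentM h1 h2 : laurent h1 -> laurent h2 -> laurent (fun z => h1 z * h2 z).
Proof.
move=> [n1 [q1 E1]] [n2 [q2 E2]]; exists (n1 + n2)%N, (q1 * q2) => z z0.
by rewrite E1// E2// hornerM exprD invfM; ring.
Qed.

Lemma laurent_horner q : laurent (fun z => q.[z]).
Proof. by exists 0%N, q => z _; rewrite expr0 invr1 mul1r. Qed.

Lemma laurent_const c : laurent (fun=> c).
Proof. by exists 0%N, c%:P => z _; rewrite expr0 invr1 mul1r hornerC. Qed.

Lemma laurentN h : laurent h -> laurent (fun z => - h z).
Proof. by move=> [n [q E]]; exists n, (- q) => z z0; rewrite E// hornerN mulrN. Qed.

Lemma laurent_expV n : laurent (fun z => z ^- n).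
Proof. by exists n, 1 => z _; rewrite hornerE mulr1. Qed.

Lemma laurent_inv : laurent (fun z => z^-1).
Proof. by exists 1%N, 1 => z _; rewrite hornerE mulr1 expr1. Qed.

(** The Cech splitting on ell: [a] is regular on U, and the strictly negative exponents are regular
    on V. *)
Lemma laurent_split h : laurent h ->
  exists a l : {poly K}, forall z, z != 0 -> h z = a.[z] + z^-1 * l.[z^-1].
Proof.
move=> [n [q E]]; exists (drop_poly n q), (revp n.-1 (take_poly n q)) => z z0.
rewrite E// -[in LHS](poly_take_drop n q) hornerD hornerM hornerXn mulrDr.
rewrite mulrCA mulVf ?expf_neq0// mulr1 addrC; congr (_ + _).
case: n {E} => [|n].
  by rewrite take_poly0l /revp expr0 invr1 mul1r horner0 poly_def big_ord1 coef0 scale0r horner0 mulr0.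
by rewrite horner_revp ?size_take_poly// exprS invfM mulrA.
Qed.

Lemma mul_mx2 (a b c d a' b' c' d' : K) : mx2 a b c d *m mx2 a' b' c' d' =
  mx2 (a * a' + b * c') (a * b' + b * d') (c * a' + d * c') (c * b' + d * d').
Proof.
apply/matrixP => i k; rewrite !mxE big_ord_recl big_ord1 !mxE /=.
by case: (i == 0); case: (k == 0).
Qed.

Lemma add_mx2 (a b c d a' b' c' d' : K) : mx2 a b c d + mx2 a' b' c' d' =
  mx2 (a + a') (b + b') (c + c') (d + d').
Proof. by apply/matrixP => i k; rewrite !mxE; case: (i == 0); case: (k == 0). Qed.

Lemma opp_mx2 (a b c d : K) : - mx2 a b c d = mx2 (- a) (- b) (- c) (- d).
Proof. by apply/matrixP => i k; rewrite !mxE; case: (i == 0); case: (k == 0). Qed.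

Lemma scale_mx2 (s a b c d : K) : s *: mx2 a b c d = mx2 (s * a) (s * b) (s * c) (s * d).
Proof. by apply/matrixP => i k; rewrite !mxE; case: (i == 0); case: (k == 0). Qed.

Lemma mx2_1 : 1%:M = mx2 1 0 0 1 :> 'M[K]_2.
Proof. by apply/matrixP => -[[|[|//]] ?] [[|[|//]] ?]; rewrite !mxE. Qed.

End Laurent.

(** * First-order expansions along the zero section *)

Section Jets.
Variable R : realType.
Local Notation C := (Cplx R).
Local Notation C2 := (C * C)%type.
Local Notation dz := ((1, 0) : C2).
Local Notation du := ((0, 1) : C2).
Implicit Types (h : C -> C) (X Y : C2 -> 'M[C]_2).

(** The difference quotient in the direction u is identically 0, for any [h], including negative
    powers of z at every point. *)
Lemma der_fst h x : der x du (fun x => h x.1) 0.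
Proof.
have E : (fun t : C => t^-1 *: (((fun x : C2 => h x.1) \o shift x) (t *: du) - h x.1)) = fun=> 0.
  by apply/funext => t /=; rewrite /shift /= scaler0 add0r subrr scaler0.
by apply: DeriveDef; rewrite /derivable /derive E; [exact: is_cvg_cst|exact: lim_cst].
Qed.

Lemma derm_mx2 x v (a b c d : C2 -> C) (a' b' c' d' : C) :
  der x v a a' -> der x v b b' -> der x v c c' -> der x v d d' ->
  derm x v (fun x => mx2 (a x) (b x) (c x) (d x)) (mx2 a' b' c' d').
Proof.
move=> ha hb hc hd i k; rewrite mxE.
have -> : (fun y => mx2 (a y) (b y) (c y) (d y) i k) =
  if i == 0 then if k == 0 then a else b else if k == 0 then c else d.
  by apply/funext => y; rewrite mxE; case: ifP; case: ifP.
by case: ifP; case: ifP.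
Qed.

Lemma hmx_mx2 W (a b c d : C2 -> C) : holo W a -> holo W b -> holo W c -> holo W d ->
  hmx W (fun x => mx2 (a x) (b x) (c x) (d x)).
Proof.
move=> ha hb hc hd i k.
have -> : (fun y => mx2 (a y) (b y) (c y) (d y) i k) =
  if i == 0 then if k == 0 then a else b else if k == 0 then c else d.
  by apply/funext => y; rewrite mxE; case: ifP; case: ifP.
by case: ifP => _; case: ifP => _; [exact: ha|exact: hb|exact: hc|exact: hd].
Qed.

(* The coefficients of u^0 and u^1 at (z, 0). *)
Definition jet (z : C) X (X0 X1 : 'M[C]_2) : Prop := X (z, 0) = X0 /\ derm (z, 0) du X X1.

Lemma jetM z X Y (X0 X1 Y0 Y1 : 'M[C]_2) : jet z X X0 X1 -> jet z Y Y0 Y1 ->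
  jet z (fun x => X x *m Y x) (X0 *m Y0) (X1 *m Y0 + X0 *m Y1).
Proof. by move=> [<- dX] [<- dY]; split=> //; exact: derm_mul. Qed.

Lemma jetD z X Y (X0 X1 Y0 Y1 : 'M[C]_2) : jet z X X0 X1 -> jet z Y Y0 Y1 ->
  jet z (fun x => X x + Y x) (X0 + Y0) (X1 + Y1).
Proof. by move=> [<- dX] [<- dY]; split=> //; exact: derm_add. Qed.

Lemma jetN z X (X0 X1 : 'M[C]_2) : jet z X X0 X1 -> jet z (fun x => - X x) (- X0) (- X1).
Proof. by move=> [<- dX]; split=> //; exact: derm_opp. Qed.

Lemma jetZ z X (s : C2 -> C) s0 s1 (X0 X1 : 'M[C]_2) : s (z, 0) = s0 -> der (z, 0) du s s1 ->
  jet z X X0 X1 -> jet z (fun x => s x *: X x) (s0 *: X0) (s1 *: X0 + s0 *: X1).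
Proof. by move=> <- ds [<- dX]; split=> //; exact: derm_scale. Qed.

Lemma jet_UV z X Y (X0 X1 : 'M[C]_2) : z != 0 -> (forall x, x.1 != 0 -> X x = Y x) ->
  jet z X X0 X1 -> jet z Y X0 X1.
Proof.
move=> z0 XY [<- dX]; split; first by rewrite XY.
by apply: (derm_near (open_neq0 (R := R)) _ _ dX).
Qed.

Lemma eq_mod_u2_jet X Y :
  (forall z, z != 0 -> exists X0 X1 : 'M[C]_2, jet z X X0 X1 /\ jet z Y X0 X1) ->
  forall i k, eq_mod_u2 (fun x => X x i k) (fun x => Y x i k).
Proof.
move=> h i k; rewrite /eq_mod_u2 => z z0; have [X0 [X1 [[x0 x1] [y0 y1]]]] := h z z0.
rewrite x0 y0; split; first reflexivity.
have := x1 i k; have := y1 i k; rewrite /der => -[_ yE] [_ xE].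
exact: (etrans xE (esym yE)).
Qed.

End Jets.

(** * Reduction of the equivalence to identities of classical matrices *)

Section QStep.
Variable R : realType.
Local Notation C := (Cplx R).
Local Notation C2 := (C * C)%type.
Local Notation dz := ((1, 0) : C2).
Local Notation du := ((0, 1) : C2).
Local Notation mxfun := (C2 -> 'M[C]_2).
Implicit Types (X Y A B G : mxfun) (W : set C2).

Record derivatives W X Xz Xu : Prop := Derivatives {
  der_holo : hmx W X;
  der_holoz : hmx W Xz;
  der_holou : hmx W Xu;
  der_z : forall x, W x -> derm x dz X (Xz x);
  der_u : forall x, W x -> derm x du X (Xu x) }.

Lemma derivatives_const W (K : 'M[C]_2) : derivatives W (fun=> K) (fun=> 0) (fun=> 0).
Proof. by split; [exact: hmx_const|exact: hmx_const|exact: hmx_const|move=> *; exact: derm_const..]. Qed.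

Section Transition.
Variables (j : nat) (j2 : (2 <= j)%N).
Implicit Types p q : coeffs R j.

(** This is pi in p = pi(z) u, with P = [rVpoly p] and nonnegative powers only; it agrees with
    [pfun p] where z != 0. *)
Definition slope p (z : C) : C := z ^- j.-2 * (rVpoly p).[z].
Definition slope' p (z : C) : C :=
  - (j.-2)%:R * z ^- j.-2 * z^-1 * (rVpoly p).[z] + z ^- j.-2 * (rVpoly p)^`().[z].

Definition tr p : mxfun := fun x => mx2 (x.1 ^+ j) (slope p x.1 * x.2) 0 (x.1 ^- j).
Definition trz p : mxfun := fun x =>
  mx2 (j%:R * x.1 ^+ j * x.1^-1) (slope' p x.1 * x.2) 0 (- j%:R * x.1 ^- j * x.1^-1).
Definition tru p : mxfun := fun x => mx2 0 (slope p x.1) 0 0.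
Definition itr p : mxfun := fun x => mx2 (x.1 ^- j) (- (slope p x.1 * x.2)) 0 (x.1 ^+ j).
Definition itrz p : mxfun := fun x =>
  mx2 (- j%:R * x.1 ^- j * x.1^-1) (- (slope' p x.1 * x.2)) 0 (j%:R * x.1 ^+ j * x.1^-1).
Definition itru p : mxfun := fun x => mx2 0 (- slope p x.1) 0 0.

Lemma holo_inv1 : holo (@UV R) (fun x => x.1^-1).
Proof. by move=> x x1; apply: differentiable2V => //; exact: differentiable_c1. Qed.

Lemma holo_exp1 W n : holo W (fun x : C2 => x.1 ^+ n).
Proof.
have -> : (fun x : C2 => x.1 ^+ n) = (fun x => ('X^n).[x.1]) by apply/funext => x; rewrite hornerXn.
exact: holo_horner1.
Qed.

Lemma holo_expV1 n : holo (@UV R) (fun x => x.1 ^- n).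
Proof.
move=> x x1; apply: differentiable2V; first exact: (@holo_exp1 setT).
by rewrite expf_neq0.
Qed.

Lemma holo_slope p : holo (@UV R) (fun x => slope p x.1).
Proof. by apply: holoM; [exact: holo_expV1|exact: holo_horner1]. Qed.

Lemma holo_slope' p : holo (@UV R) (fun x => slope' p x.1).
Proof.
apply: holoD; apply: holoM; last exact: holo_horner1; last exact: holo_expV1; last exact: holo_horner1.
apply: holoM; last exact: holo_inv1.
by apply: holoM; [exact: holo_cst|exact: holo_expV1].
Qed.

Lemma der_slope p x v : x.1 != 0 -> der x v (fun x => slope p x.1) (v.1 * slope' p x.1).
Proof.
move=> x1; rewrite /slope /slope'; apply: der_eq.
  by apply: derM; [exact: der_expV1|exact: der_horner].
by rewrite /=; ring.
Qed.

Lemma derivatives_tr p : derivatives (@UV R) (tr p) (trz p) (tru p).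
Proof.
split; rewrite /tr /trz /tru.
- apply: hmx_mx2; [exact: holo_exp1| |exact: holo_cst|exact: holo_expV1].
  by apply: holoM; [exact: holo_slope|exact: holo2].
- apply: hmx_mx2; [| |exact: holo_cst|].
  + by apply: holoM; [apply: holoM; [exact: holo_cst|exact: holo_exp1]|exact: holo_inv1].
  + by apply: holoM; [exact: holo_slope'|exact: holo2].
  + by apply: holoM; [apply: holoM; [exact: holo_cst|exact: holo_expV1]|exact: holo_inv1].
- by apply: hmx_mx2; [exact: holo_cst|exact: holo_slope|exact: holo_cst|exact: holo_cst].
- move=> x x1; have {}x1 : x.1 != 0 := x1; apply: derm_mx2.
  + by apply: der_eq; [exact: der_exp1|rewrite mulr1].
  + apply: der_eq; first by apply: derM; [exact: der_slope|exact: der_coord2].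
    by rewrite /=; ring.
  + exact: der_const.
  + by apply: der_eq; [exact: der_expV1|rewrite mulr1].
- move=> x x1; have {}x1 : x.1 != 0 := x1; apply: derm_mx2.
  + exact: (der_fst (fun z => z ^+ j)).
  + apply: der_eq; first by apply: derM; [exact: der_slope|exact: der_coord2].
    by rewrite /=; ring.
  + exact: der_const.
  + exact: (der_fst (fun z => z ^- j)).
Qed.

Definition adj X : mxfun := fun x => mx2 (X x 1 1) (- X x 0 1) (- X x 1 0) (X x 0 0).

Lemma derivatives_adj W X Xz Xu : derivatives W X Xz Xu -> derivatives W (adj X) (adj Xz) (adj Xu).
Proof.
move=> [h hz hu dX dU]; split; rewrite /adj.
- by apply: hmx_mx2; [exact: h|apply: holoN; exact: h|apply: holoN; exact: h|exact: h].
- by apply: hmx_mx2; [exact: hz|apply: holoN; exact: hz|apply: holoN; exact: hz|exact: hz].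
- by apply: hmx_mx2; [exact: hu|apply: holoN; exact: hu|apply: holoN; exact: hu|exact: hu].
- by move=> x Wx; apply: derm_mx2; [exact: dX|exact: (derN (dX x Wx 0 1))|exact: (derN (dX x Wx 1 0))|exact: dX].
- by move=> x Wx; apply: derm_mx2; [exact: dU|exact: (derN (dU x Wx 0 1))|exact: (derN (dU x Wx 1 0))|exact: dU].
Qed.

Lemma adj_mx2 (a b c d : C2 -> C) :
  adj (fun x => mx2 (a x) (b x) (c x) (d x)) = (fun x => mx2 (d x) (- b x) (- c x) (a x)).
Proof. by apply/funext => x; rewrite /adj !mxE. Qed.

Lemma derivatives_itr p : derivatives (@UV R) (itr p) (itrz p) (itru p).
Proof.
have := derivatives_adj (derivatives_tr p).
rewrite /tr /trz /tru !adj_mx2; rewrite /itr /itrz /itru.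
have -> : (fun x : C2 => mx2 0 (- slope p x.1) (- 0) 0) = (fun x => mx2 0 (- slope p x.1) 0 0).
  by apply/funext => x; rewrite oppr0.
have e (a b c : C2 -> C) : (fun x : C2 => mx2 (a x) (b x) (- 0) (c x)) = (fun x => mx2 (a x) (b x) 0 (c x)).
  by apply/funext => x; rewrite oppr0.
by rewrite !e.
Qed.

Lemma tr_itr p x : x.1 != 0 -> tr p x *m itr p x = 1%:M.
Proof.
move=> x1; rewrite mul_mx2 mx2_1; have x1j : x.1 ^+ j != 0 by rewrite expf_neq0.
by congr mx2; field.
Qed.

Lemma m1_qtransition p p' x : x.1 != 0 -> m1 (qtransition p p') x = tr p x.
Proof.
move=> x1; apply/matrixP => i k; rewrite !mxE; case: (i == 0); case: (k == 0) => //=.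
by case: x x1 => z u z0; rewrite pfunE.
Qed.

Lemma m2_qtransition p p' x : x.1 != 0 -> m2 (qtransition p p') x = mx2 0 (slope p' x.1 * x.2) 0 0.
Proof.
move=> x1; apply/matrixP => i k; rewrite !mxE; case: (i == 0); case: (k == 0) => //=.
by case: x x1 => z u z0; rewrite pfunE.
Qed.

Lemma derivatives_UV X Y Xz Xu : (forall x, x.1 != 0 -> X x = Y x) ->
  derivatives (@UV R) X Xz Xu -> derivatives (@UV R) Y Xz Xu.
Proof.
move=> XY [h hz hu dX dU]; split=> //.
- move=> i k x x1; apply: near_differentiable (h i k x x1).
  apply: filterS (open_nbhs_nbhs (conj (open_neq0 (R := R)) x1)) => y y1.
  by rewrite XY.
- by move=> x x1; apply: (derm_near (open_neq0 (R := R)) x1 _ (dX x x1)).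
- by move=> x x1; apply: (derm_near (open_neq0 (R := R)) x1 _ (dU x x1)).
Qed.

End Transition.

End QStep.

Section QStepIntro.
Variable R : realType.
Local Notation C := (Cplx R).
Local Notation C2 := (C * C)%type.
Local Notation dz := ((1, 0) : C2).
Local Notation du := ((0, 1) : C2).
Local Notation mxfun := (C2 -> 'M[C]_2).
Local Notation qfun := ((C2 -> C) * (C2 -> C))%type.
Variables (sU sV : C2 -> C) (j : nat).
Hypotheses (j2 : (2 <= j)%N) (hsU : holo setT sU) (hsV : holo setT sV).
Implicit Types (A B G : mxfun) (p q : coeffs R j).

Lemma eq_mod_u2_UV (f g g' : C2 -> C) : (forall x, x.1 != 0 -> g x = g' x) ->
  eq_mod_u2 f g -> eq_mod_u2 f g'.
Proof.
move=> gg fg; rewrite /eq_mod_u2 => z z0; have [e0 e1] := fg z z0.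
split; first by rewrite e0 gg.
apply: (etrans e1); apply: near_eq_derive.
apply: filterS (open_nbhs_nbhs (conj (open_neq0 (R := R)) (z0 : (z, 0 : C).1 != 0))) => y y1.
exact: gg.
Qed.

Lemma qholoP W (X : 'M[qfun]_2) : hmx W (m1 X) -> hmx W (m2 X) -> qholo W X.
Proof.
move=> h1 h2 i k; split.
  have -> : (X i k).1 = (fun x => m1 X x i k) by apply/funext => x; rewrite mxE.
  exact: h1.
have -> : (X i k).2 = (fun x => m2 X x i k) by apply/funext => x; rewrite mxE.
exact: h2.
Qed.

Definition dtr p : mxfun := fun x => mx2 0 (slope p x.1 * x.2) 0 0.

Lemma derivatives_qtransition p p' :
  derivatives (@UV R) (m1 (qtransition p p')) (trz p) (tru p).
Proof.
apply: derivatives_UV (derivatives_tr p) => x x1.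
by rewrite m1_qtransition.
Qed.

Lemma qholo_qtransition p p' : qholo (@UV R) (qtransition p p').
Proof.
apply: qholoP; first exact: (der_holo (derivatives_qtransition p p')).
move=> i k x x1.
have : hmx (@UV R) (dtr p').
  apply: hmx_mx2; [exact: holo_cst| |exact: holo_cst|exact: holo_cst].
  by apply: holoM; [exact: holo_slope|exact: holo2].
move=> /(_ i k x x1); apply: near_differentiable.
apply: filterS (open_nbhs_nbhs (conj (open_neq0 (R := R)) x1)) => y y1.
by rewrite m2_qtransition.
Qed.

(** The hbar part of the star inverse of T_q, divided by [sU]. It comes from the brackets of z^j and
    z^-j with pi u, which add up and yield the factor 2j. *)
Definition itr_hbar q : mxfun := fun x => mx2 0 (2 * j%:R * slope q x.1 * x.1^-1) 0 0.

Definition qitr q : 'M[qfun]_2 :=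
  star_inv sU (qtransition q 0) (trz q) (tru q) (itr q) (itrz q) (itru q).

Lemma slope0 z : slope (0 : coeffs R j) z = 0.
Proof. by rewrite /slope linear0 horner0 mulr0. Qed.

Lemma m2_qitr q x : x.1 != 0 -> m2 (qitr q) x = sU x *: itr_hbar q x.
Proof.
move=> x1; rewrite m2_qmx m2_qtransition// slope0 mul0r.
rewrite /itr_hbar /itr /trz /tru /itrz /itru.
have x1j : x.1 ^+ j != 0 by rewrite expf_neq0.
rewrite !(mul_mx2, add_mx2, opp_mx2, scale_mx2).
by congr mx2; field; rewrite ?x1 ?x1j.
Qed.

Lemma qitrP q : star_inverse sU (@UV R) (qtransition q 0) (qitr q).
Proof.
have [hT hTz hTu dTz dTu] := derivatives_qtransition q 0.
have [hS hSz hSu dSz dSu] := derivatives_itr q.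
apply: star_invP => //; first exact: open_neq0.
- by apply: holoS hsU.
- exact: qholo_qtransition.
- by move=> x x1; rewrite m1_qtransition// tr_itr.
Qed.

(* The hbar part of T_p * A * (star inverse of T_q) that comes from the brackets,
   divided by sU. *)
Definition theta p q A Az Au : mxfun := fun x =>
  (trz p x *m Au x - tru p x *m Az x) *m itr q x
  + ((trz p x *m A x + tr p x *m Az x) *m itru q x
     - (tru p x *m A x + tr p x *m Au x) *m itrz q x)
  + tr p x *m A x *m itr_hbar q x.

Let collect (X Y D E F S T : 'M[C]_2) s : X *m (s *: T) + (Y + D + s *: E) *m S + s *: F =
  Y *m S + D *m S + s *: (E *m S + F + X *m T).
Proof.
rewrite -scalemxAr !mulmxDl -scalemxAl !scalerDr [s *: (X *m T) + _]addrC -!addrA.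
by congr (_ + (_ + (_ + _))); rewrite addrC.
Qed.

(** Classical inverses with holomorphic derivatives suffice for star invertibility, by [star_invP].
    The gluing condition separates into a classical part and an hbar part whose brackets are
    collected in [theta]. *)
Lemma qstep_intro p p' q A A' Az Au B Bz Bu G G' Gz Gu H Hz Hu :
  qpair (p, p') -> qpair (q, 0) ->
  derivatives setT A Az Au -> derivatives setT B Bz Bu ->
  (forall x, A x *m B x = 1%:M) -> hmx setT A' ->
  derivatives setT G Gz Gu -> derivatives setT H Hz Hu ->
  (forall x, G x *m H x = 1%:M) -> hmx setT G' ->
  (forall i k, eq_mod_u2 (fun x => G (Defs.glue x) i k)
     (fun x => (tr p x *m A x *m itr q x) i k)) ->
  (forall i k, eq_mod_u2 (fun x => G' (Defs.glue x) i k)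
     (fun x => (tr p x *m A' x *m itr q x + dtr p' x *m A x *m itr q x
                + sU x *: theta p q A Az Au x) i k)) ->
  qstep sU sV (p, p') (q, 0).
Proof.
move=> qp qq dA dB AB hA' dG dH GH hG' e1 e2; split=> //.
exists (qmx A A'), (qmx G G'), (qitr q).
have inv s (X X' Xz Xu Y Yz Yu : mxfun) : holo setT s -> derivatives setT X Xz Xu ->
    derivatives setT Y Yz Yu -> (forall x, X x *m Y x = 1%:M) -> hmx setT X' ->
    qholo setT (qmx X X') /\ exists Z, star_inverse s setT (qmx X X') Z.
  move=> hs [hX hXz hXu dXz dXu] [hY hYz hYu dYz dYu] XY hX'.
  have qX : qholo setT (qmx X X') by exact: qholo_qmx.
  split=> //; exists (star_inv s (qmx X X') Xz Xu Y Yz Yu).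
  apply: star_invP => //; first exact: openT.
  - by move=> x Wx; rewrite m1_qmx; exact: dXz.
  - by move=> x Wx; rewrite m1_qmx; exact: dXu.
  - by move=> x Wx; rewrite m1_qmx; exact: XY.
split; [exact: inv dA dB AB hA'|exact: inv dG dH GH hG'|exact: qitrP|].
move=> i k; set M := starmx sU _ _.
have M1 x : x.1 != 0 -> m1 M x = tr p x *m A x *m itr q x.
  by move=> x1; rewrite !m1_starmx m1_qtransition// !m1_qmx.
have [_ _ _ dTz dTu] := derivatives_qtransition p p'.
have [_ _ _ dSz dSu] := derivatives_itr q.
have [_ _ _ dAz dAu] := dA.
have M2 x : x.1 != 0 -> m2 M x = tr p x *m A' x *m itr q x + dtr p' x *m A x *m itr q x
                + sU x *: theta p q A Az Au x.
  move=> x1; have x1' : UV x := x1.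
  have dAz' : derm x dz (m1 (qmx A A')) (Az x) by rewrite m1_qmx; exact: dAz.
  have dAu' : derm x du (m1 (qmx A A')) (Au x) by rewrite m1_qmx; exact: dAu.
  have TA y v (T' A1 : 'M[C]_2) : y.1 != 0 -> derm y v (m1 (qtransition p p')) T' -> derm y v A A1 ->
      derm y v (m1 (starmx sU (qtransition p p') (qmx A A'))) (T' *m A y + tr p y *m A1).
    move=> y1 dT dA1.
    have -> : m1 (starmx sU (qtransition p p') (qmx A A')) =
        (fun x => m1 (qtransition p p') x *m A x).
      by apply/funext => w; rewrite m1_starmx m1_qmx.
    by rewrite -(m1_qtransition j2 p p' y1); exact: derm_mul.
  have TAz := TA x dz _ _ x1 (dTz x x1') (dAz x I).
  have TAu := TA x du _ _ x1 (dTu x x1') (dAu x I).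
  have dSz' : derm x dz (m1 (qitr q)) (itrz q x) by rewrite m1_qmx; exact: dSz.
  have dSu' : derm x du (m1 (qitr q)) (itru q x) by rewrite m1_qmx; exact: dSu.
  rewrite (m2_starmx sU TAz TAu dSz' dSu') m1_starmx (m1_qtransition j2 p p' x1) !m1_qmx.
  rewrite (m2_qitr q x1) (m2_starmx sU (dTz x x1') (dTu x x1') dAz' dAu').
  rewrite (m1_qtransition j2 p p' x1) (m2_qtransition j2 p p' x1).
  by rewrite m1_qmx m2_qmx; exact: collect.
have E1 : (qmx G G' i k).1 \o @Defs.glue R = fun x => G (Defs.glue x) i k.
  by apply/funext => x; rewrite /qmx mxE.
have E2 : (qmx G G' i k).2 \o @Defs.glue R = fun x => G' (Defs.glue x) i k.
  by apply/funext => x; rewrite /qmx mxE.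
rewrite E1 E2; split.
- by apply: eq_mod_u2_UV (e1 i k) => x x1; rewrite -M1// mxE.
- by apply: eq_mod_u2_UV (e2 i k) => x x1; rewrite -M2// mxE.
Qed.

End QStepIntro.

(** * The gauge transformation *)

Section Gauge.
Variable R : realType.
Local Notation C := (Cplx R).
Local Notation C2 := (C * C)%type.
Local Notation dz := ((1, 0) : C2).
Local Notation du := ((0, 1) : C2).
Local Notation mxfun := (C2 -> 'M[C]_2).
Implicit Types (f g : {poly C}).

Ltac derive_entry := repeat first
  [ apply: der_const | apply: der_coord1 | apply: der_coord2 | apply: der_horner
  | apply: derD | apply: derN | apply: derM ].

Ltac holo_entry := repeat first
  [ apply: holo_cst | apply: holo1 | apply: holo2 | apply: holo_horner1
  | apply: holoD | apply: holoN | apply: holoM ].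

(* [[1 + ug, 0], [f, 1 - ug]] modulo u^2, completed to have determinant 1: this is
   [[1, 0], [(f - g)(1 - ug), 1]] * [[1 + ug, - u^2 g], [g, 1 - ug]]. *)
Definition psi g f : mxfun := fun x =>
  mx2 (1 + x.2 * g.[x.1]) (- (x.2 * x.2 * g.[x.1]))
      (f.[x.1] - (f.[x.1] - g.[x.1]) * (x.2 * x.2 * (g.[x.1] * g.[x.1])))
      (1 - x.2 * g.[x.1] - (f.[x.1] - g.[x.1]) * (1 - x.2 * g.[x.1]) * (x.2 * x.2 * g.[x.1])).

Definition psiz g f : mxfun := fun x =>
  mx2 (x.2 * g^`().[x.1]) (- (x.2 * x.2 * g^`().[x.1]))
      (f^`().[x.1] - (f^`().[x.1] - g^`().[x.1]) * (x.2 * x.2 * (g.[x.1] * g.[x.1]))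
       - (f.[x.1] - g.[x.1]) * (x.2 * x.2 * (2 * g.[x.1] * g^`().[x.1])))
      (- (x.2 * g^`().[x.1])
       - (f^`().[x.1] - g^`().[x.1]) * (1 - x.2 * g.[x.1]) * (x.2 * x.2 * g.[x.1])
       + (f.[x.1] - g.[x.1]) * (x.2 * g^`().[x.1]) * (x.2 * x.2 * g.[x.1])
       - (f.[x.1] - g.[x.1]) * (1 - x.2 * g.[x.1]) * (x.2 * x.2 * g^`().[x.1])).

Definition psiu g f : mxfun := fun x =>
  mx2 g.[x.1] (- (2 * x.2 * g.[x.1]))
      (- (f.[x.1] - g.[x.1]) * (2 * x.2 * (g.[x.1] * g.[x.1])))
      (- g.[x.1] + (f.[x.1] - g.[x.1]) * g.[x.1] * (x.2 * x.2 * g.[x.1])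
       - (f.[x.1] - g.[x.1]) * (1 - x.2 * g.[x.1]) * (2 * x.2 * g.[x.1])).

Lemma derivatives_psi g f : derivatives setT (psi g f) (psiz g f) (psiu g f).
Proof.
split; rewrite /psi /psiz /psiu.
- by apply: hmx_mx2; holo_entry.
- by apply: hmx_mx2; holo_entry.
- by apply: hmx_mx2; holo_entry.
- by move=> x _; apply: derm_mx2; (apply: der_eq; [derive_entry|rewrite /=; ring]).
- by move=> x _; apply: derm_mx2; (apply: der_eq; [derive_entry|rewrite /=; ring]).
Qed.

Lemma psi_adj g f x : psi g f x *m adj (psi g f) x = 1%:M.
Proof. by rewrite /psi adj_mx2 mul_mx2 mx2_1; congr mx2; ring. Qed.

Lemma jet_psi g f z : jet z (psi g f) (mx2 1 0 f.[z] 1) (mx2 g.[z] 0 0 (- g.[z])).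
Proof.
split; first by rewrite /psi /=; congr mx2; ring.
by apply: derm_mx2; (apply: der_eq; [derive_entry|rewrite /=; ring]).
Qed.

Lemma jet_psiz g f z :
  jet z (psiz g f) (mx2 0 0 f^`().[z] 0) (mx2 g^`().[z] 0 0 (- g^`().[z])).
Proof.
split; first by rewrite /psiz /=; congr mx2; ring.
by apply: derm_mx2; (apply: der_eq; [derive_entry|rewrite /=; ring]).
Qed.

Lemma jet_psiu g f z : jet z (psiu g f) (mx2 g.[z] 0 0 (- g.[z]))
  (mx2 0 (- (2 * g.[z])) (- (2 * (f.[z] - g.[z]) * g.[z] ^+ 2)) (- (2 * (f.[z] - g.[z]) * g.[z]))).
Proof.
split; first by rewrite /psiu /=; congr mx2; ring.
by apply: derm_mx2; (apply: der_eq; [derive_entry|rewrite /=; ring]).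
Qed.

Lemma jet_psi_glue g f z : jet z (fun x => psi g f (Defs.glue x))
  (mx2 1 0 f.[z^-1] 1) (mx2 (z * g.[z^-1]) 0 0 (- (z * g.[z^-1]))).
Proof.
have dg := der_fst (fun z => g.[z^-1]) (z, 0).
have df := der_fst (fun z => f.[z^-1]) (z, 0).
split; first by rewrite /psi /=; congr mx2; ring.
rewrite /psi /Defs.glue /=.
by apply: derm_mx2; (apply: der_eq; [repeat (first [exact: dg|exact: df|apply: der_const
  |apply: der_coord1 | apply: der_coord2| apply: derD | apply: derN | apply: derM ])|rewrite /=; ring]).
Qed.

Section Core.
Variables (sU sV : C2 -> C) (j : nat) (s0 : C).
Hypotheses (j2 : (2 <= j)%N) (pois : poisson sU sV) (sU0 : forall z, sU (z, 0) = s0).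
Implicit Types p q : coeffs R j.

Lemma jet_tr p z : z != 0 ->
  jet z (tr p) (mx2 (z ^+ j) 0 0 (z ^- j)) (mx2 0 (slope p z) 0 0).
Proof.
move=> z0; split; first by rewrite /tr /= mulr0.
exact: (der_u (derivatives_tr p) (z0 : UV (z, 0))).
Qed.

Lemma jet_itr p z : z != 0 ->
  jet z (itr p) (mx2 (z ^- j) 0 0 (z ^+ j)) (mx2 0 (- slope p z) 0 0).
Proof.
move=> z0; split; first by rewrite /itr /= mulr0 oppr0.
exact: (der_u (derivatives_itr p) (z0 : UV (z, 0))).
Qed.

Lemma jet_dtr p z : z != 0 -> jet z (dtr p) 0 (mx2 0 (slope p z) 0 0).
Proof.
move=> z0; split.
  by rewrite /dtr /= mulr0; apply/matrixP => i k; rewrite !mxE; case: ifP; case: ifP.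
apply: derm_mx2; [exact: der_const| |exact: der_const|exact: der_const].
apply: der_eq; first by apply: derM; [exact: der_slope|exact: der_coord2].
by rewrite /=; ring.
Qed.

Let der_line (h : C -> C) z : der (z, 0) du (fun x => h x.1 * x.2) (h z).
Proof.
apply: der_eq; first by apply: derM; [exact: (der_fst h)|exact: der_coord2].
by rewrite /=; ring.
Qed.

Lemma jet_trz p z : z != 0 -> jet z (trz p)
  (mx2 (j%:R * z ^+ j * z^-1) 0 0 (- j%:R * z ^- j * z^-1)) (mx2 0 (slope' p z) 0 0).
Proof.
move=> z0; split; first by rewrite /trz /= mulr0.
apply: derm_mx2; [|exact: (der_line (slope' p))|exact: der_const|].
- exact: (der_fst (fun z => j%:R * z ^+ j * z^-1)).
- exact: (der_fst (fun z => - j%:R * z ^- j * z^-1)).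
Qed.

Lemma jet_itrz p z : z != 0 -> jet z (itrz p)
  (mx2 (- j%:R * z ^- j * z^-1) 0 0 (j%:R * z ^+ j * z^-1)) (mx2 0 (- slope' p z) 0 0).
Proof.
move=> z0; split; first by rewrite /itrz /= mulr0 oppr0.
apply: derm_mx2; [| |exact: der_const|].
- exact: (der_fst (fun z => - j%:R * z ^- j * z^-1)).
- exact: (derN (der_line (slope' p) z)).
- exact: (der_fst (fun z => j%:R * z ^+ j * z^-1)).
Qed.

Lemma jet_tru p z : jet z (tru p) (mx2 0 (slope p z) 0 0) 0.
Proof.
split=> //; move=> i k; rewrite mxE.
exact: (der_fst (fun z => (mx2 0 (slope p z) 0 0 : 'M[C]_2) i k)).
Qed.

Lemma jet_itru p z : jet z (itru p) (mx2 0 (- slope p z) 0 0) 0.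
Proof.
split=> //; move=> i k; rewrite mxE.
exact: (der_fst (fun z => (mx2 0 (- slope p z) 0 0 : 'M[C]_2) i k)).
Qed.

Lemma jet_itr_hbar p z : jet z (itr_hbar p) (mx2 0 (2 * j%:R * slope p z * z^-1) 0 0) 0.
Proof.
split=> //; move=> i k; rewrite mxE.
exact: (der_fst (fun z => (mx2 0 (2 * j%:R * slope p z * z^-1) 0 0 : 'M[C]_2) i k)).
Qed.

(** The upper left entry of [theta] on ell for the gauge matrix [psi g f]; the lower right one
    differs from it by 2j F / z with F = z^-j pi f. *)
Definition theta11 p g f (z : C) : C := 2 * j%:R * z^-1 * g.[z]
  - z ^- j * slope p z * f^`().[z] + j%:R * z^-1 * (z ^- j * slope p z * f.[z]).

Lemma jet_eq z (X : mxfun) (X0 X1 Y0 Y1 : 'M[C]_2) : jet z X X0 X1 -> X0 = Y0 -> X1 = Y1 ->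
  jet z X Y0 Y1.
Proof. by move=> + <- <-. Qed.

Lemma mx2_0 : 0 = mx2 0 0 0 0 :> 'M[C]_2.
Proof. by apply/matrixP => i k; rewrite !mxE; case: ifP; case: ifP. Qed.

Lemma jet_theta p g f z : z != 0 ->
  jet z (theta p p (psi g f) (psiz g f) (psiu g f))
    (mx2 (theta11 p g f z) 0 0
         (theta11 p g f z + 2 * j%:R * z^-1 * (z ^- j * slope p z * f.[z])))
    (mx2 0 (2 * j%:R * z^-1 * z ^+ j * slope p z * (g.[z] + z ^- j * slope p z * f.[z]))
         0 (4 * j%:R * z^-1 * (f.[z] - g.[z]) * g.[z])).
Proof.
move=> z0; have zj : z ^+ j != 0 by rewrite expf_neq0.
apply: jet_eq.
- apply: jetD; first apply: jetD.
  + by apply: jetM (jet_itr p z0); apply: jetD; last apply: jetN; apply: jetM;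
      [exact: jet_trz|exact: jet_psiu|exact: jet_tru|exact: jet_psiz].
  + apply: jetD; last apply: jetN.
    * by apply: jetM (jet_itru p z); apply: jetD; apply: jetM;
        [exact: jet_trz|exact: jet_psi|exact: jet_tr|exact: jet_psiz].
    * by apply: jetM (jet_itrz p z0); apply: jetD; apply: jetM;
        [exact: jet_tru|exact: jet_psi|exact: jet_tr|exact: jet_psiu].
  + by apply: jetM (jet_itr_hbar p z); apply: jetM; [exact: jet_tr|exact: jet_psi].
- rewrite !(mul_mx2, add_mx2, opp_mx2) /theta11; congr mx2; field; rewrite ?z0 ?zj //.
- rewrite mx2_0 !(mul_mx2, add_mx2, opp_mx2) /theta11; congr mx2; field; rewrite ?z0 ?zj //.
Qed.

(** The first two conditions make the conjugate of [psi g f] extend to V as [psi gV fV] modulo u^2.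
    The others distribute hbar terms: polynomials in z are cancelled on U by [A'], polynomials in
    1/z are taken over by [G'] on V, with a factor z at order u because v = zu. The terms on ell are
    absorbed as multiples of [sU] on U and of [sV = - z^-1 sU] on V, which matches both orders in u
    at once. Only the last condition is a constraint: its right-hand side leaves the exponents 2,
    ..., 2j - 1 uncovered. *)
Lemma gauge_core p p' mu (f g gV fV a11 a22 b11 b12 b22 l11 l22 m11 m12 m22 : {poly C}) :
  qpair (p, p') -> qpair (p, 0) ->
  (forall z, z != 0 -> let F := z ^- j * slope p z * f.[z] in
   [/\ g.[z] + F = z * gV.[z^-1],
       z ^- j * f.[z] * z ^- j = fV.[z^-1],
       theta11 p g f z = a11.[z] + z^-1 * l11.[z^-1]
     & theta11 p g f z + 2 * j%:R * z^-1 * F = a22.[z] + z^-1 * l22.[z^-1]] /\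
   [/\ z ^- j * slope p' z * f.[z] = b11.[z] + z * m11.[z^-1],
       s0 * (4 * j%:R * z^-1 * (f.[z] - g.[z]) * g.[z]) = b22.[z] + z * m22.[z^-1]
     & z ^+ j * slope p z * (s0 * (a11.[z] - a22.[z]) + mu) + z ^+ j * slope p' z
       + s0 * (2 * j%:R * z^-1 * z ^+ j * slope p z * (g.[z] + F))
       = z ^+ j * z ^+ j * b12.[z] + z * m12.[z^-1]]) ->
  qstep sU sV (p, p') (p, 0).
Proof.
case: pois => hsU hsV glueV qp qq H.
(* The constant [mu] is common to both charts; conjugation by T_p turns it into [mu] z^j pi in the
   upper right entry at order u. *)
pose A' : mxfun := fun x => mx2 (- (sU x * a11.[x.1]) - x.2 * b11.[x.1]) (- (x.2 * b12.[x.1]))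
  0 (- (sU x * a22.[x.1]) - x.2 * b22.[x.1] + mu).
pose G' : mxfun := fun x => mx2 (- (sV x * l11.[x.1]) + x.2 * m11.[x.1]) (x.2 * m12.[x.1])
  0 (- (sV x * l22.[x.1]) + x.2 * m22.[x.1] + mu).
pose s1 (z : C) : C := 'D_du sU (z, 0).
have dsU z : der (z, 0) du sU (s1 z).
  by apply: DeriveDef => //; apply: diff_derivable; exact: hsU.
have jA' z : jet z A' (mx2 (- (s0 * a11.[z])) 0 0 (- (s0 * a22.[z]) + mu))
    (mx2 (- (s1 z * a11.[z]) - b11.[z]) (- b12.[z]) 0 (- (s1 z * a22.[z]) - b22.[z])).
  split; first by rewrite /A' /= sU0; congr mx2; ring.
  have dU := dsU z.
  by apply: derm_mx2; (apply: der_eq; [repeat (first [exact: dU|apply: der_const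
    |apply: der_coord1|apply: der_coord2|apply: der_horner|apply: derD|apply: derN|apply: derM])
    |rewrite /= ?sU0; ring]).
have jG' z : z != 0 -> jet z (fun x => G' (Defs.glue x))
    (mx2 (s0 * (z^-1 * l11.[z^-1])) 0 0 (s0 * (z^-1 * l22.[z^-1]) + mu))
    (mx2 (s1 z * (z^-1 * l11.[z^-1]) + z * m11.[z^-1]) (z * m12.[z^-1])
       0 (s1 z * (z^-1 * l22.[z^-1]) + z * m22.[z^-1])).
  move=> z0; pose hn (q : {poly C}) (z : C) : C := z^-1 * q.[z^-1]; pose hp (q : {poly C}) (z : C) : C := z * q.[z^-1].
  apply: (@jet_UV _ _ (fun x => mx2 (sU x * hn l11 x.1 + hp m11 x.1 * x.2) (hp m12 x.1 * x.2)
      0 (sU x * hn l22 x.1 + hp m22 x.1 * x.2 + mu))) => //.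
    move=> x x1; rewrite /G' glueV// /Defs.glue /hn /hp /=; congr mx2; ring.
  split; first by rewrite /= sU0 /hn; congr mx2; ring.
  have dU := dsU z.
  have dn r := der_fst (hn r) (z, 0); have dp r := der_line (hp r) z.
  by apply: derm_mx2; (apply: der_eq; [repeat (first [exact: dU|exact: dn|exact: dp|apply: der_const
    |apply: derD|apply: derM])|rewrite /= ?sU0 /hn /hp; ring]).
have dA := derivatives_psi g f; have dG := derivatives_psi gV fV.
apply: (@qstep_intro R sU sV j j2 hsU hsV p p' p (psi g f) A' _ _ _ _ _ (psi gV fV) G'
  _ _ _ _ _ qp qq dA (derivatives_adj dA) (psi_adj g f) _ dG (derivatives_adj dG) (psi_adj gV fV)).
- by rewrite /A'; apply: hmx_mx2; repeat (first [exact: hsU|apply: holo_cst|apply: holo2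
    |apply: holo_horner1|apply: holoD|apply: holoN|apply: holoM]).
- by rewrite /G'; apply: hmx_mx2; repeat (first [exact: hsV|apply: holo_cst|apply: holo2
    |apply: holo_horner1|apply: holoD|apply: holoN|apply: holoM]).
- apply: eq_mod_u2_jet => z z0; have [[hg hf _ _] _] := H z z0.
  have zj : z ^+ j != 0 by rewrite expf_neq0.
  do 2 eexists; split; first exact: jet_psi_glue.
  apply: jet_eq; first by apply: jetM (jet_itr p z0); apply: jetM; [exact: jet_tr|exact: jet_psi].
    by rewrite !mul_mx2 -hf; congr mx2; field.
  by rewrite !(mul_mx2, add_mx2) -hg; congr mx2; field.
- apply: eq_mod_u2_jet => z z0; have [[_ _ h11 h22] [k11 k22 k12]] := H z z0.
  have zj : z ^+ j != 0 by rewrite expf_neq0.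
  do 2 eexists; split; first exact: jG'.
  apply: jet_eq.
  + apply: jetD; last exact: (jetZ (sU0 z) (dsU z) (jet_theta p g f z0)).
    by apply: jetD; apply: jetM (jet_itr p z0); apply: jetM;
      [exact: jet_tr|exact: jA'|exact: jet_dtr|exact: jet_psi].
  + rewrite mx2_0 !(mul_mx2, add_mx2, scale_mx2); congr mx2.
    * by rewrite h11; field; rewrite ?zj ?z0.
    * by field; rewrite ?zj.
    * by field; rewrite ?zj.
    * by rewrite h22; field; rewrite ?zj ?z0.
  + rewrite mx2_0 !(mul_mx2, add_mx2, scale_mx2); congr mx2.
    * have -> : z^-1 * l11.[z^-1] = theta11 p g f z - a11.[z] by rewrite h11 addrC addKr.
      have -> : z * m11.[z^-1] = z ^- j * slope p' z * f.[z] - b11.[z] by rewrite k11 addrC addKr.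
      by field; rewrite ?zj ?z0.
    * apply: (addIr (z ^+ j * z ^+ j * b12.[z])); rewrite [RHS]addrC -k12.
      by field; rewrite zj z0.
    * by field; rewrite ?zj ?z0.
    * have -> : z^-1 * l22.[z^-1] = theta11 p g f z
          + 2 * j%:R * z^-1 * (z ^- j * slope p z * f.[z]) - a22.[z] by rewrite h22 addrC addKr.
      have -> : z * m22.[z^-1] = s0 * (4 * j%:R * z^-1 * (f.[z] - g.[z]) * g.[z]) - b22.[z].
        by rewrite k22 addrC addKr.
      by field; rewrite zj z0.
Qed.

End Core.

End Gauge.

(** * Removing the hbar part of the transition matrix *)

Section GaugeStep.
Variable R : realType.
Local Notation C := (Cplx R).
Local Notation C2 := (C * C)%type.
Variables (sU sV : C2 -> C) (j : nat).
Hypotheses (j2 : (2 <= j)%N) (pois : poisson sU sV).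
Implicit Types p q : coeffs R j.

Lemma laurent_slope p : laurent (slope p).
Proof. by apply: laurentM; [exact: laurent_expV|exact: laurent_horner]. Qed.

(** The left-hand side of the last condition of [gauge_core] becomes z^(3 - 2j) N, and
    [signed_window_surj] chooses [f] and [mu] so that [N] has no coefficient of index 2j - 1, ...,
    4j - 4. The bound 2j on the degree of [f] is what makes z^(-2j) f, the lower left entry, regular
    on V. *)
Lemma qstep_limit s0 p p' : s0 != 0 -> (forall z, sU (z, 0) = s0) ->
  \rank (toeplitz j (rVpoly p)) = j.-1 -> qpair (p, p') -> qpair (p, 0) ->
  qstep sU sV (p, p') (p, 0).
Proof.
move=> s00 sU0 rk qp qq.
have s'0 : 2 * j%:R * s0 != 0 :> C by rewrite !mulf_neq0// pnatr_eq0; case: (j) j2.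
have [f [mu sf win]] := signed_window_surj j2 rk (fun k => (rVpoly p')`_k) s'0.
set P := rVpoly p in win; set P' := rVpoly p' in win.
(* So G = F / z has negative part z^-(2j-1) lo and nonnegative part dr. *)
pose lo := take_poly (2 * j - 1) (P * f); pose dr := drop_poly (2 * j - 1) (P * f).
pose N := 'X^(2 * j - 1) * (P' + mu *: P) + (2 * j%:R * s0) *: (P * signed_split j (P * f)).
pose low := take_poly (2 * j - 1) N; pose high := drop_poly (4 * j - 3) N.
have NE : N = low + 'X^(4 * j - 3) * high.
  apply/polyP => i; rewrite [RHS]coefD coefXnM coef_take_poly coef_drop_poly.
  have [i1|i1] := ltnP i (2 * j - 1).
    by rewrite (_ : i < 4 * j - 3)%N ?addr0//; lia.
  have [i2|i2] := ltnP i (4 * j - 3); last by rewrite subnK// add0r.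
  rewrite addr0 /N coefD coefXnM ltnNge i1 /= coefD !coefZ.
  have iw : (i - (2 * j - 1) < 2 * j - 2)%N by lia.
  by apply: (etrans _ (win _ iw)); rewrite subnK//; ring.
(* [g] cancels the summand z dr of F; the rest, z^(2 - 2j) lo, equals z gV(1/z). *)
pose g := - ('X * dr); pose gV := 'X * revp (2 * j - 2) lo; pose fV := revp (2 * j) f.
have [a11 [l11 h11]] : exists a l : {poly C}, forall z, z != 0 ->
    theta11 p g f z = a.[z] + z^-1 * l.[z^-1].
  apply: laurent_split; rewrite /theta11.
  have LF := laurentM (laurent_expV _ j) (laurent_slope p).
  have Lc c := laurentM (laurent_const c) (@laurent_inv R).
  apply: laurentD; [apply: laurentD|].
  - by apply: laurentM; [exact: Lc|exact: laurent_horner].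
  - by apply: laurentN; apply: laurentM; [exact: LF|exact: laurent_horner].
  - by apply: laurentM; [exact: Lc|apply: laurentM; [exact: LF|exact: laurent_horner]].
(* At order u the charts overlap in the exponents 0 and 1, so every Laurent polynomial splits. *)
have split2 h : laurent h -> exists b m : {poly C}, forall z, z != 0 ->
    h z = b.[z] + z * m.[z^-1].
  move=> /laurent_split[b [l E]]; exists b, ('X^2 * l) => z z0.
  by rewrite E// hornerM hornerXn; field.
have [b11 [m11 k11]] : exists b m : {poly C}, forall z, z != 0 ->
    z ^- j * slope p' z * f.[z] = b.[z] + z * m.[z^-1].
  apply: split2; apply: laurentM; last exact: laurent_horner.
  by apply: laurentM; [exact: laurent_expV|exact: laurent_slope].
have [b22 [m22 k22]] : exists b m : {poly C}, forall z, z != 0 ->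
    s0 * (4 * j%:R * z^-1 * (f.[z] - g.[z]) * g.[z]) = b.[z] + z * m.[z^-1].
  apply: split2; apply: laurentM; first exact: laurent_const.
  apply: laurentM; last exact: laurent_horner.
  apply: laurentM; first by apply: laurentM; [exact: laurent_const|exact: laurent_inv].
  by apply: laurentD; [exact: laurent_horner|apply: laurentN; exact: laurent_horner].
(* The diagonal entries of [theta] on ell differ by 2j F / z, whence the shifts of [a11] and [l11]
   by the two parts of it; the shift by 2j dr is the origin of - G_+. *)
apply: (@gauge_core R sU sV j s0 j2 pois sU0 p p' mu f g gV fV a11
  (a11 + (2 * j%:R) *: dr) b11 high b22 l11 (l11 + (2 * j%:R) *: revp (2 * j - 2) lo)
  m11 (revp (2 * j - 2) low) m22 qp qq) => z z0.
have zj : z ^+ j != 0 by rewrite expf_neq0.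
have rlo : (revp (2 * j - 2) lo).[z^-1] = z ^- (2 * j - 2) * lo.[z].
  by rewrite horner_revp// (leq_trans (size_take_poly _ _))//; lia.
have rlow : (revp (2 * j - 2) low).[z^-1] = z ^- (2 * j - 2) * low.[z].
  by rewrite horner_revp// (leq_trans (size_take_poly _ _))//; lia.
have rf : fV.[z^-1] = z ^- (2 * j) * f.[z] by rewrite horner_revp.
have e1 : z ^+ (2 * j - 1) = z ^+ j * z ^+ j * z^-1.
  by apply: (mulIf z0); rewrite divfK// -exprSr -exprD; congr (_ ^+ _); lia.
have e2 : z ^- j.-2 = z ^+ 2 * z ^- j.
  apply: (mulIf zj); rewrite divfK// mulrC; apply: (canLR (mulfK _)); rewrite ?expf_neq0//.
  by rewrite -exprD; congr (_ ^+ _); lia.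
have e3 : z ^- (2 * j - 2) = z ^+ 2 * (z ^- j * z ^- j).
  have : z ^+ (2 * j - 2) * z ^+ 2 = z ^+ j * z ^+ j by rewrite -!exprD; congr (_ ^+ _); lia.
  rewrite -invfM => <-; rewrite invfM mulrCA mulfV ?mulr1// expf_neq0//.
have e4 : z ^+ (4 * j - 3) = z ^+ j * z ^+ j * (z ^+ j * z ^+ j) * z ^- 3.
  apply: (mulIf (expf_neq0 3 z0)); rewrite divfK ?expf_neq0// -!exprD.
  by congr (_ ^+ _); lia.
have e5 : z ^- (2 * j) = z ^- j * z ^- j by rewrite -invfM -exprD; congr (_ ^- _); lia.
have PF : P.[z] * f.[z] = lo.[z] + z ^+ j * z ^+ j * z^-1 * dr.[z].
  have := poly_take_drop (2 * j - 1) (P * f); rewrite -/lo -/dr => /(congr1 (fun r => r.[z])).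
  by rewrite hornerD !hornerM hornerXn e1 => <-; ring.
have pF : z ^- j * slope p z * f.[z] =
    z ^+ 2 * (z ^- j * z ^- j) * (lo.[z] + z ^+ j * z ^+ j * z^-1 * dr.[z]).
  by rewrite -PF /slope e2; ring.
have gz : g.[z] = - (z * dr.[z]) by rewrite /g hornerN hornerM hornerX.
have gVz : gV.[z^-1] = z^-1 * (z ^+ 2 * (z ^- j * z ^- j) * lo.[z]).
  by rewrite hornerM hornerX rlo e3.
have ss : (signed_split j (P * f)).[z] = lo.[z] - z ^+ j * z ^+ j * z^-1 * dr.[z].
  by rewrite /signed_split hornerD hornerN hornerM hornerXn e1.
have Nz : z ^+ j * z ^+ j * z^-1 * (P'.[z] + mu * P.[z])
    + 2 * j%:R * s0 * (P.[z] * (lo.[z] - z ^+ j * z ^+ j * z^-1 * dr.[z]))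
    = low.[z] + z ^+ j * z ^+ j * (z ^+ j * z ^+ j) * z ^- 3 * high.[z].
  rewrite -ss -e1 -e4; have := congr1 (fun r => r.[z]) NE; rewrite /N.
  move: (signed_split _ _) => S; rewrite !hornerD hornerZ !hornerM !hornerXn hornerD hornerZ.
  exact.
move=> F; split; split.
- by rewrite /F pF gz gVz; field; rewrite zj z0.
- by rewrite rf e5; ring.
- exact: h11.
- rewrite h11// !hornerD !hornerZ rlo e3 /F pF; field; rewrite zj z0 //.
- exact: k11.
- exact: k22.
- have lowE : low.[z] = z ^+ j * z ^+ j * z^-1 * (P'.[z] + mu * P.[z])
      + 2 * j%:R * s0 * (P.[z] * (lo.[z] - z ^+ j * z ^+ j * z^-1 * dr.[z]))
      - z ^+ j * z ^+ j * (z ^+ j * z ^+ j) * z ^- 3 * high.[z] by rewrite Nz addrK.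
  rewrite rlow lowE e3 hornerD hornerZ /F pF gz /slope e2 -/P -/P'.
  by field; rewrite zj z0.
Qed.

End GaugeStep.

(** * Rescaling the classical part, and conclusion *)

Section Scaling.
Variable R : realType.
Local Notation C := (Cplx R).
Local Notation C2 := (C * C)%type.
Variables (sU sV : C2 -> C) (j : nat).
Hypotheses (j2 : (2 <= j)%N) (pois : poisson sU sV).
Implicit Types p q : coeffs R j.

Lemma slopeZ c p z : slope (c *: p) z = c * slope p z.
Proof. by rewrite /slope linearZ hornerZ mulrCA. Qed.

(** The matrix diag(c, 1) conjugates T_p to T_(cp) exactly and its bracket terms cancel, so zero
    hbar parts do on both charts. *)
Lemma qstep_scale c p : c != 0 -> qpair (c *: p, 0) -> qpair (p, 0) ->
  qstep sU sV (c *: p, 0) (p, 0).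
Proof.
move=> c0 qcp qp; case: pois => hsU hsV _.
pose A : C2 -> 'M[C]_2 := fun=> mx2 c 0 0 1; pose B : C2 -> 'M[C]_2 := fun=> mx2 c^-1 0 0 1.
have AB x : A x *m B x = 1%:M.
  by rewrite mul_mx2 mx2_1; congr mx2; rewrite ?mulr0 ?mul0r ?addr0 ?add0r ?mulr1 ?mulfV.
have dA := derivatives_const setT (mx2 c 0 0 1 : 'M[C]_2).
have dB := derivatives_const setT (mx2 c^-1 0 0 1 : 'M[C]_2).
have h0 := @hmx_const R setT 0.
have refl f : eq_mod_u2 (f : C2 -> C) f by [].
apply: (@qstep_intro R sU sV j j2 hsU hsV (c *: p) 0 p A (fun=> 0) _ _ B _ _ A (fun=> 0)
  _ _ B _ _ qcp qp dA dB AB h0 dA dB AB h0) => i k.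
- apply: eq_mod_u2_UV (refl _) => x x1; congr (_ i k).
  have x1j : x.1 ^+ j != 0 by rewrite expf_neq0.
  by rewrite /A /tr /itr !mul_mx2 slopeZ; congr mx2; field.
- apply: eq_mod_u2_UV (refl _) => x x1; congr (_ i k).
  have x1j : x.1 ^+ j != 0 by rewrite expf_neq0.
  rewrite /theta /A !mulmx0 mul0mx /tr /itr /trz /tru /itru /itrz /itr_hbar /dtr.
  rewrite slope0 mul0r mx2_0 !(mul_mx2, add_mx2, opp_mx2, scale_mx2) !slopeZ.
  by congr mx2; field; rewrite ?x1 ?x1j.
Qed.

Lemma rank_toeplitzZ c p : c != 0 ->
  \rank (toeplitz j (rVpoly (c *: p))) = \rank (toeplitz j (rVpoly p)).
Proof.
move=> c0; have -> : toeplitz j (rVpoly (c *: p)) = c *: toeplitz j (rVpoly p).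
  by apply/matrixP => i k; rewrite !mxE linearZ coefZ.
exact: mxrank_scale_nz.
Qed.

End Scaling.

Theorem theorem9p9 (R : realType) (sU sV : Cplx R * Cplx R -> Cplx R) :
  minimally_degenerate sU sV ->
  forall (j : nat), (2 <= j)%N ->
  forall P : set (coeffs R j), MI P -> tame sU sV P.
Proof.
move=> md j j2 _ [p [p0 -> chp]].
have [pois _ _] := md; have [s0 s00 sU0] := minimally_degenerate_const md.
have MIp : MI (proj_point p) by exists p.
(* Every pair over the point is joined to the representative [(p, 0)]: its hbar part is removed,
   then its classical part rescaled. *)
have to_p x : proj_point p = proj_point x.1 ->
    clos_refl_sym_trans _ (@qstep R sU sV j) x (p, 0).
  case: x => q q' /= pq; have [c c0 qE] : proj_point p q.
    by rewrite pq; exists 1; rewrite ?oner_neq0 ?scale1r.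
  have qp r : qpair (q, r) by rewrite /qpair /= -pq.
  apply: (@rst_trans _ _ _ (q, 0)); apply: rst_step.
    apply: (qstep_limit j2 pois s00 sU0) => //.
    by rewrite qE rank_toeplitzZ// charge_rank.
  by rewrite qE in qp *; exact: qstep_scale.
(* A class in the stalk contains some pair over the point, hence also [(p, 0)], so it is the class
   of [(p, 0)]. *)
exists (qclass sU sV (p, 0)); apply/seteqP; split=> [c [[Q qQ ->] [x Qx px]]|_ ->].
  have Qp := rst_trans _ _ _ _ _ Qx (to_p x px).
  apply/seteqP; split=> y /= Qy.
    exact: (rst_trans _ _ _ _ _ (rst_sym _ _ _ _ Qp) Qy).
  exact: (rst_trans _ _ _ _ _ Qp Qy).
by split; [exists (p, 0)|exists (p, 0) => //; exact: rst_refl].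
Qed.
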